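(* Let $X_d$ denote either $C(\mathbb{R}^d)$ or $\mathcal{D}(\mathbb{R}^d)'$. Let $h_1,\dots,h_t\in\mathbb{R}^d$ be such that the subgroup $h_1\mathbb{Z}+\dots+h_t\mathbb{Z}$ is dense in $\mathbb{R}^d$, let $f\in X_d$, and suppose there are natural numbers $m_1,\dots,m_t$ such that for every $k\in\{1,\dots,t\}$, $\Delta_{h_k}^{m_k}f$ is (in distributional sense) a continuous exponential polynomial. Then $f$ is (in distributional sense) a continuous exponential polynomial.
   Context: $C(\mathbb{R}^d)$ is the space of continuous complex valued functions on $\mathbb{R}^d$ and $\mathcal{D}(\mathbb{R}^d)'$ the space of complex valued Schwartz distributions. For a function $f$: $(\tau_yf)(x)=f(x+y)$ and $\Delta_h^mf=\sum_{k=0}^m\binom{m}{k}(-1)^{m-k}\tau_{kh}f$. For a distribution $f$ and test function $\varphi$: $(\Delta_h^mf)\{\varphi\}=f\{\Delta_{-h}^m\varphi\}$. A continuous exponential polynomial on $\mathbb{R}^d$ is a function of the form $x\mapsto\sum_{j=1}^r p_j(x)e^{\langle\lambda_j,x\rangle}$ with polynomials $p_j$ and $\lambda_j\in\mathbb{C}^d$; a distribution is a continuous exponential polynomial in distributional sense if it is the distribution $\varphi\mapsto\int e\varphi$ induced by such a function $e$. *)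

(* Defs.v *)
From Stdlib Require Import Reals ZArith.
From mathcomp Require Import ssreflect ssrfun ssrbool eqtype ssrnat seq choice fintype finfun bigop.
Set Implicit Arguments. Unset Strict Implicit.
Open Scope R_scope.

Definition Cplx := (R * R)%type.
Definition C0 : Cplx := (0, 0).
Definition RtoC (r : R) : Cplx := (r, 0).
Definition Cadd (z w : Cplx) : Cplx := (fst z + fst w, snd z + snd w).
Definition Copp (z : Cplx) : Cplx := (- fst z, - snd z).
Definition Csub (z w : Cplx) : Cplx := Cadd z (Copp w).
Definition Cmul (z w : Cplx) : Cplx :=
  (fst z * fst w - snd z * snd w, fst z * snd w + snd z * fst w).
Definition Cexp (z : Cplx) : Cplx :=
  (exp (fst z) * cos (snd z), exp (fst z) * sin (snd z)).
Definition Cnorm (z : Cplx) : R := sqrt (fst z ^ 2 + snd z ^ 2).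
Definition Cv (u : nat -> Cplx) (l : Cplx) : Prop :=
  Un_cv (fun n => fst (u n)) (fst l) /\ Un_cv (fun n => snd (u n)) (snd l).

Definition Pt (d : nat) := 'I_d -> R.
Definition vadd d (x y : Pt d) : Pt d := fun i => x i + y i.
Definition vscal d (a : R) (x : Pt d) : Pt d := fun i => a * x i.
Definition vnorm d (x : Pt d) : R := sqrt (\big[Rplus/0]_(i < d) (x i ^ 2)).
Definition unit_vec d (i : 'I_d) : Pt d := fun j => if j == i then 1 else 0.

Definition Fn (d : nat) := Pt d -> Cplx.

Definition Ccont d (f : Fn d) : Prop :=
  forall x eps, 0 < eps -> exists del, 0 < del /\
    forall y, vnorm (vadd y (vscal (-1) x)) < del -> Cnorm (Csub (f y) (f x)) < eps.

Definition Ftau d (y : Pt d) (f : Fn d) : Fn d := fun x => f (vadd x y).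
Definition FDelta d (h : Pt d) (m : nat) (f : Fn d) : Fn d := fun x =>
  \big[Cadd/C0]_(k < m.+1)
     Cmul (RtoC (Binomial.C m k * (-1) ^ (m - k)%nat)) (Ftau (vscal (INR k) h) f x).

Definition monom d (a : 'I_d -> nat) (x : Pt d) : R := \big[Rmult/1]_(i < d) (x i ^ a i).
Definition poly_eval d (p : seq (Cplx * ('I_d -> nat))) (x : Pt d) : Cplx :=
  foldr (fun ca acc => Cadd (Cmul ca.1 (RtoC (monom ca.2 x))) acc) C0 p.
Definition cdot d (lam : 'I_d -> Cplx) (x : Pt d) : Cplx :=
  (\big[Rplus/0]_(i < d) (fst (lam i) * x i), \big[Rplus/0]_(i < d) (snd (lam i) * x i)).
Definition is_exp_poly d (e : Fn d) : Prop :=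
  exists terms : seq (seq (Cplx * ('I_d -> nat)) * ('I_d -> Cplx)),
    forall x, e x = foldr (fun pl acc => Cadd (Cmul (poly_eval pl.1 x) (Cexp (cdot pl.2 x))) acc)
                          C0 terms.

Definition has_partial d (i : 'I_d) (f g : Fn d) : Prop := forall x,
  derivable_pt_lim (fun s => fst (f (vadd x (vscal s (unit_vec i))))) 0 (fst (g x)) /\
  derivable_pt_lim (fun s => snd (f (vadd x (vscal s (unit_vec i))))) 0 (snd (g x)).
(* D l = the iterated partial derivative of f along the coordinate list l *)
Definition deriv_family d (f : Fn d) (D : seq 'I_d -> Fn d) : Prop :=
  D [::] = f /\ forall l, Ccont (D l) /\ forall i, has_partial i (D l) (D (i :: l)).
Definition supp_in d (f : Fn d) (r : R) : Prop := forall x, r < vnorm x -> f x = C0.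
Definition test_fn d (phi : Fn d) : Prop :=
  (exists D, deriv_family phi D) /\ (exists r, supp_in phi r).
Definition test_conv d (phis : nat -> Fn d) (phi : Fn d) : Prop :=
  exists r, supp_in phi r /\ (forall n, supp_in (phis n) r) /\
  exists (Ds : nat -> seq 'I_d -> Fn d) (D : seq 'I_d -> Fn d),
    deriv_family phi D /\ (forall n, deriv_family (phis n) (Ds n)) /\
    forall l eps, 0 < eps -> exists N, forall n x, (N <= n)%nat ->
      Cnorm (Csub (Ds n l x) (D l x)) < eps.

(* a functional, only its values on test functions matter *)
Definition distribution d (T : Fn d -> Cplx) : Prop :=
  (forall phi psi, test_fn phi -> test_fn psi ->
     T (fun x => Cadd (phi x) (psi x)) = Cadd (T phi) (T psi)) /\
  (forall c phi, test_fn phi -> T (fun x => Cmul c (phi x)) = Cmul c (T phi)) /\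
  (forall phis phi, (forall n, test_fn (phis n)) -> test_fn phi ->
     test_conv phis phi -> Cv (fun n => T (phis n)) (T phi)).

Definition DeltaD d (h : Pt d) (m : nat) (T : Fn d -> Cplx) : Fn d -> Cplx :=
  fun phi => T (FDelta (vscal (-1) h) m phi).

(* Riemann sums on the grid (Z/(n+1))^d cut to the cube [-n^2/(n+1), n^2/(n+1)]^d;
   for continuous compactly supported g they converge to the integral over R^d. *)
Definition riemann_sum d (g : Fn d) (n : nat) : Cplx :=
  \big[Cadd/C0]_(k : {ffun 'I_d -> 'I_(S (2 * n * n)%nat)})
     Cmul (RtoC (/ (INR n.+1 ^ d)))
          (g (fun i => (INR (k i) - INR (n * n)%nat) / INR n.+1)).

(* T is the distribution phi |-> int e phi *)
Definition induced d (e : Fn d) (T : Fn d -> Cplx) : Prop :=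
  forall phi, test_fn phi -> Cv (riemann_sum (fun x => Cmul (e x) (phi x))) (T phi).
Definition dist_exp_poly d (T : Fn d -> Cplx) : Prop :=
  exists e, is_exp_poly e /\ induced e T.

Definition dense_subgroup d t (h : 'I_t -> Pt d) : Prop :=
  forall (x : Pt d) eps, 0 < eps -> exists z : 'I_t -> Z,
    vnorm (vadd (fun i => \big[Rplus/0]_(k < t) (IZR (z k) * h k i)) (vscal (-1) x)) < eps.

(* Main.v *)
From Coquelicot Require Complex.
From Coquelicot Require Import Rcomplements Hierarchy Derive RInt RInt_analysis Continuity.
Require Import Defs.
From Stdlib Require Import Reals ZArith Lra Lia.
From Stdlib Require Import ClassicalEpsilon FunctionalExtensionality.
From HB Require Import structures.
From mathcomp Require Import ssreflect ssrfun ssrbool eqtype ssrnat seq choice fintype finfun bigop.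
From mathcomp Require Import Rstruct ssrZ.
From mathcomp Require ssralg poly complex.
Open Scope R_scope.

(** Both cases rest on one finite-dimensionality argument.  Let [A y] be the translate by [y] of the
    given object, seen as a function of a point (case C(R^d)) or of a test function (case D').  Exponential
    polynomials have finite-dimensional spaces of translates, so modulo a finite-dimensional space
    [A] satisfies a two-sided recurrence in each direction [h k]; hence [A] stays in a
    finite-dimensional space [V] on the whole group.  A finite-dimensional function space is
    reproduced by finitely many points, [w = sum_i w(x_i) v_i], an identity that survives
    limits; density and continuity give [A y x = sum_i A y x_i * v_i x] for every [y].

    A continuous function of finite rank is an exponential polynomial.  One variable at a time, the
    translates span a finite-dimensional space; it is invariant under differentiation (look at
    averages of translates), so the function solves a linear ODE with constant coefficients.

    For a distribution [T], put [F_phi y = T (phi (. - y))].  The finite rank identity shows that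
    [F_phi = sum_i v_i(phi) F_(phi_i)] with exponential polynomials [F_(phi_i)].  Commutativity of
    convolution reads [int F_psi phi = int F_phi psi], so if [phi] is orthogonal to all
    [F_(phi_i)], then [F_phi] is orthogonal to every test function, whence [T phi = F_phi 0 = 0].  Thus [T]
    is a linear combination of the functionals [phi |-> int F_(phi_i) phi]. *)

(** The reproducing identity plays the part of a basis with its dual basis, in a form whose
    coefficients are values of [w] at fixed points. It is used in three ways. Being pointwise, it
    survives limits along sequences as well as integration and differentiation in a parameter.
    Applied to [f (x + y)] it separates variables, and so splits off one coordinate at a time.
    Applied to functionals, whose points are test functions, it yields the projection
    [phi - sum_i v_i(phi) phi_i] onto the common kernel of finitely many exponential polynomials.
    The recurrence along [h k] runs in both directions because the first and last coefficients of a
    difference operator, [(-1)^m] and [1], are nonzero. For the integral, [induced] prescribes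
    Riemann sums whose mesh and range are both tied to [n]; they are compared with sums whose range
    is fixed by the support, from which linearity, invariance under translation and reflection, and
    strict positivity follow. *)

(** * Complex arithmetic *)

Notation Cone := (RtoC 1).
Definition Cinv : Cplx -> Cplx := Complex.Cinv.
Definition Cdiv (z w : Cplx) : Cplx := Cmul z (Cinv w).
Definition Cconj (z : Cplx) : Cplx := (fst z, - snd z).

(** The operations on [Cplx] are convertible to those of Coquelicot, so its results apply as they
    stand; the same conversion yields the basic facts on [Cnorm]. *)
Lemma Cplx_field_theory : field_theory C0 Cone Cadd Cmul Csub Copp Cdiv Cinv eq.
Proof. exact: Complex.C_field_theory. Qed.

Add Field Cplx_field : Cplx_field_theory.

Lemma Cadd0z z : Cadd C0 z = z. Proof. ring. Qed.
Lemma CaddA : associative Cadd. Proof. by move=> *; ring. Qed.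
Lemma CaddC : commutative Cadd. Proof. by move=> *; ring. Qed.
Lemma CmulA : associative Cmul. Proof. by move=> *; ring. Qed.
Lemma CmulC : commutative Cmul. Proof. by move=> *; ring. Qed.
Lemma Cmul1z : left_id Cone Cmul. Proof. by move=> *; ring. Qed.
Lemma Cmul0z : left_zero C0 Cmul. Proof. by move=> *; ring. Qed.
Lemma Cmulz0 : right_zero C0 Cmul. Proof. by move=> *; ring. Qed.
Lemma CmulDl : left_distributive Cmul Cadd. Proof. by move=> *; ring. Qed.
Lemma CmulDr : right_distributive Cmul Cadd. Proof. by move=> *; ring. Qed.
HB.instance Definition _ := Monoid.isComLaw.Build Cplx C0 Cadd CaddA CaddC Cadd0z.
HB.instance Definition _ := Monoid.isComLaw.Build Cplx Cone Cmul CmulA CmulC Cmul1z.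
HB.instance Definition _ := Monoid.isMulLaw.Build Cplx C0 Cmul Cmul0z Cmulz0.
HB.instance Definition _ := Monoid.isAddLaw.Build Cplx Cmul Cadd CmulDl CmulDr.

Lemma RtoCD a b : RtoC (a + b) = Cadd (RtoC a) (RtoC b).
Proof. by rewrite /RtoC /Cadd /=; congr pair; ring. Qed.
Lemma RtoCM a b : RtoC (a * b) = Cmul (RtoC a) (RtoC b).
Proof. by rewrite /RtoC /Cmul /=; congr pair; ring. Qed.
Lemma RtoCN a : RtoC (- a) = Copp (RtoC a).
Proof. by rewrite /RtoC /Copp /=; congr pair; ring. Qed.
Lemma RtoCB a b : RtoC (a - b) = Csub (RtoC a) (RtoC b).
Proof. by rewrite /Rminus RtoCD RtoCN. Qed.
Lemma RtoC_inj a b : RtoC a = RtoC b -> a = b. Proof. by case. Qed.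

Lemma CexpD z w : Cexp (Cadd z w) = Cmul (Cexp z) (Cexp w).
Proof. by rewrite /Cexp /Cmul /= exp_plus cos_plus sin_plus; congr pair; ring. Qed.
Lemma Cexp0 : Cexp C0 = Cone.
Proof. by rewrite /Cexp /= exp_0 cos_0 sin_0; congr pair; ring. Qed.
Lemma Csub_eq0 z w : Csub z w = C0 -> z = w.
Proof. by move=> e; have ->: z = Cadd (Csub z w) w; [ring | rewrite e; ring]. Qed.

Lemma Cnorm_ge0 z : 0 <= Cnorm z. Proof. exact: sqrt_pos. Qed.
Lemma Cnorm_triangle z w : Cnorm (Cadd z w) <= Cnorm z + Cnorm w.
Proof. exact: Complex.Cmod_triangle. Qed.
Lemma CnormM z w : Cnorm (Cmul z w) = Cnorm z * Cnorm w.
Proof. exact: Complex.Cmod_mult. Qed.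
Lemma Cnorm_opp z : Cnorm (Copp z) = Cnorm z.
Proof. exact: Complex.Cmod_opp. Qed.
Lemma Cnorm0 : Cnorm C0 = 0. Proof. exact: Complex.Cmod_0. Qed.
Lemma Cnorm_eq0 z : Cnorm z = 0 -> z = C0. Proof. exact: Complex.Cmod_eq_0. Qed.
Lemma Cnorm_RtoC x : Cnorm (RtoC x) = Rabs x. Proof. exact: Complex.Cmod_R. Qed.
Lemma Cnorm_sub_sym z w : Cnorm (Csub z w) = Cnorm (Csub w z).
Proof. by rewrite -Cnorm_opp; congr Cnorm; ring. Qed.
Lemma Cnorm_fst z : Rabs (fst z) <= Cnorm z.
Proof.
rewrite /Cnorm -sqrt_Rsqr_abs; apply: sqrt_le_1_alt.
by rewrite /Rsqr; nra.
Qed.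
Lemma Cnorm_snd z : Rabs (snd z) <= Cnorm z.
Proof.
rewrite /Cnorm -sqrt_Rsqr_abs; apply: sqrt_le_1_alt.
by rewrite /Rsqr; nra.
Qed.
Lemma Cnorm_le_sum z : Cnorm z <= Rabs (fst z) + Rabs (snd z).
Proof.
have ->: z = Cadd (RtoC (fst z)) (Cmul (0, 1) (RtoC (snd z))).
  by case: z => a b; rewrite /Cadd /Cmul /RtoC /=; congr pair; ring.
apply: Rle_trans (Cnorm_triangle _ _) _.
rewrite CnormM !Cnorm_RtoC.
have ->: Cnorm (0, 1) = 1.
  by rewrite /Cnorm /= -[RHS]sqrt_1; congr sqrt; ring.
by rewrite /Cadd /Cmul /RtoC /=; ring_simplify (fst z + (0 * snd z - 1 * 0)) (0 + (0 * 0 + 1 * snd z)); lra.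
Qed.

Lemma Cnorm_small_eq0 z : (forall eps, 0 < eps -> Cnorm z < eps) -> z = C0.
Proof.
move=> H; apply: Cnorm_eq0; have := Cnorm_ge0 z.
by case: (Rle_lt_or_eq_dec _ _ (Cnorm_ge0 z)) => // /H; lra.
Qed.

Lemma Cnorm_sum_le (I : Type) (s : seq I) (F : I -> Cplx) (B : I -> R) :
  (forall i, Cnorm (F i) <= B i) ->
  Cnorm (\big[Cadd/C0]_(i <- s) F i) <= \big[Rplus/0]_(i <- s) B i.
Proof.
move=> H; elim: s => [|a s IH]; first by rewrite !big_nil Cnorm0; lra.
rewrite !big_cons; apply: Rle_trans (Cnorm_triangle _ _) _.
exact: Rplus_le_compat (H a) IH.
Qed.

(** * Finite-dimensional spaces of complex functions *)

Section Span.
Variable X : Type.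
Implicit Types (u v w : X -> Cplx) (V : (X -> Cplx) -> Prop).

(** The linear span of a list, encoded by peeling off one generator at a time, so that statements
    about spans go by induction on the list without indexed coefficients. *)
Fixpoint insp (s : seq (X -> Cplx)) w : Prop :=
  if s is u :: s' then exists c, insp s' (fun x => Csub (w x) (Cmul c (u x)))
  else forall x, w x = C0.

Definition subspace V :=
  V (fun=> C0) /\ forall c u v, V u -> V v -> V (fun x => Cadd (u x) (Cmul c (v x))).

Lemma insp_subspace s : subspace (insp s).
Proof.
elim: s => [|u s [IH0 IH]]; first by split=> //= c u v Hu Hv x; rewrite Hu Hv; ring.
split.
  exists C0; have := IH0; congr (insp s _); apply: functional_extensionality => x; ring.
move=> c v w [a Ha] [b Hb]; exists (Cadd a (Cmul c b)).
have := IH c _ _ Ha Hb; congr (insp s _); apply: functional_extensionality => x; ring.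
Qed.

Lemma subspaceD V u v : subspace V -> V u -> V v -> V (fun x => Cadd (u x) (v x)).
Proof.
move=> [_ H] Hu Hv; have := H Cone u v Hu Hv.
by congr V; apply: functional_extensionality => x; ring.
Qed.

Lemma subspaceZ V c u : subspace V -> V u -> V (fun x => Cmul c (u x)).
Proof.
move=> [H0 H] Hu; have := H c _ u H0 Hu.
by congr V; apply: functional_extensionality => x; ring.
Qed.

Lemma subspaceB V u v : subspace V -> V u -> V v -> V (fun x => Csub (u x) (v x)).
Proof.
move=> [_ H] Hu Hv; have := H (Copp Cone) u v Hu Hv.
by congr V; apply: functional_extensionality => x; ring.
Qed.

Lemma subspace_sum V (I : Type) (r : seq I) (P : pred I) (F : I -> X -> Cplx) :
  subspace V -> (forall i, P i -> V (F i)) ->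
  V (fun x => \big[Cadd/C0]_(i <- r | P i) F i x).
Proof.
move=> sV H; elim: r => [|a r IH].
  have := proj1 sV.
  by congr V; apply: functional_extensionality => x; rewrite big_nil.
case Pa: (P a); last first.
  by have := IH; congr V; apply: functional_extensionality => x; rewrite big_cons Pa.
have := subspaceD _ _ _ sV (H a Pa) IH.
by congr V; apply: functional_extensionality => x; rewrite big_cons Pa.
Qed.

Lemma subspaceI V W : subspace V -> subspace W -> subspace (fun w => V w /\ W w).
Proof. by move=> [a b] [c d]; split=> // k u v [? ?] [? ?]; split; auto. Qed.

Lemma insp_cons u s w : insp s w -> insp (u :: s) w.
Proof.
move=> H; exists C0; have := H.
by congr insp; apply: functional_extensionality => x; ring.
Qed.

Lemma insp_catl s t w : insp s w -> insp (s ++ t) w.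
Proof.
elim: s w => [|u s IH] w /=; last by move=> [c Hc]; exists c; exact: IH.
move=> H; have ->: w = (fun=> C0) by apply: functional_extensionality.
exact: (proj1 (insp_subspace t)).
Qed.

Lemma insp_catr s t w : insp t w -> insp (s ++ t) w.
Proof. by elim: s => [//|u s IH] H; apply: insp_cons; exact: IH. Qed.

Lemma insp_nth s i : (i < size s)%N -> insp s (nth (fun=> C0) s i).
Proof.
elim: s i => [//|u s IH] [|i] /= H; last exact: (insp_cons _ _ _ (IH i H)).
exists Cone; have := proj1 (insp_subspace s).
by congr insp; apply: functional_extensionality => x; ring.
Qed.

Lemma insp_in V s w : subspace V ->
  (forall i, (i < size s)%N -> V (nth (fun=> C0) s i)) -> insp s w -> V w.
Proof.
move=> sV; elim: s w => [|u s IH] w H /=.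
  move=> Hw; have := proj1 sV.
  by congr V; apply: functional_extensionality => x; rewrite Hw.
move=> [c Hc]; have Vu := H O isT.
have Hr := IH _ (fun i hi => H i.+1 hi) Hc.
have := proj2 sV c _ _ Hr Vu.
by congr V; apply: functional_extensionality => x /=; ring.
Qed.

Lemma insp_sum s w : insp s w -> exists c : nat -> Cplx,
  forall x, w x = \big[Cadd/C0]_(i < size s) Cmul (c i) (nth (fun=> C0) s i x).
Proof.
elim: s w => [|u s IH] w /=; first by move=> H; exists (fun=> C0) => x; rewrite big_ord0.
move=> [a /IH [c Hc]]; exists (fun i => if i is j.+1 then c j else a) => x.
by rewrite big_ord_recl /= -Hc; ring.
Qed.

Definition rsum (l : seq (X * (X -> Cplx))) w : X -> Cplx :=
  fun x => \big[Cadd/C0]_(p <- l) Cmul (w p.1) (p.2 x).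

Lemma rsumD l c u v x :
  rsum l (fun x => Cadd (u x) (Cmul c (v x))) x = Cadd (rsum l u x) (Cmul c (rsum l v x)).
Proof.
rewrite /rsum (big_distrr (times := Cmul)) /= -big_split /=.
by apply: eq_bigr => p _; ring.
Qed.

Definition reproduces V (l : seq (X * (X -> Cplx))) :=
  (forall i p0, (i < size l)%N -> V (nth p0 l i).2) /\ forall w, V w -> forall x, w x = rsum l w x.

Lemma rsum_in V l w : subspace V ->
  (forall i p0, (i < size l)%N -> V (nth p0 l i).2) -> V (rsum l w).
Proof.
move=> sV; elim: l => [|p l IH] H.
  have := proj1 sV.
  by congr V; apply: functional_extensionality => x; rewrite /rsum big_nil.
have Vp := H O p isT; have Vl := IH (fun i p0 hi => H i.+1 p0 hi).
have := proj2 sV (w p.1) _ _ Vl Vp.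
by congr V; apply: functional_extensionality => x; rewrite /rsum big_cons /=; ring.
Qed.

(** Induction on the spanning list, in the manner of Gaussian elimination. The list [l] reproduces
    the part of [V] inside the span of [s]. If [V] is larger, that part has codimension one in [V],
    and one further point suffices. *)
Lemma reproducing_points V s : subspace V -> (forall w, V w -> insp s w) ->
  exists l, reproduces V l.
Proof.
elim: s V => [|u s IH] V sV H.
  by exists [::]; split=> // w /H Hw x; rewrite Hw /rsum big_nil.
have [l [Vl El]] := IH _ (subspaceI _ _ sV (insp_subspace s)) (fun w Hw => proj2 Hw).
have VE w : V (rsum l w).
  by apply: rsum_in => // i p0 /(Vl i p0) [].
have SE w : insp s (rsum l w).
  by apply: rsum_in => [|i p0 /(Vl i p0) []//]; exact: insp_subspace.
case: (classic (forall w, V w -> insp s w)) => [all_s|].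
  by exists l; split=> [i p0 /(Vl i p0) []//|w Vw]; apply: El; auto.
move=> nall; have [w0 nw] := not_all_ex_not _ _ nall.
have [Vw0 nw0] := imply_to_and _ _ nw.
have [c0 Hc0] := H _ Vw0.
have nc0 : c0 <> C0.
  move=> e; apply: nw0; move: Hc0; rewrite e.
  by congr insp; apply: functional_extensionality => x; ring.
(* The residue [w1] is nonzero somewhere: otherwise [w0] would equal [rsum l w0], which lies in the
   span of [s]. *)
pose w1 x := Csub (w0 x) (rsum l w0 x).
have [x0 nx0] : exists x0, w1 x0 <> C0.
  apply: not_all_ex_not => w10; apply: nw0; have := SE w0.
  by congr insp; apply: functional_extensionality => x; apply/esym/Csub_eq0/w10.
pose v0 x := Cdiv (w1 x) (w1 x0).
have Vv0 : V v0.
  have := subspaceZ _ (Cinv (w1 x0)) _ sV (subspaceB _ _ _ sV Vw0 (VE w0)).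
  by congr V; apply: functional_extensionality => x; rewrite /v0 /Cdiv /w1; ring.
(* [v0] takes the value 1 at [x0], and the old functions are corrected by multiples of [v0] so as to
   vanish at [x0], as in a dual basis. *)
exists ((x0, v0) :: [seq (p.1, fun x => Csub (p.2 x) (Cmul (p.2 x0) (v0 x))) | p <- l]); split.
  move=> [|i] p0 //= hi; rewrite size_map in hi.
  rewrite (nth_map p0) //=; apply: subspaceB => //; first by case: (Vl i p0 hi).
  exact: subspaceZ.
move=> w Vw x; rewrite /rsum big_cons big_map /=.
have ->: \big[Cadd/C0]_(j <- l) Cmul (w j.1) (Csub (j.2 x) (Cmul (j.2 x0) (v0 x))) =
   Csub (rsum l w x) (Cmul (rsum l w x0) (v0 x)).
  have ->: Csub (rsum l w x) (Cmul (rsum l w x0) (v0 x)) =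
     Cadd (rsum l w x) (Cmul (Copp (v0 x)) (rsum l w x0)) by ring.
  rewrite /rsum (big_distrr (times := Cmul)) /= -big_split /=.
  by apply: eq_bigr => p _; ring.
have [c Hc] := H _ Vw.
(* With this [a] the components along [u] cancel in [w - a w0], which therefore falls under the
   induction hypothesis; so the residue of [w] is [a] times that of [w0]. *)
pose a := Cdiv c c0.
have Hw' : V (fun x => Cadd (w x) (Cmul (Copp a) (w0 x))) /\
           insp s (fun x => Cadd (w x) (Cmul (Copp a) (w0 x))).
  split; first exact: (proj2 sV).
  have := proj2 (insp_subspace s) (Copp a) _ _ Hc Hc0.
  by congr insp; apply: functional_extensionality => y; rewrite /a; field.
have key y : Csub (w y) (rsum l w y) = Cmul a (w1 y).
  have e := El _ Hw' y; rewrite rsumD in e.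
  have {}e : w y = Cadd (Cadd (rsum l w y) (Cmul (Copp a) (rsum l w0 y))) (Cmul a (w0 y)).
    by rewrite -e; ring.
  by rewrite e /w1; ring.
have -> : Cadd (Cmul (w x0) (v0 x)) (Csub (rsum l w x) (Cmul (rsum l w x0) (v0 x))) =
  Cadd (rsum l w x) (Cmul (Csub (w x0) (rsum l w x0)) (v0 x)) by ring.
rewrite key /v0.
have -> : Cmul (Cmul a (w1 x0)) (Cdiv (w1 x) (w1 x0)) = Cmul a (w1 x) by field.
by rewrite -key; ring.
Qed.

End Span.

Arguments insp {X}.
Arguments subspace {X}.
Arguments rsum {X}.
Arguments reproduces {X}.

(** * Splitting off a root of a monic complex polynomial *)

Section LinearFactor.
Import ssralg poly complex GRing.Theory.

Let toc (z : Cplx) : complex R := (fst z +i* snd z)%C.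
Let ofc (z : complex R) : Cplx := (Re z, Im z).

Let ofcD z w : ofc (z + w)%R = Cadd (ofc z) (ofc w). Proof. by case: z; case: w. Qed.
Let ofcM z w : ofc (z * w)%R = Cmul (ofc z) (ofc w). Proof. by case: z; case: w. Qed.
Let ofcN z : ofc (- z)%R = Copp (ofc z). Proof. by case: z. Qed.
Let ofcK z : ofc (toc z) = z. Proof. by case: z. Qed.

(** The numbers [a] are the lower coefficients of a monic polynomial of degree [n.+1], [lam] is one
    of its roots, and [b] lists the coefficients of the quotient by [X - lam]. This splits a
    first-order factor off a differential operator. *)
Lemma monic_linear_factor n (a : nat -> Cplx) : exists lam (b : nat -> Cplx),
  b n = Cone /\ a O = Copp (Cmul lam (b O)) /\
  forall k, (k < n)%N -> a k.+1 = Csub (b k) (Cmul lam (b k.+1)).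
Proof.
pose p : {poly complex R} := ('X^(n.+1) + \poly_(k < n.+1) toc (a k))%R.
have sp : size p = n.+2.
  by rewrite size_polyDl size_polyXn // ltnS; apply: size_poly.
have [lam /factor_theorem [q pq]] : exists x, root p x.
  by apply/closed_rootP; rewrite sp.
have mon : (lead_coef ('X - lam%:P : {poly complex R}) = 1)%R by rewrite lead_coefXsubC.
have qn0 : q != 0%R.
  by apply/eqP => q0; move: sp; rewrite pq q0 mul0r size_poly0.
have sq : size q = n.+1.
  by apply: succn_inj; rewrite -sp pq size_Mmonic ?monicXsubC // size_XsubC addn2.
have E0 : toc (a O) = (- (lam * q`_0))%R.
  have := congr1 (fun r : {poly complex R} => r`_0)%R pq.
  rewrite /p /= coefD coefXn coef_poly /= add0r => ->.
  by rewrite mulrBr coefB coefMX coefMC /= sub0r mulrC.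
have ES k : (k < n)%N -> toc (a k.+1) = (q`_k - lam * q`_k.+1)%R.
  move=> hk; have := congr1 (fun r : {poly complex R} => r`_k.+1)%R pq.
  rewrite /p /= coefD coefXn coef_poly /= eqSS ltnS hk (ltn_eqF hk) add0r => ->.
  by rewrite mulrBr coefB coefMX coefMC /= mulrC.
have En : (q`_n = 1)%R.
  have := congr1 (fun r : {poly complex R} => r`_n.+1)%R pq.
  rewrite /p /= coefD coefXn coef_poly /= eqxx ltnn addr0.
  rewrite mulrBr coefB coefMX coefMC /= [(q`_n.+1)%R]nth_default ?sq // mul0r subr0.
  by move=> <-.
exists (ofc lam), (fun k => ofc (q`_k)%R); split; [|split].
- by rewrite En.
- by rewrite -[LHS]ofcK E0 ofcN ofcM.
- by move=> k /ES e; rewrite -[LHS]ofcK e ofcD ofcN ofcM.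
Qed.

End LinearFactor.

(** * Functions of one variable with a finite-dimensional space of translates *)

Definition cderiv (f : R -> Cplx) (t : R) (l : Cplx) : Prop :=
  derivable_pt_lim (fun s => fst (f s)) t (fst l) /\
  derivable_pt_lim (fun s => snd (f s)) t (snd l).

Lemma cderiv_eq f g t l l' : cderiv f t l -> (forall s, f s = g s) -> l = l' -> cderiv g t l'.
Proof. by move=> H /functional_extensionality <- <-. Qed.

Lemma cderiv_unique f t l l' : cderiv f t l -> cderiv f t l' -> l = l'.
Proof.
case: l l' => [a b] [a' b'] [/= H1 H2] [/= H3 H4].
by rewrite (uniqueness_limite _ _ _ _ H1 H3) (uniqueness_limite _ _ _ _ H2 H4).
Qed.

Lemma cderiv_const c t : cderiv (fun=> c) t C0.
Proof. by split; exact: derivable_pt_lim_const. Qed.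

Lemma cderiv_add f g t a b : cderiv f t a -> cderiv g t b ->
  cderiv (fun s => Cadd (f s) (g s)) t (Cadd a b).
Proof. by move=> [? ?] [? ?]; split; apply: derivable_pt_lim_plus. Qed.

Lemma cderiv_mul f g t a b : cderiv f t a -> cderiv g t b ->
  cderiv (fun s => Cmul (f s) (g s)) t (Cadd (Cmul a (g t)) (Cmul (f t) b)).
Proof.
move=> [f1 f2] [g1 g2]; split=> /=.
  have -> : fst a * fst (g t) - snd a * snd (g t) + (fst (f t) * fst b - snd (f t) * snd b) =
     (fst a * fst (g t) + fst (f t) * fst b) - (snd a * snd (g t) + snd (f t) * snd b) by ring.
  exact: (derivable_pt_lim_minus _ _ _ _ _ (derivable_pt_lim_mult _ _ _ _ _ f1 g1)
            (derivable_pt_lim_mult _ _ _ _ _ f2 g2)).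
have -> : fst a * snd (g t) + snd a * fst (g t) + (fst (f t) * snd b + snd (f t) * fst b) =
   (fst a * snd (g t) + fst (f t) * snd b) + (snd a * fst (g t) + snd (f t) * fst b) by ring.
exact: (derivable_pt_lim_plus _ _ _ _ _ (derivable_pt_lim_mult _ _ _ _ _ f1 g2)
          (derivable_pt_lim_mult _ _ _ _ _ f2 g1)).
Qed.

Lemma cderiv_scal c f t a : cderiv f t a -> cderiv (fun s => Cmul c (f s)) t (Cmul c a).
Proof.
move=> H; apply: cderiv_eq (cderiv_mul _ _ _ _ _ (cderiv_const c t) H) _ _ => //; ring.
Qed.

Lemma cderiv_sum (I : Type) (r : seq I) (F : I -> R -> Cplx) t (L : I -> Cplx) :
  (forall i, cderiv (F i) t (L i)) ->
  cderiv (fun s => \big[Cadd/C0]_(i <- r) F i s) t (\big[Cadd/C0]_(i <- r) L i).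
Proof.
move=> H; elim: r => [|i r IH].
  by apply: cderiv_eq (cderiv_const C0 t) _ _ => [s|]; rewrite big_nil.
by apply: cderiv_eq (cderiv_add _ _ _ _ _ (H i) IH) _ _ => [s|]; rewrite big_cons.
Qed.

Lemma cderiv_RtoC f t l : derivable_pt_lim f t l -> cderiv (fun s => RtoC (f s)) t (RtoC l).
Proof. by move=> H; split=> //=; exact: derivable_pt_lim_const. Qed.

Lemma cderiv_affine f a b t l : cderiv f (a * t + b) l ->
  cderiv (fun s => f (a * s + b)) t (Cmul (RtoC a) l).
Proof.
have Ha : derivable_pt_lim (fun s => a * s + b) t a.
  have := derivable_pt_lim_plus _ _ _ _ _
     (derivable_pt_lim_scal _ a t _ (derivable_pt_lim_id t)) (derivable_pt_lim_const b t).
  by rewrite Rmult_1_r Rplus_0_r.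
move=> [H1 H2]; split=> /=.
  have -> : a * fst l - 0 * snd l = fst l * a by ring.
  exact: (derivable_pt_lim_comp _ _ _ _ _ Ha H1).
have -> : a * snd l + 0 * fst l = snd l * a by ring.
exact: (derivable_pt_lim_comp _ _ _ _ _ Ha H2).
Qed.

Lemma cderiv_shift f b t l : cderiv f (t + b) l -> cderiv (fun s => f (s + b)) t l.
Proof.
move=> H; have : cderiv f (1 * t + b) l by rewrite Rmult_1_l.
move/cderiv_affine => H'; apply: cderiv_eq H' _ _ => [s|]; last by ring.
by rewrite Rmult_1_l.
Qed.

Lemma cderiv_exp mu t :
  cderiv (fun s => Cexp (Cmul mu (RtoC s))) t (Cmul mu (Cexp (Cmul mu (RtoC t)))).
Proof.
have E s : Cexp (Cmul mu (RtoC s)) =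
  Cmul (RtoC (exp (fst mu * s))) (cos (snd mu * s), sin (snd mu * s)).
  by rewrite /Cexp /Cmul /RtoC /=; congr pair; rewrite !Rmult_0_r !Rmult_0_l ?Rplus_0_l ?Rminus_0_r ?Rplus_0_r.
have lin a : derivable_pt_lim (fun s => a * s) t a.
  by have := derivable_pt_lim_scal _ a t _ (derivable_pt_lim_id t); rewrite Rmult_1_r.
have He : cderiv (fun s => RtoC (exp (fst mu * s))) t (RtoC (exp (fst mu * t) * fst mu)).
  apply: cderiv_RtoC.
  exact: (derivable_pt_lim_comp _ _ _ _ _ (lin (fst mu)) (derivable_pt_lim_exp _)).
have Hc : cderiv (fun s => (cos (snd mu * s), sin (snd mu * s)) : Cplx) t
   (- sin (snd mu * t) * snd mu, cos (snd mu * t) * snd mu).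
  split.
    exact: (derivable_pt_lim_comp _ _ _ _ _ (lin (snd mu)) (derivable_pt_lim_cos _)).
  exact: (derivable_pt_lim_comp _ _ _ _ _ (lin (snd mu)) (derivable_pt_lim_sin _)).
apply: cderiv_eq (cderiv_mul _ _ _ _ _ He Hc) _ _ => [s|]; first by rewrite E.
by rewrite E /Cadd /Cmul /RtoC /=; congr pair; ring.
Qed.

Lemma zero_deriv_const f : (forall t, cderiv f t C0) -> forall t, f t = f 0.
Proof.
have aux (g : R -> R) : (forall t, derivable_pt_lim g t 0) -> forall t, g t = g 0.
  move=> H t.
  have pr : derivable g by move=> s; exists 0; exact: H.
  apply: (null_derivative_1 g pr) => s.
  by apply: derive_pt_eq_0; exact: H.
move=> H t; rewrite [LHS]surjective_pairing [RHS]surjective_pairing.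
by congr pair; apply: (aux (fun s => _ (f s))) => s; case: (H s).
Qed.

Definition ccont1 (f : R -> Cplx) := forall t,
  continuity_pt (fun s => fst (f s)) t /\ continuity_pt (fun s => snd (f s)) t.

Lemma primitive_exists f : ccont1 f -> exists F, forall t, cderiv F t (f t).
Proof.
have aux (g : R -> R) : (forall t, continuity_pt g t) ->
    forall t, derivable_pt_lim (fun s => RInt g 0 s) t (g t).
  move=> H t; apply/is_derive_Reals.
  have Hc s : continuous g s by apply/continuity_pt_filterlim.
  apply: is_derive_RInt (Hc t).
  exists (mkposreal 1 Rlt_0_1) => s _.
  by apply/RInt_correct/ex_RInt_continuous => z _.
move=> H; exists (fun t => (RInt (fun s => fst (f s)) 0 t, RInt (fun s => snd (f s)) 0 t)) => t.
by split=> /=; apply: aux => s; case: (H s).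
Qed.

Inductive exp_poly1 : (R -> Cplx) -> Prop :=
| exp_poly1_0 : exp_poly1 (fun=> C0)
| exp_poly1_add f c k mu : exp_poly1 f ->
    exp_poly1 (fun t => Cadd (f t) (Cmul c (Cmul (RtoC (t ^ k)) (Cexp (Cmul mu (RtoC t)))))).

Lemma exp_poly1_ext f g : exp_poly1 f -> (forall t, f t = g t) -> exp_poly1 g.
Proof. by move=> H /functional_extensionality <-. Qed.

Lemma exp_poly1D f g : exp_poly1 f -> exp_poly1 g -> exp_poly1 (fun t => Cadd (f t) (g t)).
Proof.
move=> Hf; elim=> [|h c k mu _ IH]; first by apply: exp_poly1_ext Hf _ => t; ring.
by apply: exp_poly1_ext (exp_poly1_add _ c k mu IH) _ => t; ring.
Qed.

Lemma exp_poly1Z a f : exp_poly1 f -> exp_poly1 (fun t => Cmul a (f t)).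
Proof.
elim=> [|h c k mu _ IH]; first by apply: exp_poly1_ext exp_poly1_0 _ => t; ring.
by apply: exp_poly1_ext (exp_poly1_add _ (Cmul a c) k mu IH) _ => t; ring.
Qed.

Lemma exp_poly1_mulexp nu f : exp_poly1 f ->
  exp_poly1 (fun t => Cmul (Cexp (Cmul nu (RtoC t))) (f t)).
Proof.
elim=> [|h c k mu _ IH]; first by apply: exp_poly1_ext exp_poly1_0 _ => t; ring.
apply: exp_poly1_ext (exp_poly1_add _ c k (Cadd nu mu) IH) _ => t.
have -> : Cmul (Cadd nu mu) (RtoC t) = Cadd (Cmul nu (RtoC t)) (Cmul mu (RtoC t)) by ring.
by rewrite CexpD; ring.
Qed.

Lemma exp_poly1_monom k mu :
  exp_poly1 (fun t => Cmul (RtoC (t ^ k)) (Cexp (Cmul mu (RtoC t)))).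
Proof. by apply: exp_poly1_ext (exp_poly1_add _ Cone k mu exp_poly1_0) _ => t; ring. Qed.

Lemma exp_poly1_const c : exp_poly1 (fun=> c).
Proof.
apply: exp_poly1_ext (exp_poly1Z c _ (exp_poly1_monom O C0)) _ => t /=.
by rewrite (_ : Cmul C0 _ = C0) ?Cexp0; ring.
Qed.

Lemma cderiv_monom k mu t :
  cderiv (fun t => Cmul (RtoC (t ^ k.+1)) (Cexp (Cmul mu (RtoC t)))) t
   (Cadd (Cmul (RtoC (INR k.+1)) (Cmul (RtoC (t ^ k)) (Cexp (Cmul mu (RtoC t)))))
         (Cmul mu (Cmul (RtoC (t ^ k.+1)) (Cexp (Cmul mu (RtoC t)))))).
Proof.
have Hp := cderiv_RtoC _ _ _ (derivable_pt_lim_pow t k.+1).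
apply: cderiv_eq (cderiv_mul _ _ _ _ _ Hp (cderiv_exp mu t)) _ _ => //.
by rewrite RtoCM /=; ring.
Qed.

(** For [t^k e^(mu t)] with [mu] nonzero, integration by parts lowers [k]; [mu = 0] is the power
    rule and is treated apart. *)
Lemma exp_poly1_primitive f : exp_poly1 f ->
  exists F, exp_poly1 F /\ forall t, cderiv F t (f t).
Proof.
have mono k mu : exists F, exp_poly1 F /\
    forall t, cderiv F t (Cmul (RtoC (t ^ k)) (Cexp (Cmul mu (RtoC t)))).
  case: (eqVneq mu C0) => [->|/eqP nmu].
    exists (fun t => Cmul (RtoC (/ INR k.+1)) (Cmul (RtoC (t ^ k.+1)) (Cexp (Cmul C0 (RtoC t))))).
    split; first exact/exp_poly1Z/exp_poly1_monom.
    move=> t; apply: cderiv_eq (cderiv_scal _ _ _ _ (cderiv_monom k C0 t)) _ _ => //.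
    have -> : forall A B, Cmul (RtoC (/ INR k.+1)) (Cadd (Cmul (RtoC (INR k.+1)) A) (Cmul C0 B)) =
       Cmul (Cmul (RtoC (/ INR k.+1)) (RtoC (INR k.+1))) A by move=> *; ring.
    rewrite -RtoCM Rinv_l; [ring | exact: not_0_INR].
  elim: k => [|k [F [EF DF]]].
    exists (fun t => Cmul (Cinv mu) (Cexp (Cmul mu (RtoC t)))); split.
      apply: exp_poly1_ext (exp_poly1Z (Cinv mu) _ (exp_poly1_monom O mu)) _ => t /=; ring.
    move=> t; apply: cderiv_eq (cderiv_scal _ _ _ _ (cderiv_exp mu t)) _ _ => //=.
    by field.
  exists (fun t => Cmul (Cinv mu) (Cadd (Cmul (RtoC (t ^ k.+1)) (Cexp (Cmul mu (RtoC t))))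
                                   (Cmul (Copp (RtoC (INR k.+1))) (F t)))); split.
    by apply/exp_poly1Z/exp_poly1D; [exact: exp_poly1_monom | exact: exp_poly1Z].
  move=> t; apply: cderiv_eq (cderiv_scal _ _ _ _ (cderiv_add _ _ _ _ _ (cderiv_monom k mu t)
     (cderiv_scal _ _ _ _ (DF t)))) _ _ => //.
  by field.
elim=> [|h c k mu _ [H [EH DH]]].
  by exists (fun=> C0); split; [exact: exp_poly1_0 | move=> t; exact: cderiv_const].
have [F [EF DF]] := mono k mu.
exists (fun t => Cadd (H t) (Cmul c (F t))); split; first exact/exp_poly1D/exp_poly1Z.
by move=> t; apply: cderiv_add => //; exact: cderiv_scal.
Qed.

(** Integrating factor: [e^(-lam t) w] has derivative [e^(-lam t) u], so it differs by a constant
    from the exponential polynomial primitive [F]. *)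
Lemma first_order_ode lam w u : exp_poly1 u ->
  (forall t, cderiv w t (Cadd (u t) (Cmul lam (w t)))) -> exp_poly1 w.
Proof.
move=> Hu Hw.
pose e nu t := Cexp (Cmul nu (RtoC t)).
have ee nu t : Cmul (e nu t) (e (Copp nu) t) = Cone.
  rewrite /e -CexpD -Cexp0; congr Cexp; ring.
have [F [EF DF]] := exp_poly1_primitive _ (exp_poly1_mulexp (Copp lam) _ Hu).
have Hc : forall t, cderiv (fun t => Cadd (Cmul (e (Copp lam) t) (w t)) (Cmul (Copp Cone) (F t))) t C0.
  move=> t; apply: cderiv_eq (cderiv_add _ _ _ _ _ (cderiv_mul _ _ _ _ _ (cderiv_exp (Copp lam) t) (Hw t))
     (cderiv_scal (Copp Cone) _ _ _ (DF t))) _ _ => //.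
  ring.
pose H t := Cadd (Cmul (e (Copp lam) t) (w t)) (Cmul (Copp Cone) (F t)).
pose c := H 0; have K t : H t = c := zero_deriv_const _ Hc t.
apply: exp_poly1_ext (exp_poly1_mulexp lam _ (exp_poly1D _ _ EF (exp_poly1_const c))) _ => t.
rewrite -(K t) -/(e lam t) /H.
have -> : forall A B D E : Cplx, Cmul A (Cadd D (Cadd (Cmul B E) (Cmul (Copp Cone) D))) = Cmul (Cmul A B) E
   by move=> *; ring.
by rewrite ee; ring.
Qed.

(** [W k] is the k-th derivative of [W 0]. If [X - lam] is a factor of the characteristic
    polynomial, [U = W' - lam W] solves the equation of order [n] whose coefficients are those of
    the quotient, and [W] is recovered from [U] by a first-order equation. *)
Lemma linear_ode n (a : nat -> Cplx) (W : nat -> R -> Cplx) :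
  (forall k t, cderiv (W k) t (W k.+1 t)) ->
  (forall t, Cadd (W n t) (\big[Cadd/C0]_(k < n) Cmul (a k) (W k t)) = C0) ->
  exp_poly1 (W O).
Proof.
elim: n a W => [|n IH] a W HW Hr.
  by apply: exp_poly1_ext exp_poly1_0 _ => t; rewrite -(Hr t) big_ord0; ring.
have [lam [b [bn [b0 bS]]]] := monic_linear_factor n a.
pose U k t := Cadd (W k.+1 t) (Cmul (Copp lam) (W k t)).
have HU : exp_poly1 (U O).
  apply: (IH b) => [k t|t].
    by apply: cderiv_add => //; apply: cderiv_scal.
  rewrite -[RHS](Hr t) /U.
  have -> : Cadd (W n.+1 t) (Cmul (Copp lam) (W n t)) =
     Cmul (b n) (Cadd (W n.+1 t) (Cmul (Copp lam) (W n t))) by rewrite bn; ring.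
  rewrite CaddC -(big_ord_recr n (fun k => Cmul (b k) (Cadd (W k.+1 t) (Cmul (Copp lam) (W k t))))) /=.
  rewrite [in RHS]big_ord_recl /= b0.
  rewrite (eq_bigr (fun k : 'I_n.+1 => Cadd (Cmul (b k) (W k.+1 t)) (Cmul (Cmul (Copp lam) (b k)) (W k t))));
    last by move=> k _; ring.
  rewrite big_split /= big_ord_recr /= bn [X in Cadd _ X]big_ord_recl /=.
  rewrite [in RHS](eq_bigr (fun k : 'I_n => Cadd (Cmul (b k) (W k.+1 t)) (Cmul (Cmul (Copp lam) (b k.+1)) (W k.+1 t))));
    last by move=> k _; rewrite (_ : bump 0 k = k.+1) // bS //; ring.
  rewrite big_split /=.
  rewrite [X in Cadd _ (Cadd _ X) = _](eq_bigr (fun i : 'I_n => Cmul (Cmul (Copp lam) (b i.+1)) (W i.+1 t))) //.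
  ring.
apply: (first_order_ode lam) HU _ => t.
by apply: cderiv_eq (HW O t) _ _ => //; rewrite /U; ring.
Qed.

Section FiniteRank.
Variables (g : R -> Cplx) (S : seq (R -> Cplx)).
Hypotheses (cg : ccont1 g) (fr : forall s, insp S (fun t => g (t + s))).

Let V (w : R -> Cplx) := exists l : seq (Cplx * R),
  forall t, w t = \big[Cadd/C0]_(p <- l) Cmul p.1 (g (t + p.2)).

Let sV : subspace V.
Proof.
split; first by exists [::] => t; rewrite big_nil.
move=> c u v [l Hl] [l' Hl']; exists (l ++ [seq (Cmul c p.1, p.2) | p <- l']) => t.
rewrite big_cat big_map Hl Hl' (big_distrr (times := Cmul)) /=; congr Cadd.
by apply: eq_bigr => p _; ring.
Qed.

Let Vg s : V (fun t => g (t + s)).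
Proof. by exists [:: (Cone, s)] => t; rewrite big_cons big_nil /=; ring. Qed.

Let VS w : V w -> insp S w.
Proof.
move=> [l Hl]; have -> : w = fun t => \big[Cadd/C0]_(p <- l) Cmul p.1 (g (t + p.2)).
  exact: functional_extensionality.
apply: (subspace_sum _ (insp S) _ l xpredT (fun p t => Cmul p.1 (g (t + p.2)))) => [|p _].
  exact: insp_subspace.
by apply: subspaceZ => //; exact: insp_subspace.
Qed.

Let Vtrans w s : V w -> V (fun t => w (t + s)).
Proof.
move=> [l Hl]; exists [seq (p.1, s + p.2) | p <- l] => t.
by rewrite Hl big_map; apply: eq_bigr => p _ /=; rewrite Rplus_assoc.
Qed.

Let V1 w := V w /\ exists w', V w' /\ forall t, cderiv w t (w' t).

Let sV1 : subspace V1.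
Proof.
split.
  split; first exact: (proj1 sV).
  by exists (fun=> C0); split=> [|t]; [exact: (proj1 sV) | exact: cderiv_const].
move=> c u v [Vu [u' [Vu' Du]]] [Vv [v' [Vv' Dv]]]; split; first exact: (proj2 sV).
exists (fun t => Cadd (u' t) (Cmul c (v' t))); split; first exact: (proj2 sV).
by move=> t; apply: cderiv_add => //; exact: cderiv_scal.
Qed.

(* The averages of translates of g are differentiable with derivative in V, and V1, being
   finite-dimensional, is closed under the limit that recovers g from them. *)
Let V1g : V1 g.
Proof.
have [G DG] := primitive_exists _ cg.
have [l [Vl El]] := reproducing_points _ _ _ sV VS.
have [l1 [Vl1 El1]] := reproducing_points _ _ _ sV1 (fun w Hw => VS _ (proj1 Hw)).
pose A del t := Cadd (G (t + del)) (Cmul (Copp Cone) (G t)).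
(* [A del t] is the integral of [g] over [[t, t + del]]. The identity [El] for the translates of [g]
   is integrated in the shift [s]: both sides have the same derivative in [s] and vanish at
   [s = 0]. *)
have AE del t : A del t = rsum l (A del) t.
  have H0 s : cderiv (fun s => Cadd (A s t) (Cmul (Copp Cone) (rsum l (A s) t))) s C0.
    have D1 u : cderiv (fun s => A s u) s (g (u + s)).
      have := cderiv_add _ _ _ _ _ (cderiv_shift _ u s _ (DG _)) (cderiv_const (Cmul (Copp Cone) (G u)) s).
      move/cderiv_eq; apply=> [x|]; first by rewrite /A Rplus_comm.
      by rewrite Rplus_comm; ring.
    have := cderiv_add _ _ _ _ _ (D1 t) (cderiv_scal (Copp Cone) _ _ _
       (cderiv_sum _ l (fun p s => Cmul (A s p.1) (p.2 t)) s (fun p => Cmul (g (p.1 + s)) (p.2 t)) _)).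
    move=> H; apply: cderiv_eq (H _) _ _ => //.
      move=> p; apply: cderiv_eq (cderiv_scal (p.2 t) _ _ _ (D1 p.1)) _ _ => [x|]; ring.
    rewrite (El _ (Vg s) t) /rsum; ring.
  have A0 : A 0 =1 fun=> C0 by move=> u; rewrite /A Rplus_0_r; ring.
  apply: Csub_eq0; have := zero_deriv_const _ H0 del.
  have -> : rsum l (A 0) t = C0.
    by rewrite /rsum big1 // => p _; rewrite A0; ring.
  rewrite A0 => H; apply: etrans (etrans H _); ring.
have VA del : V1 (A del).
  split.
    have := rsum_in _ V l (A del) sV Vl; congr V.
    by apply: functional_extensionality => t; rewrite -AE.
  exists (fun t => Cadd (g (t + del)) (Cmul (Copp Cone) (g t))); split.
    apply: (proj2 sV) => //; have := Vg 0; congr V.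
    by apply: functional_extensionality => t; rewrite Rplus_0_r.
  move=> t; apply: cderiv_add; last exact: cderiv_scal.
  exact: cderiv_shift.
have -> : g = rsum l1 g; last exact: rsum_in.
apply: functional_extensionality => t.
(* The derivative of [A s u] in [s] at 0 is [g u], so differentiating the identity [El1] for the
   functions [A s] gives the same identity for [g]. *)
have D1 u : cderiv (fun s => A s u) 0 (g u).
  have := cderiv_add _ _ _ _ _ (cderiv_shift _ u 0 _ (DG _)) (cderiv_const (Cmul (Copp Cone) (G u)) 0).
  move/cderiv_eq; apply=> [x|]; first by rewrite /A Rplus_comm.
  by rewrite Rplus_0_l; ring.
apply: cderiv_unique (D1 t) _.
have := cderiv_sum _ l1 (fun p s => Cmul (A s p.1) (p.2 t)) 0 (fun p => Cmul (g p.1) (p.2 t)) _.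
move=> H; apply: cderiv_eq (H _) _ _ => //.
  move=> p; apply: cderiv_eq (cderiv_scal (p.2 t) _ _ _ (D1 p.1)) _ _ => [x|]; ring.
by move=> s; rewrite (El1 _ (VA s) t).
Qed.

Let V1all w : V w -> exists w', V w' /\ forall t, cderiv w t (w' t).
Proof.
move=> [l Hl]; have [_ [g' [Vg' Dg]]] := V1g.
exists (fun t => \big[Cadd/C0]_(p <- l) Cmul p.1 (g' (t + p.2))); split.
  apply: (subspace_sum _ V _ l xpredT (fun p t => Cmul p.1 (g' (t + p.2)))) => // p _.
  by apply: subspaceZ => //; exact: Vtrans.
move=> t.
have := cderiv_sum _ l (fun p t => Cmul p.1 (g (t + p.2))) t (fun p => Cmul p.1 (g' (t + p.2))) _.
move=> H; apply: cderiv_eq (H _) _ _ => // p.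
by apply/cderiv_scal/cderiv_shift.
Qed.

(** The iterated derivatives of [g] stay in the finite-dimensional [V], so one of them is a
    combination of the earlier ones; this relation is the differential equation. *)
Lemma finite_rank_exp_poly1 : exp_poly1 g.
Proof.
pose step (w : {w | V w}) : {w | V w} :=
  let w' := constructive_indefinite_description _ (V1all _ (proj2_sig w)) in
  exist V (proj1_sig w') (proj1 (proj2_sig w')).
have Vg0 : V g.
  have := Vg 0; congr V.
  by apply: functional_extensionality => t; rewrite Rplus_0_r.
pose W k := proj1_sig (iter k step (exist V g Vg0)).
have WV k : V (W k) by exact: proj2_sig.
have WD k t : cderiv (W k) t (W k.+1 t).
  rewrite /W iterS /step /=.
  exact: (proj2 (proj2_sig (constructive_indefinite_description _ (V1all _ _)))).
pose L K := [seq W k | k <- iota 0 K].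
have LS K w : insp (L K) w -> V w.
  apply: insp_in => // i; rewrite size_map size_iota => hi.
  by rewrite (nth_map O) ?size_iota.
have Lmono K K' w : (K <= K')%N -> insp (L K) w -> insp (L K') w.
  by move=> /subnKC <-; rewrite /L iotaD map_cat; exact: insp_catl.
(* The linear dependence comes from reproducing points: the union [V2] of the increasing spans [L K]
   has a finite reproducing list, whose functions already lie in a single [L K]. Hence [V2] equals
   [L K] and contains [W K]. *)
pose V2 w := exists K, insp (L K) w.
have sV2 : subspace V2.
  split; first by exists O.
  move=> c u v [K HK] [K' HK']; exists (maxn K K').
  by apply: (proj2 (insp_subspace _ _)); [apply: Lmono HK | apply: Lmono HK'];
    rewrite ?leq_maxl ?leq_maxr.
have [l [Vl El]] := reproducing_points _ _ _ sV2 (fun w Hw => VS _ (let: ex_intro K H := Hw in LS K w H)).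
have [K HK] : exists K, forall i p0, (i < size l)%N -> insp (L K) (nth p0 l i).2.
  elim: l Vl {El} => [|p l IH] Vl; first by exists O.
  have [K1 H1] := Vl O p isT; have [K2 H2] := IH (fun i p0 hi => Vl i.+1 p0 hi).
  exists (maxn K1 K2) => -[|i] p0 hi.
    by apply: Lmono H1; rewrite leq_maxl.
  by apply: Lmono (H2 i p0 hi); rewrite leq_maxr.
have V2W : V2 (W K).
  exists K.+1; have := insp_nth _ (L K.+1) K.
  by rewrite size_map size_iota (nth_map O) ?size_iota // nth_iota // add0n; apply.
have : insp (L K) (W K).
  have -> : W K = rsum l (W K) by apply: functional_extensionality; exact: El.
  by apply: rsum_in => //; exact: insp_subspace.
move/insp_sum => [c Hc].
have -> : g = W O by [].
apply: (linear_ode K (fun k => Copp (c k))) => // t.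
rewrite {1}Hc size_map size_iota -big_split big1 //= => i _.
by rewrite (nth_map O) ?size_iota // nth_iota // add0n; ring.
Qed.

End FiniteRank.

(** * Points of R^d, convergence and continuity *)

Lemma vnorm_ge0 d (x : Pt d) : 0 <= vnorm x. Proof. exact: sqrt_pos. Qed.

Lemma sumR_ge0 (I : Type) (r : seq I) (F : I -> R) :
  (forall i, 0 <= F i) -> 0 <= \big[Rplus/0]_(i <- r) F i.
Proof.
move=> H; elim: r => [|i r IH]; first by rewrite big_nil; lra.
by rewrite big_cons; have := H i; lra.
Qed.

Lemma vnorm_coord d (x : Pt d) i : Rabs (x i) <= vnorm x.
Proof.
rewrite /vnorm -sqrt_Rsqr_abs; apply: sqrt_le_1_alt.
rewrite (bigD1 i) // -big_filter.
have := sumR_ge0 _ [seq j <- index_enum _ | j != i] (fun j => x j ^ 2) (fun j => pow2_ge_0 _).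
by rewrite /Rsqr; set S := bigop _ _ _; move: (x i) S => a S /=; nra.
Qed.

Lemma vnorm_le_sum d (x : Pt d) : vnorm x <= \big[Rplus/0]_(i < d) Rabs (x i).
Proof.
have aux (r : seq 'I_d) : 0 <= \big[Rplus/0]_(i <- r) Rabs (x i) /\
   \big[Rplus/0]_(i <- r) x i ^ 2 <= (\big[Rplus/0]_(i <- r) Rabs (x i)) ^ 2.
  elim: r => [|i r [IH0 IH]]; first by rewrite !big_nil; lra.
  rewrite !big_cons; have := Rabs_pos (x i); rewrite -(pow2_abs (x i)).
  by split; [lra | nra].
have [H0 H] := aux (index_enum 'I_d).
rewrite /vnorm -[X in _ <= X]sqrt_pow2 //; exact: sqrt_le_1_alt.
Qed.

Lemma sumR_const d (a : R) : \big[Rplus/0]_(i < d) a = INR d * a.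
Proof.
elim: d => [|d IH]; first by rewrite big_ord0 /=; lra.
by rewrite big_ord_recr IH S_INR /=; lra.
Qed.

Lemma sumR_le (I : Type) (r : seq I) (F G : I -> R) : (forall i, F i <= G i) ->
  \big[Rplus/0]_(i <- r) F i <= \big[Rplus/0]_(i <- r) G i.
Proof.
move=> H; elim: r => [|i r IH]; first by rewrite !big_nil; lra.
by rewrite !big_cons; have := H i; lra.
Qed.

Lemma vnorm_lt_coord d (x : Pt d) del : 0 < del ->
  (forall i, Rabs (x i) < del / (INR d + 1)) -> vnorm x < del.
Proof.
move=> Hd H; apply: Rle_lt_trans (vnorm_le_sum _ _) _.
apply: Rle_lt_trans (sumR_le _ _ _ (fun=> del / (INR d + 1)) (fun i => Rlt_le _ _ (H i))) _.
have Hp : 0 < INR d + 1 by have := pos_INR d; lra.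
rewrite sumR_const; apply: (Rmult_lt_reg_r (INR d + 1)) => //.
by rewrite /Rdiv -!Rmult_assoc Rmult_assoc Rinv_l; [nra | lra].
Qed.

Lemma eventually_all d (P : 'I_d -> nat -> Prop) :
  (forall i, exists N, forall n, (N <= n)%N -> P i n) ->
  exists N, forall n, (N <= n)%N -> forall i, P i n.
Proof.
move=> /(choice (fun i N => forall n, (N <= n)%N -> P i n)) [f Hf].
exists (\max_i f i)%N => n Hn i; apply: Hf; apply: leq_trans Hn.
exact: (leq_bigmax i).
Qed.

Lemma CvP u l : Cv u l <->
  forall eps, 0 < eps -> exists N, forall n, (N <= n)%N -> Cnorm (Csub (u n) l) < eps.
Proof.
split=> [[H1 H2] eps He|H].
  have [N1 HN1] := H1 (eps / 2) ltac:(lra); have [N2 HN2] := H2 (eps / 2) ltac:(lra).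
  exists (maxn N1 N2) => n; rewrite geq_max => /andP [/leP h1 /leP h2].
  apply: Rle_lt_trans (Cnorm_le_sum _) _.
  by have := HN1 n h1; have := HN2 n h2; rewrite /Rdist /Csub /Cadd /Copp /Rminus /=; lra.
split=> eps He; have [N HN] := H eps He; exists N => n /leP /HN Hn;
  [have := Cnorm_fst (Csub (u n) l) | have := Cnorm_snd (Csub (u n) l)];
  by move: Hn; rewrite /Rdist /Csub /Cadd /Copp /Rminus /=; lra.
Qed.

Lemma Cv_unique u l l' : Cv u l -> Cv u l' -> l = l'.
Proof.
case: l l' => [a b] [a' b'] [/= H1 H2] [/= H3 H4].
by rewrite (UL_sequence _ _ _ H1 H3) (UL_sequence _ _ _ H2 H4).
Qed.

Lemma Cv_const c : Cv (fun=> c) c.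
Proof. by apply/CvP => eps He; exists O => n _; rewrite (_ : Csub c c = C0) ?Cnorm0 //; ring. Qed.

Lemma Cv_add u v a b : Cv u a -> Cv v b -> Cv (fun n => Cadd (u n) (v n)) (Cadd a b).
Proof. by move=> [? ?] [? ?]; split; apply: CV_plus. Qed.

Lemma Cv_mul u v a b : Cv u a -> Cv v b -> Cv (fun n => Cmul (u n) (v n)) (Cmul a b).
Proof.
by move=> [? ?] [? ?]; split; [apply: CV_minus | apply: CV_plus]; apply: CV_mult.
Qed.

Lemma Cv_ext u v a : (forall n, u n = v n) -> Cv u a -> Cv v a.
Proof. by move=> /functional_extensionality ->. Qed.

Lemma Cv_sum (I : Type) (r : seq I) (F : I -> nat -> Cplx) (L : I -> Cplx) :
  (forall i, Cv (F i) (L i)) ->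
  Cv (fun n => \big[Cadd/C0]_(i <- r) F i n) (\big[Cadd/C0]_(i <- r) L i).
Proof.
move=> H; elim: r => [|i r IH].
  by rewrite big_nil; apply: Cv_ext (Cv_const C0) => n; rewrite big_nil.
by rewrite big_cons; apply: Cv_ext (Cv_add _ _ _ _ (H i) IH) => n; rewrite big_cons.
Qed.

Lemma Cv_RtoC u a : Un_cv u a -> Cv (fun n => RtoC (u n)) (RtoC a).
Proof. by move=> H; split=> //; apply: (proj1 (Cv_const C0)). Qed.

Definition pcv d (u : nat -> Pt d) (x : Pt d) := forall i, Un_cv (fun n => u n i) (x i).

(** Sequential continuity, equivalent to [Ccont] by [Ccont_scont]; algebraic operations and limits
    then reduce to facts on sequences. *)
Definition scont d (f : Fn d) := forall u x, pcv d u x -> Cv (fun n => f (u n)) (f x).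

Definition ccont_coord d (f : Fn d) := forall x eps, 0 < eps -> exists del, 0 < del /\
  forall y, (forall i, Rabs (y i - x i) < del) -> Cnorm (Csub (f y) (f x)) < eps.

Lemma Ccont_coord d (f : Fn d) : Ccont f <-> ccont_coord d f.
Proof.
split=> H x eps /(H x) [del [Hd K]].
  exists (del / (INR d + 1)); split.
    by apply: Rdiv_lt_0_compat => //; have := pos_INR d; lra.
  move=> y Hy; apply: K; apply: vnorm_lt_coord => // i.
  by rewrite /vadd /vscal (_ : y i + -1 * x i = y i - x i) //; ring.
exists del; split=> // y Hy; apply: K => i.
apply: Rle_lt_trans _ Hy; have := vnorm_coord _ (vadd y (vscal (-1) x)) i.
by rewrite /vadd /vscal (_ : y i + -1 * x i = y i - x i) //; ring.
Qed.

Lemma Un_cv_invS (u : nat -> R) a :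
  (forall n, Rabs (u n - a) <= / INR n.+1) -> Un_cv u a.
Proof.
move=> H eps He.
have [N [HN1 HN2]] := archimed_cor1 eps He.
exists N => n hn; apply: Rle_lt_trans (H n) _.
apply: Rle_lt_trans _ HN1; apply: Rinv_le_contravar.
  by apply: lt_0_INR.
by apply: le_INR; lia.
Qed.

Lemma Ccont_scont d (f : Fn d) : Ccont f <-> scont d f.
Proof.
split=> [/Ccont_coord H u x Hu|H].
  apply/CvP => eps /(H x) [del [Hd K]].
  have [N HN] := eventually_all d (fun i n => Rabs (u n i - x i) < del)
    (fun i => let: ex_intro N HN := Hu i del Hd in
              ex_intro _ N (fun n hn => HN n (elimT leP hn))).
  by exists N => n /HN hn; exact: K.
apply/Ccont_coord; apply: NNPP => nH.
have [x nx] := not_all_ex_not _ _ nH; have [eps neps] := not_all_ex_not _ _ nx.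
have [He nd] := imply_to_and _ _ neps.
have Hn (n : nat) : exists y : Pt d, (forall i, Rabs (y i - x i) < / INR n.+1) /\
    ~ Cnorm (Csub (f y) (f x)) < eps.
  apply: NNPP => nex; apply: nd; exists (/ INR n.+1); split.
    by apply: Rinv_0_lt_compat; apply: lt_0_INR; lia.
  by move=> y hy; apply: NNPP => ny; apply: nex; exists y.
have [u Hu] := choice _ Hn.
have /(H u x) /CvP /(_ eps He) [N HN] : pcv d u x.
  by move=> i; apply: Un_cv_invS => n; apply: Rlt_le; case: (Hu n).
by case: (Hu N) => _; apply; exact: HN.
Qed.

(** * Exponential polynomials *)

Section ExpPoly.
Variable d : nat.
Implicit Types f g : Fn d.

(** The algebra generated by constants, coordinates and exponentials of one coordinate: a form
    suited to induction, shown equivalent to [is_exp_poly] by [is_exp_poly_EP] and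
    [EP_is_exp_poly]. *)
Inductive exp_poly : Fn d -> Prop :=
| EP_const c : exp_poly (fun=> c)
| EP_coord i : exp_poly (fun x => RtoC (x i))
| EP_exp mu i : exp_poly (fun x => Cexp (Cmul mu (RtoC (x i))))
| EP_add f g : exp_poly f -> exp_poly g -> exp_poly (fun x => Cadd (f x) (g x))
| EP_mul f g : exp_poly f -> exp_poly g -> exp_poly (fun x => Cmul (f x) (g x)).

Lemma EP_ext f g : exp_poly f -> (forall x, f x = g x) -> exp_poly g.
Proof. by move=> H /functional_extensionality <-. Qed.

Lemma EP_sum (I : Type) (r : seq I) (P : pred I) (F : I -> Fn d) : (forall i, exp_poly (F i)) ->
  exp_poly (fun x => \big[Cadd/C0]_(i <- r | P i) F i x).
Proof.
move=> H; elim: r => [|i r IH]; first by apply: EP_ext (EP_const C0) _ => x; rewrite big_nil.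
case Pi: (P i); last by apply: EP_ext IH _ => x; rewrite big_cons Pi.
by apply: EP_ext (EP_add _ _ (H i) IH) _ => x; rewrite big_cons Pi.
Qed.

Lemma EP_prod (I : Type) (r : seq I) (F : I -> Fn d) : (forall i, exp_poly (F i)) ->
  exp_poly (fun x => \big[Cmul/Cone]_(i <- r) F i x).
Proof.
move=> H; elim: r => [|i r IH]; first by apply: EP_ext (EP_const Cone) _ => x; rewrite big_nil.
by apply: EP_ext (EP_mul _ _ (H i) IH) _ => x; rewrite big_cons.
Qed.

Lemma RtoC_prod (I : Type) (r : seq I) (F : I -> R) :
  RtoC (\big[Rmult/1]_(i <- r) F i) = \big[Cmul/Cone]_(i <- r) RtoC (F i).
Proof. by apply: (big_morph RtoC) => // a b; exact: RtoCM. Qed.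

Lemma Cexp_cdot (lam : 'I_d -> Cplx) (x : Pt d) :
  Cexp (cdot lam x) = \big[Cmul/Cone]_(i < d) Cexp (Cmul (lam i) (RtoC (x i))).
Proof.
rewrite -(big_morph Cexp CexpD Cexp0); congr Cexp.
rewrite /cdot; elim: (index_enum _) => [|i r IH]; first by rewrite !big_nil.
by rewrite !big_cons -IH /Cadd /Cmul /RtoC /=; congr pair; ring.
Qed.

Lemma EP_pow f k : exp_poly f -> exp_poly (fun x => iter k (Cmul (f x)) Cone).
Proof. by move=> H; elim: k => [|k IH] /=; [exact: EP_const | exact: EP_mul]. Qed.

Lemma RtoC_pow a k : RtoC (a ^ k) = iter k (Cmul (RtoC a)) Cone.
Proof. by elim: k => //= k <-; rewrite RtoCM. Qed.

Lemma is_exp_poly_EP f : is_exp_poly f -> exp_poly f.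
Proof.
move=> [terms /functional_extensionality ->].
have Hm (a : 'I_d -> nat) : exp_poly (fun x => RtoC (monom a x)).
  apply: EP_ext (EP_prod _ (index_enum 'I_d) (fun i x => RtoC (x i ^ a i)) _) _.
    by move=> i; apply: EP_ext (EP_pow _ (a i) (EP_coord i)) _ => x; rewrite RtoC_pow.
  by move=> x; rewrite RtoC_prod.
have Hp (p : seq (Cplx * ('I_d -> nat))) : exp_poly (poly_eval p).
  elim: p => [|ca p IH]; first exact: EP_const.
  by apply: EP_add IH; apply: EP_mul; [exact: EP_const | exact: Hm].
have He (lam : 'I_d -> Cplx) : exp_poly (fun x => Cexp (cdot lam x)).
  apply: EP_ext (EP_prod _ (index_enum 'I_d) (fun i x => Cexp (Cmul (lam i) (RtoC (x i)))) _) _.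
    by move=> i; exact: EP_exp.
  by move=> x; rewrite Cexp_cdot.
elim: terms => [|pl terms IH]; first exact: EP_const.
by apply: EP_add IH; apply: EP_mul.
Qed.

Let term := (Cplx * ('I_d -> nat) * ('I_d -> Cplx))%type.
Let tval (t : term) (x : Pt d) : Cplx :=
  Cmul (Cmul t.1.1 (RtoC (monom t.1.2 x))) (Cexp (cdot t.2 x)).

Let monomD (a b : 'I_d -> nat) (x : Pt d) :
  monom (fun i => a i + b i)%N x = monom a x * monom b x.
Proof. by rewrite /monom -big_split; apply: eq_bigr => i _; rewrite pow_add. Qed.

Let cdotD (a b : 'I_d -> Cplx) (x : Pt d) :
  cdot (fun i => Cadd (a i) (b i)) x = Cadd (cdot a x) (cdot b x).
Proof.
by rewrite /cdot /Cadd /= -!big_split; congr pair; apply: eq_bigr => i _ /=; ring.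
Qed.

Let monom0 x : monom (fun _ : 'I_d => O) x = 1.
Proof. by rewrite /monom big1. Qed.
Let cdot0 (x : Pt d) : cdot (fun=> C0) x = C0.
Proof. by rewrite /cdot /= !big1 // => i _; ring. Qed.

(** Sums of terms [c x^a e^<lam, x>] are closed under multiplication, because exponents and
    frequencies add. *)
Lemma EP_is_exp_poly f : exp_poly f -> is_exp_poly f.
Proof.
move=> Hf; suff [l Hl] : exists l : seq term, forall x, f x = \big[Cadd/C0]_(t <- l) tval t x.
  exists [seq ([:: t.1], t.2) | t <- l] => x; rewrite Hl.
  elim: l {Hl} => [|t l IH] /=; first by rewrite big_nil.
  by rewrite big_cons IH /tval; congr (Cadd (Cmul _ _) _); ring.
elim: {f} Hf => [c|i|mu i|f g _ [l Hl] _ [l' Hl']|f g _ [l Hl] _ [l' Hl']].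
- exists [:: (c, fun=> O, fun=> C0)] => x; rewrite big_cons big_nil /tval /=.
  by rewrite monom0 cdot0 Cexp0; ring.
- exists [:: (Cone, fun j => nat_of_bool (j == i), fun=> C0)] => x; rewrite big_cons big_nil /tval /=.
  rewrite cdot0 Cexp0 /monom (bigD1 i) //= eqxx big1 /=; last by move=> j /negbTE ->.
  by rewrite !Rmult_1_r; ring.
- exists [:: (Cone, fun=> O, fun j => if j == i then mu else C0)] => x; rewrite big_cons big_nil /tval /=.
  rewrite monom0 Cexp_cdot (bigD1 i) //= eqxx big1; first by ring.
  by move=> j /negbTE ->; rewrite Cmul0z Cexp0.
- by exists (l ++ l') => x; rewrite big_cat Hl Hl'.
- exists [seq (Cmul t.1.1 u.1.1, fun i => (t.1.2 i + u.1.2 i)%N, fun i => Cadd (t.2 i) (u.2 i))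
    | t : term <- l, u : term <- l'] => x.
  rewrite big_allpairs_dep Hl Hl' (big_distrlr Cadd) /=.
  apply: eq_bigr => t _; apply: eq_bigr => u _; rewrite /tval /=.
  by rewrite monomD cdotD CexpD RtoCM; ring.
Qed.

Lemma EP_scont f : exp_poly f -> scont d f.
Proof.
elim=> [c|i|mu i|{}f g _ Hf _ Hg|{}f g _ Hf _ Hg] u x Hu.
- exact: Cv_const.
- exact: Cv_RtoC.
- have Hc (h : R -> R) : continuity h -> forall v a, Un_cv v a -> Un_cv (fun n => h (v n)) (h a).
    by move=> ch v a; apply: continuity_seq; exact: ch.
  have [H1 H2] := Cv_mul _ _ _ _ (Cv_const mu) (Cv_RtoC _ _ (Hu i)).
  split; apply: CV_mult.
  + exact: (Hc exp (derivable_continuous _ derivable_exp)).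
  + exact: (Hc cos continuity_cos).
  + exact: (Hc exp (derivable_continuous _ derivable_exp)).
  + exact: (Hc sin continuity_sin).
- by apply: Cv_add; auto.
- by apply: Cv_mul; auto.
Qed.

Lemma EP_Ccont f : exp_poly f -> Ccont f.
Proof. by move=> /EP_scont /Ccont_scont. Qed.

Lemma insp_mul (s t : seq (Fn d)) u v : insp s u -> insp t v ->
  insp [seq (fun x => Cmul (p x) (q x)) | p <- s, q <- t] (fun x => Cmul (u x) (v x)).
Proof.
move=> + Ht; elim: s u => [|p s IH] u /=; first by move=> H x; rewrite H; ring.
move=> [c /IH H]; set P := flatten _ in H *.
have Hp : insp [seq (fun x => Cmul (p x) (q x)) | q <- t] (fun x => Cmul (p x) (v x)).
  elim: t v Ht {H P IH} => [|q t IH] v /=; first by move=> H x; rewrite H; ring.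
  move=> [b /IH H]; exists b; move: H.
  by congr insp; apply: functional_extensionality => x; ring.
have := proj2 (insp_subspace _ (map (fun q x => Cmul (p x) (q x)) t ++ P)) c _ _
  (insp_catr _ _ _ _ H) (insp_catl _ _ P _ Hp).
by congr insp; apply: functional_extensionality => x; ring.
Qed.

(** Each generator has an addition formula; for sums the spanning lists are joined, for products
    they are multiplied. The spanning functions are again exponential polynomials, so that they can
    later be integrated against test functions. *)
Lemma EP_finite_rank f : exp_poly f -> exists s, List.Forall exp_poly s /\
  forall y, insp s (fun x => f (vadd x y)).
Proof.
elim=> [c|i|mu i|{}f g _ [s [Es Hs]] _ [t [Et Ht]]|{}f g _ [s [Es Hs]] _ [t [Et Ht]]].
- exists [:: fun=> Cone]; split; first by constructor; [exact: EP_const | constructor].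
  by move=> y; exists c => x; ring.
- exists [:: fun x => RtoC (x i); fun=> Cone]; split.
    by do !constructor.
  by move=> y; exists Cone, (RtoC (y i)) => x; rewrite /vadd RtoCD; ring.
- exists [:: fun x => Cexp (Cmul mu (RtoC (x i)))]; split; first by do !constructor.
  move=> y; exists (Cexp (Cmul mu (RtoC (y i)))) => x; rewrite /vadd RtoCD CmulDr CexpD; ring.
- exists (s ++ t); split; first by apply/List.Forall_app.
  move=> y; apply: (subspaceD _ _ (fun x => f (vadd x y)) (fun x => g (vadd x y))).
  + exact: insp_subspace.
  + exact: insp_catl.
  + exact: insp_catr.
- exists [seq (fun x => Cmul (p x) (q x)) | p <- s, q <- t]; split.
    elim: Es => [|p s' Hp _ IH]; first by constructor.
    apply/List.Forall_app; split=> //.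
    elim: Et => [|q t' Hq _ IHt]; constructor=> //; exact: EP_mul.
  by move=> y; exact: insp_mul (Hs y) (Ht y).
Qed.

Lemma EP_coord1 (g : R -> Cplx) i : exp_poly1 g -> exp_poly (fun x => g (x i)).
Proof.
elim=> [|h c k mu _ IH]; first exact: EP_const.
apply: EP_add IH _; apply: EP_mul (EP_const c) _; apply: EP_mul (EP_exp mu i).
by apply: EP_ext (EP_pow _ k (EP_coord i)) _ => x; rewrite RtoC_pow.
Qed.

End ExpPoly.

(** * Functions whose translates span a finite-dimensional space *)

Lemma vaddA d (x y z : Pt d) : vadd x (vadd y z) = vadd (vadd x y) z.
Proof. by apply: functional_extensionality => i; rewrite /vadd; ring. Qed.
Lemma vaddC d (x y : Pt d) : vadd x y = vadd y x.
Proof. by apply: functional_extensionality => i; rewrite /vadd; ring. Qed.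
Definition vzero d : Pt d := fun=> 0.
Lemma vadd0 d (x : Pt d) : vadd x (vzero d) = x.
Proof. by apply: functional_extensionality => i; rewrite /vadd /vzero; ring. Qed.

Lemma insp_comp (X Y : Type) (phi : Y -> X) (s : seq (X -> Cplx)) w :
  insp s w -> insp [seq (fun y => u (phi y)) | u <- s] (fun y => w (phi y)).
Proof.
elim: s w => [|u s IH] w /=; first by move=> H y.
by move=> [c /IH H]; exists c.
Qed.

Section FiniteRankRd.
Variables (d : nat) (f : Fn d) (S : seq (Fn d)).
Hypotheses (cf : Ccont f) (fr : forall y, insp S (fun x => f (vadd x y))).

Let V (w : Fn d) := exists l : seq (Cplx * Pt d),
  forall x, w x = \big[Cadd/C0]_(p <- l) Cmul p.1 (f (vadd x p.2)).

Let sV : subspace V.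
Proof.
split; first by exists [::] => x; rewrite big_nil.
move=> c u v [l Hl] [l' Hl']; exists (l ++ [seq (Cmul c p.1, p.2) | p <- l']) => x.
rewrite big_cat big_map Hl Hl' (big_distrr (times := Cmul)) /=; congr Cadd.
by apply: eq_bigr => p _; ring.
Qed.

Let Vf y : V (fun x => f (vadd x y)).
Proof. by exists [:: (Cone, y)] => x; rewrite big_cons big_nil /=; ring. Qed.

Let VS w y : V w -> insp S (fun x => w (vadd x y)).
Proof.
move=> [l Hl].
have -> : (fun x => w (vadd x y)) =
    fun x => \big[Cadd/C0]_(p <- l) Cmul p.1 (f (vadd x (vadd y p.2))).
  by apply: functional_extensionality => x; rewrite Hl; apply: eq_bigr => p _; rewrite vaddA.
apply: (subspace_sum _ (insp S) _ l xpredT (fun p x => Cmul p.1 (f (vadd x (vadd y p.2))))) => [|p _].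
  exact: insp_subspace.
by apply: subspaceZ => //; exact: insp_subspace.
Qed.

Lemma translate_scont y : scont d (fun x => f (vadd x y)).
Proof.
move/Ccont_scont: cf => H u x Hu; apply: H => i.
by apply: CV_plus => //; exact: (proj1 (Cv_const (RtoC (y i)))).
Qed.

Let Vcont w : V w -> scont d w.
Proof.
move=> [l Hl] u x Hu; rewrite Hl.
apply: Cv_ext (Cv_sum _ l (fun p n => Cmul p.1 (f (vadd (u n) p.2))) _ _) => [n|p].
  by rewrite Hl.
by apply: Cv_mul; [exact: Cv_const | exact: (translate_scont p.2 u x Hu)].
Qed.

(** On the [i]-th axis the translates of [w] lie in the span of the restrictions of [S], so the
    one-variable result applies. *)
Let V_exp_poly1 w i : V w -> exp_poly1 (fun t => w (vscal t (unit_vec i))).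
Proof.
move=> Vw; apply: (finite_rank_exp_poly1 _ [seq (fun t : R => u (vscal t (unit_vec i))) | u <- S]).
  move=> t.
  have /Ccont_scont /Ccont_coord H := Vcont _ Vw.
  split; apply/continuity_pt_locally => eps; have [del [Hd K]] := H (vscal t (unit_vec i)) eps (cond_pos eps);
    exists (mkposreal del Hd) => s Hs;
    (have {}K := K (vscal s (unit_vec i)) _;
     [apply: Rle_lt_trans (K _); [| move=> j; rewrite /vscal /unit_vec]]).
  - exact: (Cnorm_fst (Csub _ _)).
  - case: (j == i); rewrite ?Rmult_1_r ?Rmult_0_r ?Rminus_0_r ?Rabs_R0 //.
  - exact: (Cnorm_snd (Csub _ _)).
  - case: (j == i); rewrite ?Rmult_1_r ?Rmult_0_r ?Rminus_0_r ?Rabs_R0 //.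
move=> s.
have := insp_comp _ _ (fun t : R => vscal t (unit_vec i)) _ _ (VS w (vscal s (unit_vec i)) Vw).
congr insp; apply: functional_extensionality => t; congr w.
by apply: functional_extensionality => j; rewrite /vadd /vscal; ring.
Qed.

(** Separation of variables: the reproducing identity for the translate of [f] by [P x], taken at
    the point [t e_i], writes [f (t e_i + P x)] as a sum of products of some [f (p + P x)] with
    functions of [t] alone. *)
Lemma finite_rank_step (i : 'I_d) (P : Pt d -> Pt d) :
  (forall y, exp_poly d (fun x => f (vadd y (P x)))) ->
  exp_poly d (fun x => f (vadd (vscal (x i) (unit_vec i)) (P x))).
Proof.
move=> HP.
have [l [Vl El]] : exists l, reproduces V l.
  apply: (reproducing_points _ _ S sV) => w /(VS w (vzero d)).
  by congr insp; apply: functional_extensionality => x; rewrite vadd0.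
apply: (EP_ext d (fun x => \big[Cadd/C0]_(k < size l)
   let p := nth (vzero d, fun=> C0) l k in Cmul (f (vadd p.1 (P x))) (p.2 (vscal (x i) (unit_vec i))))).
  apply: EP_sum => k /=; apply: EP_mul => //.
  exact: (EP_coord1 _ _ i (V_exp_poly1 _ i (Vl _ _ (ltn_ord k)))).
move=> x; rewrite (El _ (Vf (P x)) (vscal (x i) (unit_vec i))) /rsum.
by rewrite (big_nth (vzero d, fun=> C0)) big_mkord.
Qed.

End FiniteRankRd.

Theorem finite_rank_exp_poly d (f : Fn d) (S : seq (Fn d)) :
  Ccont f -> (forall y, insp S (fun x => f (vadd x y))) -> exp_poly d f.
Proof.
move=> cf fr.
pose P (n : nat) (x : Pt d) : Pt d := fun i => if (i < n)%N then x i else 0.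
(* The shift [y] stays free in the induction because the step evaluates [f] at the shifted points
   [p + P x]. *)
have main n : (n <= d)%N -> forall y, exp_poly d (fun x => f (vadd y (P n x))).
  elim: n => [|n IH] hn y.
    apply: (EP_ext d _ _ (EP_const d (f y))) => x; congr f.
    by apply: functional_extensionality => i; rewrite /vadd /P ltn0; ring.
  pose i := Ordinal hn.
  have ct : Ccont (fun x => f (vadd x y)) by apply/Ccont_scont; exact: translate_scont.
  apply: (EP_ext d _ _ (finite_rank_step d (fun x => f (vadd x y)) S ct _ i (P n) _)).
  - move=> y'; have := fr (vadd y' y).
    by congr insp; apply: functional_extensionality => x; rewrite vaddA.
  - move=> y'; apply: EP_ext (IH (ltnW hn) (vadd y' y)) _ => x; congr f.
    by rewrite -!vaddA (vaddC _ (P n x)).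
  - move=> x; congr f; rewrite vaddC; congr vadd.
    apply: functional_extensionality => j; rewrite /vadd /vscal /unit_vec /P.
    rewrite -val_eqE ltnS [(j <= n)%N]leq_eqVlt /=.
    have [e|_] := eqVneq (nat_of_ord j) n; last by rewrite /=; case: (_ < _)%N; ring.
    by rewrite e ltnn /= (_ : j = i); [ring | exact: val_inj].
apply: EP_ext (main d (leqnn d) (vzero d)) _ => x; congr f.
by rewrite vaddC vadd0; apply: functional_extensionality => i; rewrite /P ltn_ord.
Qed.

(** * Recurrences in the directions [h k] and density of the group *)

(** A window of [m] consecutive values in [V] slides upwards on dividing by [c m], and downwards on
    dividing by [c 0]. *)
Lemma two_sided_recurrence (X : Type) (V : (X -> Cplx) -> Prop) m (c : nat -> Cplx) (b : Z -> X -> Cplx) :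
  subspace V -> c O <> C0 -> c m <> C0 ->
  (forall q, V (fun x => \big[Cadd/C0]_(j < m.+1) Cmul (c j) (b (q + Z.of_nat j)%Z x))) ->
  (forall j, (j < m)%N -> V (b (Z.of_nat j))) -> forall q, V (b q).
Proof.
move=> sV c0 cm Hr Hi.
have up q : (forall j, (j < m)%N -> V (b (q + Z.of_nat j)%Z)) -> V (b (q + Z.of_nat m)%Z).
  move=> H; have H' := subspace_sum _ V _ (index_enum 'I_m) xpredT
    (fun (j : 'I_m) x => Cmul (c j) (b (q + Z.of_nat j)%Z x)) sV
    (fun j _ => subspaceZ _ V (c j) _ sV (H j (ltn_ord j))).
  have := subspaceZ _ _ (Cinv (c m)) _ sV (subspaceB _ _ _ _ sV (Hr q) H').
  congr V; apply: functional_extensionality => x; rewrite big_ord_recr /=.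
  have E a z : Cmul (Cinv (c m)) (Csub (Cadd a (Cmul (c m) z)) a) = z by field.
  exact: E.
have down q : (forall j, (j < m)%N -> V (b (q + 1 + Z.of_nat j)%Z)) -> V (b q).
  move=> H; have H' := subspace_sum _ V _ (index_enum 'I_m) xpredT
    (fun (j : 'I_m) x => Cmul (c j.+1) (b (q + 1 + Z.of_nat j)%Z x)) sV
    (fun j _ => subspaceZ _ V (c j.+1) _ sV (H j (ltn_ord j))).
  have := subspaceZ _ _ (Cinv (c O)) _ sV (subspaceB _ _ _ _ sV (Hr q) H').
  congr V; apply: functional_extensionality => x; rewrite big_ord_recl /= Z.add_0_r.
  rewrite (eq_bigr (fun j : 'I_m => Cmul (c j.+1) (b (q + 1 + Z.of_nat j)%Z x))).
    have E a z : Cmul (Cinv (c O)) (Csub (Cadd (Cmul (c O) z) a) a) = z by field.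
    exact: E.
  by move=> j _; rewrite (_ : (q + 1 + Z.of_nat j = q + Z.of_nat (lift ord0 j))%Z) //; rewrite lift0 Nat2Z.inj_succ; lia.
have W q : forall j, (j < m)%N -> V (b (q + Z.of_nat j)%Z).
  apply: (Z.bi_induction (fun q => forall j, (j < m)%N -> V (b (q + Z.of_nat j)%Z))) => {q} [j hj|q].
    by rewrite Z.add_0_l; exact: Hi.
  split=> H j hj.
    case: (ltnP j.+1 m) => h.
      by have := H _ h; rewrite Nat2Z.inj_succ; congr (V (b _)); lia.
    have -> : (Z.succ q + Z.of_nat j = q + Z.of_nat m)%Z.
      have -> : m = j.+1 by apply/eqP; rewrite eqn_leq h hj.
      by rewrite Nat2Z.inj_succ; lia.
    exact: up.
  case: j hj => [|j] hj.
    rewrite Z.add_0_r; apply: down => j hj'.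
    by have := H _ hj'; congr (V (b _)); lia.
  by have := H _ (ltnW hj); congr (V (b _)); rewrite Nat2Z.inj_succ; lia.
move=> q; have -> : q = (q - Z.of_nat m + Z.of_nat m)%Z by lia.
apply: up; exact: W.
Qed.

Definition dcoef (m k : nat) : Cplx := RtoC (Binomial.C m k * (-1) ^ (m - k)%nat).

Lemma dcoef_neq0 m k : dcoef m k <> C0.
Proof.
move=> /RtoC_inj; apply: Rmult_integral_contrapositive_currified; last by apply: pow_nonzero; lra.
rewrite /Binomial.C /Rdiv; apply: Rmult_integral_contrapositive_currified; first exact: INR_fact_neq_0.
by apply: Rinv_neq_0_compat; apply: Rmult_integral_contrapositive_currified; exact: INR_fact_neq_0.
Qed.

Section DenseGroup.
Variables (X : Type) (d t : nat) (h : 'I_t -> Pt d) (m : 'I_t -> nat).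
Variables (A : Pt d -> X -> Cplx) (W : seq (X -> Cplx)).
Hypothesis rel : forall k y, insp W (fun x =>
  \big[Cadd/C0]_(j < (m k).+1) Cmul (dcoef (m k) j) (A (vadd y (vscal (INR j) (h k))) x)).

Let comb n (z : 'I_t -> Z) : Pt d := fun i => \big[Rplus/0]_(k < t | (k < n)%N) (IZR (z k) * h k i).

(** The list [S] may depend on [y0] but not on [z]. A new direction [h k0] contributes [m k0]
    initial values, which are the earlier situation at the base points [y0 + j h k0]; hence the
    induction is over all [y0]. *)
Lemma group_span n : (n <= t)%N -> forall y0, exists S, forall z, insp S (A (vadd y0 (comb n z))).
Proof.
elim: n => [|n IH] hn y0.
  exists [:: A y0] => z.
  have -> : vadd y0 (comb 0 z) = y0.
    by apply: functional_extensionality => i; rewrite /vadd /comb big_pred0_eq; ring.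
  by exists Cone => x; ring.
pose k0 := Ordinal hn.
have /(choice _) [Sj HSj] := IH (ltnW hn).
pose S := W ++ flatten [seq Sj (vadd y0 (vscal (INR j) (h k0))) | j <- iota 0 (m k0)].
exists S => z.
pose b q := A (vadd (vadd y0 (vscal (IZR q) (h k0))) (comb n z)).
have -> : A (vadd y0 (comb n.+1 z)) = b (z k0).
  congr A; apply: functional_extensionality => i; rewrite /vadd /comb /vscal (bigD1 k0) //=.
  rewrite Rplus_assoc; congr (_ + (_ + _)); apply: eq_bigl => k.
  by rewrite ltnS -val_eqE /= [in RHS]ltn_neqAle andbC.
apply: (two_sided_recurrence _ (insp S) (m k0) (dcoef (m k0))); try exact: dcoef_neq0.
- exact: insp_subspace.
- move=> q; apply: insp_catl; have := rel k0 (vadd (vadd y0 (vscal (IZR q) (h k0))) (comb n z)).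
  congr insp; apply: functional_extensionality => x; apply: eq_bigr => j _; congr (Cmul _ (A _ _)).
  apply: functional_extensionality => i; rewrite /vadd /vscal plus_IZR -INR_IZR_INZ; ring.
- move=> j hj; apply: insp_catr.
  have Hj := HSj (vadd y0 (vscal (INR j) (h k0))) z.
  have : j \in iota 0 (m k0) by rewrite mem_iota.
  elim: (iota 0 (m k0)) => [//|a r IHr]; rewrite inE => /orP [/eqP <-|/IHr]; last exact: insp_catr.
  by apply: insp_catl; move: Hj; rewrite /b -INR_IZR_INZ.
Qed.

(** Instead of the closedness of a span, a limit is taken in the reproducing identity: for fixed [x]
    it involves [A y] at finitely many points only, and there it is continuous in [y]. *)
Lemma dense_reproducing : dense_subgroup h -> (forall x, Ccont (fun y => A y x)) ->
  exists l, forall y x, A y x = rsum l (A y) x.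
Proof.
move=> dh cA.
have [S HS] := group_span t (leqnn t) (vzero d).
have [l [_ El]] := reproducing_points _ _ S (insp_subspace _ S) (fun w Hw => Hw).
exists l => y x.
have Hn (n : nat) : exists z : 'I_t -> Z, forall i, Rabs (comb t z i - y i) <= / INR n.+1.
  have [|z Hz] := dh y (/ INR n.+1); first by apply: Rinv_0_lt_compat; apply: lt_0_INR; lia.
  exists z => i; apply: Rlt_le; apply: Rle_lt_trans _ Hz.
  have := vnorm_coord _ (vadd (fun i => \big[Rplus/0]_(k < t) (IZR (z k) * h k i)) (vscal (-1) y)) i.
  have -> : comb t z i = \big[Rplus/0]_(k < t) (IZR (z k) * h k i).
    by apply: eq_bigl => k; rewrite ltn_ord.
  by congr (Rabs _ <= _); rewrite /vadd /vscal; ring.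
have [z Hz] := choice _ Hn.
have Hu : pcv d (fun n => comb t (z n)) y by move=> i; apply: Un_cv_invS => n; exact: Hz.
have cv x' : Cv (fun n => A (comb t (z n)) x') (A y x').
  by have /Ccont_scont := cA x'; apply.
apply: Cv_unique (cv x) _.
apply: Cv_ext (Cv_sum _ l (fun p n => Cmul (A (comb t (z n)) p.1) (p.2 x)) _ _).
  move=> n; rewrite (El (A (comb t (z n)))) //.
  by have := HS (z n); rewrite vaddC vadd0.
by move=> p; apply: Cv_mul => //; exact: Cv_const.
Qed.

End DenseGroup.

Lemma insp_collect (X I : Type) d' (F : 'I_d' -> I -> X -> Cplx) :
  (forall k, exists s, forall y, insp s (F k y)) -> exists s, forall k y, insp s (F k y).
Proof.
move=> /(choice _) [S HS].
exists (flatten [seq S k | k <- index_enum 'I_d']) => k y.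
have : k \in index_enum 'I_d' by rewrite mem_index_enum.
elim: (index_enum _) => [//|a r IHr]; rewrite inE => /orP [/eqP <-|/IHr]; last exact: insp_catr.
exact: insp_catl.
Qed.

(** * The case of continuous functions *)

Theorem continuous_case (d t : nat) (h : 'I_t -> Pt d) (m : 'I_t -> nat) (f : Fn d) :
  dense_subgroup h -> Ccont f ->
  (forall k : 'I_t, is_exp_poly (FDelta (h k) (m k) f)) -> exp_poly d f.
Proof.
move=> dh cf He.
have [W HW] : exists W, forall k y, insp W (fun x => FDelta (h k) (m k) f (vadd x y)).
  apply: (insp_collect _ _ _ (fun k y x => FDelta (h k) (m k) f (vadd x y))) => k.
  by have [s [_ Hs]] := EP_finite_rank d _ (is_exp_poly_EP d _ (He k)); exists s.
have [|x|l Hl] := dense_reproducing _ d t h m (fun y x => f (vadd x y)) W _ dh _.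
- move=> k y; have := HW k y; congr insp; apply: functional_extensionality => x.
  rewrite /FDelta; apply: eq_bigr => j _; rewrite /dcoef /Ftau; congr Cmul; congr f.
  by rewrite vaddA.
- apply/Ccont_scont; have := translate_scont d f cf x.
  by congr scont; apply: functional_extensionality => y; rewrite vaddC.
apply: (finite_rank_exp_poly d f [seq p.2 | p <- l]) => // y.
have -> : (fun x => f (vadd x y)) = rsum l (fun x => f (vadd x y)).
  by apply: functional_extensionality => x; exact: Hl.
apply: rsum_in; first exact: insp_subspace.
move=> i p0 hi; have := insp_nth _ [seq p.2 | p <- l] i.
by rewrite size_map (nth_map p0) //; apply.
Qed.

(** * Continuous functions of compact support *)

Section CompactSupport.
Variable d : nat.
Implicit Types f g : Fn d.

(** Support in a cube instead of a ball, which fits the lattice sums; [supp_in_bsupp] and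
    [bsupp_supp_in] convert between the two. *)
Definition bsupp (M : R) f := forall x i, M < Rabs (x i) -> f x = C0.

Lemma supp_in_bsupp f r : supp_in f r -> bsupp r f.
Proof. by move=> H x i Hi; apply: H; apply: Rlt_le_trans Hi _; exact: vnorm_coord. Qed.

Lemma bsupp_supp_in f M : bsupp M f -> supp_in f (INR d * M).
Proof.
move=> H x Hx; apply: NNPP => nf.
have Hb i : Rabs (x i) <= M by apply: Rnot_lt_le => /H.
have := Rle_trans _ _ _ (vnorm_le_sum _ x) (sumR_le _ _ _ (fun=> M) Hb).
by rewrite sumR_const; lra.
Qed.

Lemma bsupp_le f M M' : M <= M' -> bsupp M f -> bsupp M' f.
Proof. by move=> h H x i Hi; apply: (H x i); lra. Qed.

Lemma bsupp_nonneg f M : bsupp M f -> exists M', 0 <= M' /\ bsupp M' f.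
Proof.
move=> H; exists (Rmax M 0); split; first exact: Rmax_r.
exact: bsupp_le (Rmax_l _ _) H.
Qed.

Lemma Un_cv_sub (u : nat -> R) l (s : nat -> nat) :
  (forall n, (n <= s n)%N) -> Un_cv u l -> Un_cv (fun n => u (s n)) l.
Proof.
move=> hs H eps /H [N HN]; exists N => n hn; apply: HN.
by have /leP := hs n; lia.
Qed.

Lemma bounded_subsequence (u : nat -> R) M : (forall n, Rabs (u n) <= M) ->
  exists s l, (forall n, (n <= s n)%N) /\ Un_cv (fun n => u (s n)) l.
Proof.
move=> H.
have [l Hl] := Bolzano_Weierstrass u (fun c => - M <= c <= M) (compact_P3 _ _)
  (fun n => proj1 (Rabs_le_between _ _) (H n)).
have Hs (n : nat) : exists p, (n <= p)%N /\ Rabs (u p - l) <= / INR n.+1.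
  have Hp : 0 < / INR n.+1 by apply: Rinv_0_lt_compat; apply: lt_0_INR; lia.
  have [|p [hp Hd]] := Hl (disc l (mkposreal _ Hp)) n; first by exists (mkposreal _ Hp).
  exists p; split; first by apply/leP.
  exact: Rlt_le.
have [s Hs'] := choice _ Hs.
exists s, l; split=> [n|]; first by case: (Hs' n).
by apply: Un_cv_invS => n; case: (Hs' n).
Qed.

Lemma pcv_subsequence (u : nat -> Pt d) M : (forall n i, Rabs (u n i) <= M) ->
  exists s x, (forall n, (n <= s n)%N) /\ pcv d (fun n => u (s n)) x.
Proof.
move=> H.
have main k : exists s, (forall n, (n <= s n)%N) /\
    forall i : 'I_d, (i < k)%N -> exists l, Un_cv (fun n => u (s n) i) l.
  elim: k => [|k [s [hs Hs]]]; first by exists id.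
  case: (ltnP k d) => hk; last first.
    by exists s; split=> // i _; apply: Hs; exact: leq_trans (ltn_ord i) hk.
  pose i0 := Ordinal hk.
  have [s' [l [hs' Hl]]] := bounded_subsequence (fun n => u (s n) i0) M (fun n => H _ _).
  exists (fun n => s (s' n)); split=> [n|i]; first exact: leq_trans (hs' n) (hs _).
  rewrite ltnS leq_eqVlt => /orP [/eqP e|hi].
    by exists l; have -> : i = i0 by exact: val_inj.
  have [l' Hl'] := Hs i hi.
  by exists l'; apply: (Un_cv_sub (fun n => u (s n) i)).
have [s [hs Hs]] := main d.
have [x Hx] := choice _ (fun i => Hs i (ltn_ord i)).
by exists s, x.
Qed.

Definition ucont f := forall eps, 0 < eps -> exists del, 0 < del /\
  forall x y : Pt d, (forall i, Rabs (x i - y i) <= del) -> Cnorm (Csub (f x) (f y)) <= eps.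

Lemma compact_ucont f M : Ccont f -> bsupp M f -> ucont f.
Proof.
move=> /Ccont_scont cf sf eps He; apply: NNPP => nuc.
have Hn (n : nat) : exists p : Pt d * Pt d, (forall i, Rabs (p.1 i - p.2 i) <= / INR n.+1) /\
    eps < Cnorm (Csub (f p.1) (f p.2)).
  apply: NNPP => nex; apply: nuc; exists (/ INR n.+1); split.
    by apply: Rinv_0_lt_compat; apply: lt_0_INR; lia.
  by move=> x y hxy; apply: Rnot_lt_le => h; apply: nex; exists (x, y).
have [u Hu] := choice _ Hn.
have inv1 (n : nat) : / INR n.+1 <= 1.
  rewrite -[X in _ <= X]Rinv_1; apply: Rinv_le_contravar; first lra.
  by rewrite S_INR; have := pos_INR n; lra.
(* If the first point of a pair leaves the cube of size [M + 1], both points lie outside the support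
   and the values agree; so the offending pairs are bounded. *)
have Hb n i : Rabs ((u n).1 i) <= M + 1.
  apply: Rnot_lt_le => h; have [hd] := Hu n.
  rewrite (sf (u n).1 i); last by lra.
  rewrite (sf (u n).2 i).
    by rewrite (_ : Csub C0 C0 = C0) ?Cnorm0; [lra | ring].
  have := Rabs_triang ((u n).1 i - (u n).2 i) ((u n).2 i).
  rewrite (_ : (u n).1 i - (u n).2 i + (u n).2 i = (u n).1 i); last by ring.
  by have := hd i; have := inv1 n; lra.
have [s [x [hs Hx]]] := pcv_subsequence (fun n => (u n).1) _ Hb.
have Hy : pcv d (fun n => (u (s n)).2) x.
  move=> i.
  have H0 : Un_cv (fun n => (u n).1 i - (u n).2 i) 0.
    by apply: Un_cv_invS => n; rewrite Rminus_0_r; case: (Hu n).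
  have := CV_minus _ _ _ _ (Hx i) (Un_cv_sub _ _ _ hs H0); rewrite Rminus_0_r.
  by congr Un_cv; apply: functional_extensionality => n; ring.
have /CvP /(_ (eps / 2) ltac:(lra)) [N1 H1] := cf _ _ Hx.
have /CvP /(_ (eps / 2) ltac:(lra)) [N2 H2] := cf _ _ Hy.
pose n := maxn N1 N2.
have [_] := Hu (s n); have := H1 n (leq_maxl _ _); have := H2 n (leq_maxr _ _).
have -> : Csub (f (u (s n)).1) (f (u (s n)).2) =
   Cadd (Csub (f (u (s n)).1) (f x)) (Copp (Csub (f (u (s n)).2) (f x))) by ring.
have := Cnorm_triangle (Csub (f (u (s n)).1) (f x)) (Copp (Csub (f (u (s n)).2) (f x))).
by rewrite Cnorm_opp; lra.
Qed.

Lemma compact_bounded f M : Ccont f -> bsupp M f -> exists B, forall x, Cnorm (f x) <= B.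
Proof.
move=> /Ccont_scont cf sf; apply: NNPP => nb.
have Hn (n : nat) : exists x : Pt d, INR n < Cnorm (f x).
  apply: NNPP => nex; apply: nb; exists (INR n) => x.
  by apply: Rnot_lt_le => h; apply: nex; exists x.
have [u Hu] := choice _ Hn.
have Hb n i : Rabs (u n i) <= M.
  apply: Rnot_lt_le => h; have := Hu n; rewrite (sf _ _ h) Cnorm0.
  by have := pos_INR n; lra.
have [s [x [hs Hx]]] := pcv_subsequence u _ Hb.
have /CvP /(_ 1 Rlt_0_1) [N HN] := cf _ _ Hx.
have [K HK] := INR_unbounded (Cnorm (f x) + 1).
pose n := maxn N K; have := HN n (leq_maxl _ _); have := Hu (s n).
have : INR K <= INR (s n) by apply/le_INR/leP/(leq_trans _ (hs n)); exact: leq_maxr.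
have := Cnorm_triangle (Csub (f (u (s n))) (f x)) (f x).
by rewrite (_ : Cadd (Csub _ _) _ = f (u (s n))); [lra | ring].
Qed.

End CompactSupport.

(** * Sums over the lattice Z^d *)

Section Lattice.
Variable d : nat.
Notation idx := {ffun 'I_d -> Z}.

Definition cube (a : Z) (L : nat) : seq idx :=
  [seq [ffun i => (a + Z.of_nat (r i))%Z] | r : {ffun 'I_d -> 'I_L}].

Lemma mem_cube a L (k : idx) :
  (k \in cube a L) <-> (forall i, (a <= k i < a + Z.of_nat L)%Z).
Proof.
split=> [/imageP [r _ ->] i|H].
  by rewrite ffunE; case: (r i) => x /= /ltP; lia.
have hL i : (Z.to_nat (k i - a) < L)%N by apply/ltP; have := H i; lia.
apply/imageP; exists [ffun i => Ordinal (hL i)] => //.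
by apply/ffunP => i; rewrite !ffunE /= Z2Nat.id; have := H i; lia.
Qed.

Lemma uniq_cube a L : uniq (cube a L).
Proof.
rewrite map_inj_uniq ?enum_uniq // => r r' /ffunP H.
apply/ffunP => i; apply: val_inj; have := H i; rewrite !ffunE => e /=.
by apply: Nat2Z.inj; lia.
Qed.

Lemma size_cube a L : size (cube a L) = (L ^ d)%N.
Proof. by rewrite size_image card_ffun !card_ord. Qed.

Lemma lattice_sum_supp (s t : seq idx) (F : idx -> Cplx) : uniq s -> uniq t ->
  (forall k, F k <> C0 -> k \in s /\ k \in t) ->
  \big[Cadd/C0]_(k <- s) F k = \big[Cadd/C0]_(k <- t) F k.
Proof.
move=> us ut H; apply: perm_big_supp; apply: uniq_perm; rewrite ?filter_uniq // => k.
rewrite !mem_filter; case: eqP => //= /H [ks kt].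
by rewrite ks kt.
Qed.

Definition grid (N : nat) (k : idx) : Pt d := fun i => IZR (k i) / INR N.

(** Rounded up, so that [box M N] contains every grid point of [[-M, M]^d]. *)
Definition radius (M : R) (N : nat) : nat := Z.to_nat (up (M * INR N)).
Definition box (M : R) (N : nat) : seq idx :=
  cube (- Z.of_nat (radius M N)) (2 * radius M N).+1.

(** Unlike in [riemann_sum], the range [M] is independent of the mesh [1 / N], so that sums with
    different meshes can be compared. *)
Definition grid_sum (M : R) (N : nat) (g : Fn d) : Cplx :=
  Cmul (RtoC (/ INR N ^ d)) (\big[Cadd/C0]_(k <- box M N) g (grid N k)).

Lemma radius_bounds M N : 0 <= M -> M * INR N <= INR (radius M N) <= M * INR N + 1.
Proof.
move=> HM; have [h1 h2] := archimed (M * INR N).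
have h0 : 0 <= M * INR N by apply: Rmult_le_pos => //; exact: pos_INR.
have hu : (0 <= up (M * INR N))%Z by apply: le_IZR; lra.
by rewrite /radius (INR_IZR_INZ (Z.to_nat _)) Z2Nat.id //; lra.
Qed.

Lemma mem_box M N (k : idx) : (forall i, Rabs (IZR (k i)) <= INR (radius M N)) -> k \in box M N.
Proof.
move=> H; apply/mem_cube => i; have := H i.
rewrite INR_IZR_INZ => /Rabs_le_between []; rewrite -opp_IZR => h1 h2.
have {}h1 := le_IZR _ _ h1; have {}h2 := le_IZR _ _ h2.
by rewrite Nat2Z.inj_succ Nat2Z.inj_mul; lia.
Qed.

Lemma grid_bound N (k : idx) M i : (0 < N)%N ->
  Rabs (grid N k i) <= M -> Rabs (IZR (k i)) <= M * INR N.
Proof.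
move=> /ltP /lt_0_INR hN; rewrite /grid /Rdiv Rabs_mult (Rabs_pos_eq (/ _)); last first.
  exact/Rlt_le/Rinv_0_lt_compat.
move=> h; have := Rmult_le_compat_r _ _ _ (Rlt_le _ _ hN) h.
by rewrite Rmult_assoc Rinv_l ?Rmult_1_r //; lra.
Qed.

Lemma bsupp_grid M g N (k : idx) : (0 < N)%N -> bsupp d M g -> g (grid N k) <> C0 ->
  forall i, Rabs (IZR (k i)) <= M * INR N.
Proof.
move=> hN sg nz i; apply: grid_bound => //.
by apply: Rnot_lt_le => /sg.
Qed.

Lemma grid_sum_indep M M' N g : (0 < N)%N -> 0 <= M -> 0 <= M' ->
  bsupp d M g -> bsupp d M' g -> grid_sum M N g = grid_sum M' N g.
Proof.
move=> hN hM hM' sg sg'; congr Cmul; apply: lattice_sum_supp; try exact: uniq_cube.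
move=> k nz; split; apply: mem_box => i.
  by apply: Rle_trans (proj1 (radius_bounds M N hM)); exact: bsupp_grid sg nz i.
by apply: Rle_trans (proj1 (radius_bounds M' N hM')); exact: bsupp_grid sg' nz i.
Qed.

Lemma INR_expn a k : INR (a ^ k)%N = INR a ^ k.
Proof. by elim: k => [//|k IH]; rewrite expnS mult_INR IH. Qed.

Lemma Rsum_const (I : Type) (r : seq I) c : \big[Rplus/0]_(i <- r) c = INR (size r) * c.
Proof.
elim: r => [|i r IH]; first by rewrite big_nil /=; lra.
by rewrite big_cons IH (_ : size (i :: r) = (size r).+1) // S_INR; lra.
Qed.

(** A side of the box has [2 radius + 1 <= 2 M N + 3] points, and [3 / N <= 3]. *)
Lemma box_volume M N : (0 < N)%N -> 0 <= M ->
  / INR N ^ d * INR (size (box M N)) <= (2 * M + 3) ^ d.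
Proof.
move=> hN hM; have hN0 : 0 < INR N by apply/lt_0_INR/ltP.
have hN1 : 1 <= INR N by apply: (le_INR 1); apply/leP.
rewrite size_cube INR_expn -pow_inv -Rpow_mult_distr.
have [h1 h2] := radius_bounds M N hM.
apply: pow_incr; split.
  by apply: Rmult_le_pos; [exact/Rlt_le/Rinv_0_lt_compat | exact: pos_INR].
apply: (Rmult_le_reg_l (INR N)) => //; rewrite -Rmult_assoc Rinv_r; last lra.
rewrite S_INR mult_INR [INR 2]/=; nra.
Qed.

Lemma grid_sum_bound M N g B : (0 < N)%N -> 0 <= M -> 0 <= B ->
  (forall x, Cnorm (g x) <= B) -> Cnorm (grid_sum M N g) <= B * (2 * M + 3) ^ d.
Proof.
move=> hN hM hB Hg; have hN0 : 0 < INR N by apply/lt_0_INR/ltP.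
have hp : 0 < / INR N ^ d by apply/Rinv_0_lt_compat/pow_lt.
rewrite CnormM Cnorm_RtoC (Rabs_pos_eq _ (Rlt_le _ _ hp)).
have := Cnorm_sum_le _ (box M N) (fun k => g (grid N k)) (fun=> B) (fun k => Hg _).
rewrite Rsum_const => h.
have h1 := Rmult_le_compat_l _ _ _ (Rlt_le _ _ hp) h.
have h2 := Rmult_le_compat_r _ _ _ hB (box_volume M N hN hM).
by rewrite (Rmult_comm B); rewrite -Rmult_assoc in h1; lra.
Qed.

Lemma grid_sum_lin M N c f g : grid_sum M N (fun x => Cadd (f x) (Cmul c (g x))) =
  Cadd (grid_sum M N f) (Cmul c (grid_sum M N g)).
Proof.
rewrite /grid_sum big_split -(big_distrr (times := Cmul)) /=; ring.
Qed.

Lemma grid_sum_shift M M' N g (p : idx) : (0 < N)%N -> 0 <= M -> 0 <= M' -> bsupp d M g ->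
  bsupp d M' (fun x => g (vadd x (grid N p))) ->
  grid_sum M' N (fun x => g (vadd x (grid N p))) = grid_sum M N g.
Proof.
move=> hN hM hM' sg sg'; congr Cmul.
have hN0 : 0 < INR N by apply/lt_0_INR/ltP.
pose sh (k : idx) : idx := [ffun i => (k i + p i)%Z].
pose un (k : idx) : idx := [ffun i => (k i - p i)%Z].
have shK : cancel sh un by move=> k; apply/ffunP => i; rewrite !ffunE; exact: Z.add_simpl_r.
have unK : cancel un sh by move=> k; apply/ffunP => i; rewrite !ffunE; exact: Z.sub_add.
have E k : vadd (grid N k) (grid N p) = grid N (sh k).
  by apply: functional_extensionality => i; rewrite /vadd /grid ffunE plus_IZR; field; lra.
under eq_bigr => k _ do rewrite E.
rewrite -(big_map sh xpredT (fun k => g (grid N k))).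
apply: lattice_sum_supp; [|exact: uniq_cube|].
  by rewrite map_inj_uniq ?uniq_cube //; exact: can_inj shK.
move=> k nz; split; last first.
  apply: mem_box => i; apply: Rle_trans (proj1 (radius_bounds M N hM)).
  exact: bsupp_grid sg nz i.
rewrite -(unK k); apply: map_f; apply: mem_box => i.
apply: Rle_trans (proj1 (radius_bounds M' N hM')).
by apply: bsupp_grid hN sg' _ i; rewrite /= E unK.
Qed.

Lemma grid_sum_opp M N g : (0 < N)%N -> 0 <= M -> bsupp d M g ->
  grid_sum M N (fun x => g (vscal (-1) x)) = grid_sum M N g.
Proof.
move=> hN hM sg; congr Cmul.
have hN0 : 0 < INR N by apply/lt_0_INR/ltP.
pose op (k : idx) : idx := [ffun i => (- k i)%Z].
have opK : cancel op op by move=> k; apply/ffunP => i; rewrite !ffunE; exact: Z.opp_involutive.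
have E k : vscal (-1) (grid N k) = grid N (op k).
  by apply: functional_extensionality => i; rewrite /vscal /grid ffunE opp_IZR; field; lra.
under eq_bigr => k _ do rewrite E.
rewrite -(big_map op xpredT (fun k => g (grid N k))).
apply: lattice_sum_supp; [|exact: uniq_cube|].
  by rewrite map_inj_uniq ?uniq_cube //; exact: can_inj opK.
have h k : g (grid N k) <> C0 -> forall i, Rabs (IZR (k i)) <= INR (radius M N).
  move=> nz i; apply: Rle_trans (proj1 (radius_bounds M N hM)); exact: bsupp_grid sg nz i.
move=> k /h nz; split; last exact: mem_box.
rewrite -(opK k); apply: map_f; apply: mem_box => i.
by rewrite ffunE opp_IZR Rabs_Ropp.
Qed.

(** A fine index is [L q + r] with [0 <= r < L] in each coordinate, and its point is within [1 / N]
    of the coarse point [q / N]. Rounding down may lead just outside the cube, so [q] runs over the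
    box of [M + 1]; this gives [2 (M + 1) + 3 = 2 M + 5]. *)
Lemma grid_sum_refine M N L g eps : (0 < N)%N -> (0 < L)%N -> 0 <= M -> 0 <= eps -> bsupp d M g ->
  (forall x y, (forall i, Rabs (x i - y i) <= / INR N) -> Cnorm (Csub (g x) (g y)) <= eps) ->
  Cnorm (Csub (grid_sum M (N * L) g) (grid_sum M N g)) <= eps * (2 * M + 5) ^ d.
Proof.
move=> hN hL hM he sg osc.
have hN0 : 0 < INR N by apply/lt_0_INR/ltP.
have hL0 : 0 < INR L by apply/lt_0_INR/ltP.
have hLz : (0 < Z.of_nat L)%Z by move/ltP: hL; lia.
have hNL : (0 < N * L)%N by rewrite muln_gt0 hN.
have hM1 : 0 <= M + 1 by lra.
have sg1 : bsupp d (M + 1) g by apply: bsupp_le sg; lra.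
rewrite (grid_sum_indep M (M + 1) N g) //.
pose co (q r : idx) : idx := [ffun i => (Z.of_nat L * q i + r i)%Z].
have fine : \big[Cadd/C0]_(k <- box M (N * L)) g (grid (N * L) k) =
   \big[Cadd/C0]_(q <- box (M + 1) N) \big[Cadd/C0]_(r <- cube 0 L) g (grid (N * L) (co q r)).
  rewrite -(big_allpairs_dep (h := co) (r1 := box (M + 1) N) (r2 := fun=> cube 0 L) (F := fun k => g (grid (N * L) k))).
  apply: lattice_sum_supp; first exact: uniq_cube.
    apply: allpairs_uniq; try exact: uniq_cube.
    move=> [q r] [q' r'] /allpairsP [[q1 r1] [_ /mem_cube hr [-> ->]]]
       /allpairsP [[q2 r2] [_ /mem_cube hr' [-> ->]]] /= /ffunP H.
    suff hq : q1 = q2 /\ r1 = r2 by case: hq => -> ->.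
    have hi i : q1 i = q2 i /\ r1 i = r2 i.
      have := H i; rewrite !ffunE; apply: (Z.div_mod_unique (Z.of_nat L)); left; [exact: hr | exact: hr'].
    by split; apply/ffunP => i; case: (hi i).
  move=> k nz.
  have hk := bsupp_grid _ _ _ _ hNL sg nz.
  split; first by apply: mem_box => i; apply: Rle_trans (hk i) _; exact: (proj1 (radius_bounds M _ hM)).
  apply/allpairsP; exists ([ffun i => (k i / Z.of_nat L)%Z], [ffun i => (k i mod Z.of_nat L)%Z]).
  split=> /=.
  - apply: mem_box => i; apply: Rle_trans (proj1 (radius_bounds _ N hM1)).
    rewrite ffunE; have := hk i; rewrite mult_INR -Rmult_assoc (INR_IZR_INZ L).
    have hN1 : 1 <= INR N by apply: (le_INR 1); apply/leP.
    have hLz' : 1 <= IZR (Z.of_nat L) by apply: IZR_le; lia.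
    have [hq1 hq2] : IZR (Z.of_nat L) * IZR (k i / Z.of_nat L) <= IZR (k i) /\
       IZR (k i) <= IZR (Z.of_nat L) * IZR (k i / Z.of_nat L) + IZR (Z.of_nat L).
      rewrite -mult_IZR -plus_IZR; split; apply: IZR_le; have := Z.div_mod (k i) (Z.of_nat L);
      have := Z.mod_pos_bound (k i) (Z.of_nat L) hLz; lia.
    move=> /Rabs_le_between [ha hb]; apply/Rabs_le_between.
    move: hq1 hq2 ha hb hLz' hN1; move: (IZR (k i / _)) (IZR (k i)) (IZR (Z.of_nat L)) (INR N) => q kk l n.
    by move=> *; split; nra.
  - by apply/mem_cube => i; rewrite ffunE; have := Z.mod_pos_bound (k i) (Z.of_nat L) hLz; lia.
  - by apply/ffunP => i; rewrite !ffunE; apply: Z.div_mod; lia.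
(* A coarse value is repeated [L ^ d] times, so that the two sums can be subtracted term by term. *)
have coarse q : Cmul (RtoC (/ INR N ^ d)) (g (grid N q)) =
    Cmul (RtoC (/ INR (N * L) ^ d)) (\big[Cadd/C0]_(r <- cube 0 L) g (grid N q)).
  have -> : \big[Cadd/C0]_(r <- cube 0 L) g (grid N q) = Cmul (RtoC (INR L ^ d)) (g (grid N q)).
    rewrite -INR_expn -(size_cube 0); elim: (cube 0 L) => [|r s IH].
      by rewrite big_nil (_ : RtoC _ = C0) //; ring.
    by rewrite big_cons IH (_ : size (r :: s) = (size s).+1) // S_INR RtoCD; ring.
  rewrite CmulA -RtoCM; congr (Cmul (RtoC _) _); rewrite mult_INR Rpow_mult_distr.
  by field; split; apply: pow_nonzero; lra.
rewrite /grid_sum fine (big_distrr (times := Cmul) (RtoC (/ INR N ^ d))) /=.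
under [X in Csub _ X]eq_bigr => q _ do rewrite coarse.
rewrite -(big_distrr (times := Cmul)) /=.
have -> : forall c a b, Csub (Cmul c a) (Cmul c b) = Cmul c (Cadd a (Cmul (Copp Cone) b)) by move=> *; ring.
rewrite (big_distrr (times := Cmul)) -big_split /=.
have hp : 0 < / INR (N * L) ^ d by apply/Rinv_0_lt_compat/pow_lt/lt_0_INR/ltP.
rewrite CnormM Cnorm_RtoC (Rabs_pos_eq _ (Rlt_le _ _ hp)).
have bnd q : Cnorm (Cadd (\big[Cadd/C0]_(r <- cube 0 L) g (grid (N * L) (co q r)))
       (Cmul (Copp Cone) (\big[Cadd/C0]_(r <- cube 0 L) g (grid N q)))) <= INR L ^ d * eps.
  rewrite (big_distrr (times := Cmul)) -big_split /= -INR_expn -(size_cube 0) -Rsum_const.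
  rewrite !big_seq; elim/big_rec2: _ => [|r B z hr IH]; first by rewrite Cnorm0; lra.
  apply: Rle_trans (Cnorm_triangle _ _) _; apply: Rplus_le_compat IH.
  have -> : forall a b, Cadd a (Cmul (Copp Cone) b) = Csub a b by move=> *; ring.
  apply: osc => i; rewrite /grid ffunE plus_IZR !mult_IZR mult_INR -INR_IZR_INZ.
  have -> : (INR L * IZR (q i) + IZR (r i)) / (INR N * INR L) - IZR (q i) / INR N =
     (IZR (r i) / INR L) * / INR N by field; lra.
  have /mem_cube /(_ i) [h1 h2] := hr.
  have h1' : 0 <= IZR (r i) by apply: IZR_le.
  have h2' : IZR (r i) <= INR L by rewrite INR_IZR_INZ; apply: IZR_le; exact: Z.lt_le_incl.
  have hi : 0 < / INR N by exact: Rinv_0_lt_compat.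
  have h3 : 0 <= IZR (r i) / INR L <= 1.
    split; first by apply: Rmult_le_pos => //; exact/Rlt_le/Rinv_0_lt_compat.
    by apply: (Rmult_le_reg_r (INR L)) => //; rewrite /Rdiv Rmult_assoc Rinv_l; lra.
  by rewrite Rabs_pos_eq; nra.
have := Cnorm_sum_le _ (box (M + 1) N) _ (fun=> INR L ^ d * eps) bnd.
rewrite Rsum_const => h.
have h1 := Rmult_le_compat_l _ _ _ (Rlt_le _ _ hp) h.
apply: Rle_trans h1 _.
have h2 := Rmult_le_compat_r _ _ _ he (box_volume (M + 1) N hN hM1).
have -> : / INR (N * L) ^ d * (INR (size (box (M + 1) N)) * (INR L ^ d * eps)) =
   / INR N ^ d * INR (size (box (M + 1) N)) * eps.
  rewrite mult_INR Rpow_mult_distr; field; split; apply: pow_nonzero; lra.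
by rewrite (Rmult_comm eps) (_ : 2 * M + 5 = 2 * (M + 1) + 3); [lra | ring].
Qed.

Lemma riemann_sum_lattice g n : riemann_sum g n = Cmul (RtoC (/ INR n.+1 ^ d))
  (\big[Cadd/C0]_(k <- cube (- Z.of_nat (n * n)%N) (2 * (n * n)).+1) g (grid n.+1 k)).
Proof.
rewrite mulnA /riemann_sum -(big_distrr (times := Cmul)) /=; congr Cmul.
rewrite /cube big_image_cond /=; apply: eq_bigr => k _; congr g.
apply: functional_extensionality => i; rewrite /grid ffunE plus_IZR opp_IZR -!INR_IZR_INZ.
by congr (_ / _); ring.
Qed.

Lemma riemann_sum_grid_sum M g : 0 <= M -> bsupp d M g ->
  exists n0, forall n, (n0 <= n)%N -> riemann_sum g n = grid_sum M n.+1 g.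
Proof.
move=> hM sg.
(* For [n > 2 M + 1] one has [M (n + 1) <= n^2], so the range of the Riemann sum covers the
   support. *)
have [n0 hn0] := INR_unbounded (2 * M + 1).
exists n0 => n hn; rewrite riemann_sum_lattice; congr Cmul.
apply: lattice_sum_supp; try exact: uniq_cube.
move=> k nz; have hk := bsupp_grid _ _ _ _ (ltn0Sn n) sg nz.
split; last by apply: mem_box => i; apply: Rle_trans (proj1 (radius_bounds M n.+1 hM)); exact: hk.
apply/mem_cube => i; have := hk i.
have hn' : INR n0 <= INR n by apply/le_INR/leP.
have : M * INR n.+1 <= INR (n * n) by rewrite mult_INR S_INR; nra.
rewrite (INR_IZR_INZ (n * n)) => h1 h2.
have /Rabs_le_between [h3 h4] := Rle_trans _ _ _ h2 h1.
rewrite -opp_IZR in h3; have := le_IZR _ _ h3; have := le_IZR _ _ h4.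
rewrite Nat2Z.inj_succ Nat2Z.inj_mul; lia.
Qed.

End Lattice.

(** * The integral *)

Lemma Cv_eventually u v l n0 : (forall n, (n0 <= n)%N -> u n = v n) -> Cv u l -> Cv v l.
Proof.
move=> E /CvP H; apply/CvP => eps /H [N HN]; exists (maxn n0 N) => n.
by rewrite geq_max => /andP [h1 h2]; rewrite -E //; exact: HN.
Qed.

Lemma Cv_sub u l (s : nat -> nat) : (forall n, (n <= s n)%N) -> Cv u l -> Cv (fun n => u (s n)) l.
Proof. by move=> hs [H1 H2]; split; [apply: (Un_cv_sub (fun n => fst (u n))) | apply: (Un_cv_sub (fun n => snd (u n)))]. Qed.

Lemma Cv_norm_le u l c B : Cv u l -> (forall n, Cnorm (Csub (u n) c) <= B) -> Cnorm (Csub l c) <= B.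
Proof.
move=> /CvP H HB; apply: Rnot_lt_le => h.
have [N HN] := H (Cnorm (Csub l c) - B) ltac:(lra).
have := HN N (leqnn N); have := HB N.
have := Cnorm_triangle (Csub (u N) c) (Csub l (u N)).
rewrite (Cnorm_sub_sym l (u N)) (_ : Cadd _ _ = Csub l c); [lra | ring].
Qed.

Lemma Cauchy_Cv (u : nat -> Cplx) :
  (forall eps, 0 < eps -> exists N, forall n m, (N <= n)%N -> (N <= m)%N -> Cnorm (Csub (u n) (u m)) < eps) ->
  exists l, Cv u l.
Proof.
move=> H.
have [l1 H1] : {l | Un_cv (fun n => fst (u n)) l}.
  apply: R_complete => eps /H [N HN]; exists N => n m /leP hn /leP hm.
  apply: Rle_lt_trans (HN n m hn hm); exact: (Cnorm_fst (Csub _ _)).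
have [l2 H2] : {l | Un_cv (fun n => snd (u n)) l}.
  apply: R_complete => eps /H [N HN]; exists N => n m /leP hn /leP hm.
  apply: Rle_lt_trans (HN n m hn hm); exact: (Cnorm_snd (Csub _ _)).
by exists (l1, l2).
Qed.

Lemma small_invS del : 0 < del -> exists n0, forall n, (n0 <= n)%N -> / INR n.+1 <= del.
Proof.
move=> hd; have [N [h1 h2]] := archimed_cor1 del hd.
exists N => n /leP hn; apply: Rle_trans (Rlt_le _ _ h1).
by apply: Rinv_le_contravar; [exact: lt_0_INR | apply: le_INR; lia].
Qed.

Section Integral.
Variable d : nat.
Implicit Types f g : Fn d.

Definition compactly_supported g := exists M, bsupp d M g.
Definition cc g := Ccont g /\ compactly_supported g.

Let vol M := (2 * M + 5) ^ d.
Let vol_pos M : 0 <= M -> 0 < vol M. Proof. by move=> h; apply: pow_lt; lra. Qed.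

(** The sums of two meshes are both close to the sum of their common refinement, whose denominator
    is the product. *)
Lemma grid_sum_cauchy M g : 0 <= M -> bsupp d M g -> Ccont g ->
  exists l, Cv (fun n => grid_sum d M n.+1 g) l.
Proof.
move=> hM sg cg; apply: Cauchy_Cv => eps he.
have uc := compact_ucont _ _ _ cg sg.
have hv := vol_pos M hM.
have he' : 0 < eps / (3 * vol M) by apply: Rdiv_lt_0_compat; lra.
have [del [hd osc]] := uc _ he'.
have [n0 hn0] := small_invS _ hd.
have key n m : (n0 <= n)%N -> Cnorm (Csub (grid_sum d M (n.+1 * m.+1) g) (grid_sum d M n.+1 g)) <= eps / 3.
  move=> hn; have -> : eps / 3 = eps / (3 * vol M) * vol M by field; lra.
  apply: grid_sum_refine => //; first lra.
  by move=> x y hxy; apply: osc => i; apply: Rle_trans (hxy i) (hn0 n hn).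
exists n0 => n m hn hm; have := key n m hn; have := key m n hm; rewrite mulnC => h1 h2.
have := Cnorm_triangle (Csub (grid_sum d M (n.+1 * m.+1) g) (grid_sum d M m.+1 g))
  (Copp (Csub (grid_sum d M (n.+1 * m.+1) g) (grid_sum d M n.+1 g))).
rewrite Cnorm_opp (_ : Cadd _ _ = Csub (grid_sum d M n.+1 g) (grid_sum d M m.+1 g)); [lra | ring].
Qed.

(** A total function: [epsilon] picks the limit, which exists for continuous functions of compact
    support by [integral_riemann]. *)
Definition integral g : Cplx := epsilon (inhabits C0) (fun l => Cv (riemann_sum g) l).

Lemma integral_riemann g : cc g -> Cv (riemann_sum g) (integral g).
Proof.
move=> [cg [M0 /bsupp_nonneg [M [hM sg]]]].
apply: (epsilon_spec (inhabits C0) (fun l => Cv (riemann_sum g) l)).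
have [l Hl] := grid_sum_cauchy M g hM sg cg.
have [n0 E] := riemann_sum_grid_sum d M g hM sg.
by exists l; apply: (Cv_eventually _ _ _ n0) Hl => n /E.
Qed.

Lemma integral_grid_sum M g : 0 <= M -> bsupp d M g -> Ccont g ->
  Cv (fun n => grid_sum d M n.+1 g) (integral g).
Proof.
move=> hM sg cg; have [n0 E] := riemann_sum_grid_sum d M g hM sg.
apply: (Cv_eventually _ _ _ n0 E); apply: integral_riemann; split=> //; by exists M.
Qed.

Lemma common_bsupp f g : compactly_supported f -> compactly_supported g ->
  exists M, 0 <= M /\ bsupp d M f /\ bsupp d M g.
Proof.
move=> [M1 H1] [M2 H2]; exists (Rmax 0 (Rmax M1 M2)); split; first exact: Rmax_l.
have h := Rmax_r 0 (Rmax M1 M2); have h1 := Rmax_l M1 M2; have h2 := Rmax_r M1 M2.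
by split; [apply: bsupp_le H1 | apply: bsupp_le H2]; lra.
Qed.

Lemma bsupp_lin M f g c : bsupp d M f -> bsupp d M g ->
  bsupp d M (fun x => Cadd (f x) (Cmul c (g x))).
Proof. by move=> H1 H2 x i hx; rewrite (H1 x i) // (H2 x i) //; ring. Qed.

Lemma bsupp_mulr M f g : bsupp d M g -> bsupp d M (fun x => Cmul (f x) (g x)).
Proof. by move=> H2 x i hx; rewrite (H2 x i) //; ring. Qed.

Lemma Ccont_lin f g c : Ccont f -> Ccont g -> Ccont (fun x => Cadd (f x) (Cmul c (g x))).
Proof.
move=> /Ccont_scont Hf /Ccont_scont Hg; apply/Ccont_scont => u x Hu.
by apply: Cv_add; [exact: Hf | apply: Cv_mul; [exact: Cv_const | exact: Hg]].
Qed.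

Lemma Ccont_mul f g : Ccont f -> Ccont g -> Ccont (fun x => Cmul (f x) (g x)).
Proof.
move=> /Ccont_scont Hf /Ccont_scont Hg; apply/Ccont_scont => u x Hu.
by apply: Cv_mul; [exact: Hf | exact: Hg].
Qed.

Lemma Ccont_affine f a y : Ccont f -> Ccont (fun x => f (vadd (vscal a x) y)).
Proof.
move=> /Ccont_scont Hf; apply/Ccont_scont => u x Hu; apply: Hf => i.
apply: CV_plus; last exact: (proj1 (Cv_const (RtoC (y i)))).
by apply: CV_mult => //; exact: (proj1 (Cv_const (RtoC a))).
Qed.

Lemma vscal1 (x : Pt d) : vscal 1 x = x.
Proof. by apply: functional_extensionality => i; rewrite /vscal; ring. Qed.

Lemma Ccont_shift f y : Ccont f -> Ccont (fun x => f (vadd x y)).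
Proof.
move=> /(Ccont_affine _ 1 y); congr Ccont.
by apply: functional_extensionality => x; rewrite vscal1.
Qed.

Lemma bsupp_shift M f y : bsupp d M f -> bsupp d (M + vnorm y) (fun x => f (vadd x y)).
Proof.
move=> sf x i hx; apply: (sf _ i); rewrite /vadd.
have := Rabs_triang (x i + y i) (- y i); rewrite Rabs_Ropp.
rewrite (_ : x i + y i + - y i = x i); last by ring.
by have := vnorm_coord _ y i; lra.
Qed.

Lemma cc_mul e f : Ccont e -> cc f -> cc (fun x => Cmul (e x) (f x)).
Proof.
by move=> ce [cf [M sf]]; split; [exact: Ccont_mul | exists M; exact: bsupp_mulr].
Qed.

Lemma cc_shift f y : cc f -> cc (fun x => f (vadd x y)).
Proof.
by move=> [cf [M sf]]; split; [exact: Ccont_shift | exists (M + vnorm y); exact: bsupp_shift].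
Qed.

Lemma cc_lin f g c : cc f -> cc g -> cc (fun x => Cadd (f x) (Cmul c (g x))).
Proof.
move=> [cf sf] [cg sg]; split; first exact: Ccont_lin.
by have [M [_ [h1 h2]]] := common_bsupp _ _ sf sg; exists M; exact: bsupp_lin.
Qed.

Lemma integral_lin f g c : cc f -> cc g ->
  integral (fun x => Cadd (f x) (Cmul c (g x))) = Cadd (integral f) (Cmul c (integral g)).
Proof.
move=> [cf sf] [cg sg]; have [M [hM [sf' sg']]] := common_bsupp _ _ sf sg.
apply: Cv_unique (integral_grid_sum M _ hM (bsupp_lin _ _ _ _ sf' sg') (Ccont_lin _ _ _ cf cg)) _.
apply: Cv_ext (Cv_add _ _ _ _ (integral_grid_sum M f hM sf' cf)
   (Cv_mul _ _ _ _ (Cv_const c) (integral_grid_sum M g hM sg' cg))) => n.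
by rewrite grid_sum_lin.
Qed.

Lemma cc0 : cc (fun=> C0).
Proof. by split; [exact/EP_Ccont/EP_const | exists 0]. Qed.

Lemma integral0 : integral (fun=> C0) = C0.
Proof.
have := integral_lin _ _ (Copp Cone) cc0 cc0.
have -> : (fun _ : Pt d => Cadd C0 (Cmul (Copp Cone) C0)) = fun=> C0.
  by apply: functional_extensionality => x; ring.
by move=> ->; ring.
Qed.

Lemma integral_sum (I : Type) (r : seq I) (F : I -> Fn d) (c : I -> Cplx) : (forall i, cc (F i)) ->
  cc (fun x => \big[Cadd/C0]_(i <- r) Cmul (c i) (F i x)) /\
  integral (fun x => \big[Cadd/C0]_(i <- r) Cmul (c i) (F i x)) =
  \big[Cadd/C0]_(i <- r) Cmul (c i) (integral (F i)).
Proof.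
move=> H; elim: r => [|i r [IH1 IH2]].
  have -> : (fun x => \big[Cadd/C0]_(i <- [::]) Cmul (c i) (F i x)) = fun=> C0.
    by apply: functional_extensionality => x; rewrite big_nil.
  by rewrite big_nil integral0; split=> //; exact: cc0.
have -> : (fun x => \big[Cadd/C0]_(i <- i :: r) Cmul (c i) (F i x)) =
  fun x => Cadd (\big[Cadd/C0]_(i <- r) Cmul (c i) (F i x)) (Cmul (c i) (F i x)).
  by apply: functional_extensionality => x; rewrite big_cons CaddC.
split; first exact: cc_lin.
by rewrite integral_lin // IH2 big_cons CaddC.
Qed.

Lemma integral_bound M g B : 0 <= M -> 0 <= B -> bsupp d M g -> Ccont g ->
  (forall x, Cnorm (g x) <= B) -> Cnorm (integral g) <= B * vol M.
Proof.
move=> hM hB sg cg Hg.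
have -> : integral g = Csub (integral g) C0 by ring.
apply: Cv_norm_le (integral_grid_sum M g hM sg cg) _ => n.
rewrite (_ : Csub _ C0 = grid_sum d M n.+1 g); last by ring.
apply: Rle_trans (grid_sum_bound _ _ _ _ B _ hM hB Hg) _ => //.
by apply: Rmult_le_compat_l => //; apply: pow_incr; lra.
Qed.

Lemma integral_error M N g eps : (0 < N)%N -> 0 <= M -> 0 <= eps -> bsupp d M g -> Ccont g ->
  (forall x y, (forall i, Rabs (x i - y i) <= / INR N) -> Cnorm (Csub (g x) (g y)) <= eps) ->
  Cnorm (Csub (integral g) (grid_sum d M N g)) <= eps * vol M.
Proof.
move=> hN hM he sg cg osc.
(* The subsequence of meshes with denominator [N * n.+1], all of which refine the mesh [1 / N]. *)
have hs n : (n <= (N * n.+1).-1)%N by case: N hN {osc} => // N _; rewrite mulSn addSn /= leq_addr.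
apply: Cv_norm_le (Cv_sub _ _ _ hs (integral_grid_sum M g hM sg cg)) _ => n.
rewrite prednK ?muln_gt0 ?hN //.
exact: grid_sum_refine.
Qed.

Lemma integral_opp g : cc g -> integral (fun x => g (vscal (-1) x)) = integral g.
Proof.
move=> [cg [M0 /bsupp_nonneg [M [hM sg]]]].
apply: Cv_unique (integral_grid_sum M g hM sg cg).
apply: Cv_ext (integral_grid_sum M (fun x => g (vscal (-1) x)) hM _ _) => [n||].
- by rewrite grid_sum_opp.
- by move=> x i hx; apply: (sg _ i); rewrite /vscal Rabs_mult Rabs_Ropp Rabs_R1 Rmult_1_l.
- have := Ccont_affine g (-1) (vzero d) cg; congr Ccont.
  by apply: functional_extensionality => x; rewrite vadd0.
Qed.

(** Grid sums are invariant under shifts by grid vectors, so [a] is replaced by one within [1 / N]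
    of it in each coordinate; uniform continuity controls the error. *)
Lemma integral_shift g a : cc g -> integral (fun x => g (vadd x a)) = integral g.
Proof.
move=> [cg [M0 /bsupp_nonneg [M [hM sg]]]]; apply: Csub_eq0; apply: Cnorm_small_eq0 => eps he.
(* Room for the supports of [g] shifted by [a] and by the nearby grid vector, which differs from [a]
   by at most 1 in each coordinate. *)
pose M' := M + vnorm a + INR d + 1.
have hM' : 0 <= M' by have := vnorm_ge0 _ a; have := pos_INR d; rewrite /M'; lra.
have hv := vol_pos M' hM'.
have he' : 0 < eps / (3 * vol M') by apply: Rdiv_lt_0_compat; lra.
have [del [hd osc]] := compact_ucont _ _ _ cg sg _ he'.
have [n0 hn0] := small_invS _ hd.
have sa : bsupp d M' (fun x => g (vadd x a)).
  by apply: bsupp_le (bsupp_shift _ _ a sg); have := pos_INR d; rewrite /M'; lra.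
have /CvP /(_ (eps / 3) ltac:(lra)) [n1 h1] := integral_grid_sum M' _ hM' sa (Ccont_shift _ a cg).
have /CvP /(_ (eps / 3) ltac:(lra)) [n2 h2] := integral_grid_sum M g hM sg cg.
pose n := maxn n0 (maxn n1 n2).
have {}h1 := h1 n (leq_trans (leq_maxl n1 n2) (leq_maxr n0 _)).
have {}h2 := h2 n (leq_trans (leq_maxr n1 n2) (leq_maxr n0 _)).
have {}hn0 := hn0 n (leq_maxl _ _).
have hN0 : 0 < INR n.+1 by apply: lt_0_INR; lia.
have hN1 : / INR n.+1 <= 1.
  rewrite -[X in _ <= X]Rinv_1; apply: Rinv_le_contravar; first lra.
  by rewrite S_INR; have := pos_INR n; lra.
pose p : {ffun 'I_d -> Z} := [ffun i => up (a i * INR n.+1)].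
have hp i : Rabs (grid d n.+1 p i - a i) <= / INR n.+1.
  rewrite /grid ffunE; have [u1 u2] := archimed (a i * INR n.+1).
  have -> : IZR (up (a i * INR n.+1)) / INR n.+1 - a i = (IZR (up (a i * INR n.+1)) - a i * INR n.+1) * / INR n.+1.
    by field; lra.
  have hi : 0 < / INR n.+1 by exact: Rinv_0_lt_compat.
  by rewrite Rabs_pos_eq; nra.
have sp : bsupp d M' (fun x => g (vadd x (grid d n.+1 p))).
  move=> x i hx; apply: (sg _ i); rewrite /vadd.
  have := Rabs_triang (x i + grid d n.+1 p i) (- grid d n.+1 p i); rewrite Rabs_Ropp.
  rewrite (_ : x i + _ + - _ = x i); last by ring.
  have := Rabs_triang (grid d n.+1 p i - a i) (a i).
  rewrite (_ : _ - a i + a i = grid d n.+1 p i); last by ring.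
  have := vnorm_coord _ a i; have := hp i; have := pos_INR d; move: hx; rewrite /M'; lra.
have E := grid_sum_shift d M M' n.+1 g p isT hM hM' sg sp.
have h3 : Cnorm (Csub (grid_sum d M' n.+1 (fun x => g (vadd x a))) (grid_sum d M n.+1 g)) <= eps / 3.
  rewrite -E.
  have -> : Csub (grid_sum d M' n.+1 (fun x => g (vadd x a))) (grid_sum d M' n.+1 (fun x => g (vadd x (grid d n.+1 p)))) =
    grid_sum d M' n.+1 (fun x => Cadd (g (vadd x a)) (Cmul (Copp Cone) (g (vadd x (grid d n.+1 p))))).
    by rewrite grid_sum_lin; ring.
  apply: Rle_trans (grid_sum_bound _ _ _ _ (eps / (3 * vol M')) _ hM' (Rlt_le _ _ he') _) _ => //.
    move=> x; have -> : forall a b, Cadd a (Cmul (Copp Cone) b) = Csub a b by move=> *; ring.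
    apply: osc => i; rewrite /vadd (_ : x i + a i - (x i + grid d n.+1 p i) = - (grid d n.+1 p i - a i)); last by ring.
    by rewrite Rabs_Ropp; apply: Rle_trans (hp i) hn0.
  have -> : eps / 3 = eps / (3 * vol M') * vol M' by field; lra.
  by apply: Rmult_le_compat_l; [lra | apply: pow_incr; lra].
set A := integral _ in h1 *; set B := integral g in h2 *.
set SA := grid_sum d M' _ _ in h1 h3; set SB := grid_sum d M _ _ in h2 h3.
have := Cnorm_triangle (Cadd (Copp (Csub SA A)) (Csub SA SB)) (Csub SB B).
have := Cnorm_triangle (Copp (Csub SA A)) (Csub SA SB); rewrite Cnorm_opp.
rewrite (_ : Cadd (Cadd (Copp (Csub SA A)) (Csub SA SB)) (Csub SB B) = Csub A B); [lra | ring].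
Qed.

Lemma fst_sum (I : Type) (r : seq I) (F : I -> Cplx) :
  fst (\big[Cadd/C0]_(i <- r) F i) = \big[Rplus/0]_(i <- r) fst (F i).
Proof. by elim: r => [|i r IH]; rewrite ?big_nil // !big_cons -IH. Qed.

(** If [w] were positive at the origin, it would stay above half that value on a cube [[0, del]^d],
    and the grid points there would keep the grid sums away from 0. *)
Lemma integral_eq0 (w : Pt d -> R) : (forall x, 0 <= w x) -> cc (fun x => RtoC (w x)) ->
  integral (fun x => RtoC (w x)) = C0 -> w (vzero d) = 0.
Proof.
move=> hw [cg [M0 /bsupp_nonneg [M [hM sg]]]] I0; apply: NNPP => nz.
set g := (fun x => RtoC (w x)) in cg sg I0.
have w0 : 0 < w (vzero d) by have := hw (vzero d); lra.
pose c := w (vzero d) / 2.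
have [del [hd Hc]] := compact_ucont _ _ _ cg sg c ltac:(rewrite /c; lra).
have low x : (forall i, 0 <= x i <= del) -> c <= w x.
  move=> hx; have := Hc x (vzero d) (fun i => ltac:(rewrite /vzero Rminus_0_r Rabs_pos_eq; move: (hx i); lra)).
  rewrite /g (_ : Csub _ _ = RtoC (w x - w (vzero d))); last by rewrite RtoCB.
  by rewrite Cnorm_RtoC => /Rabs_le_between; rewrite /c; lra.
have hc : 0 < c by rewrite /c; lra.
have hdel : 0 < (del / 2) ^ d by apply: pow_lt; lra.
have [n0 hn0] := small_invS (del / 2) ltac:(lra).
have /CvP /(_ (c * (del / 2) ^ d)) [|n1 h1] := integral_grid_sum M g hM sg cg; first exact: Rmult_lt_0_compat.
pose n := maxn n0 n1.
have {}h1 := h1 n (leq_maxr _ _); have {}hn0 := hn0 n (leq_maxl _ _).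
have hN0 : 0 < INR n.+1 by apply: lt_0_INR; lia.
have hdN : 2 <= del * INR n.+1.
  have h := Rmult_le_compat_r _ _ _ (Rlt_le _ _ hN0) hn0; rewrite Rinv_l in h; lra.
have [u1 u2] := archimed (del * INR n.+1).
(* Indices [0 <= k < L] give coordinates in [[0, del]], and [L > del N - 1 >= del N / 2] because
   [del N >= 2], where [N = n.+1]. *)
pose L := Z.to_nat (up (del * INR n.+1) - 1).
have hL : INR L = IZR (up (del * INR n.+1)) - 1.
  rewrite INR_IZR_INZ Z2Nat.id ?minus_IZR //; apply: le_IZR; rewrite minus_IZR; lra.
suff : c * (del / 2) ^ d <= fst (grid_sum d M n.+1 g).
  move: h1; rewrite I0 (_ : Csub _ C0 = grid_sum d M n.+1 g); last by ring.
  have := Cnorm_fst (grid_sum d M n.+1 g); have := Rle_abs (fst (grid_sum d M n.+1 g)).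
  by lra.
have hip : 0 < / INR n.+1 ^ d by apply/Rinv_0_lt_compat/pow_lt.
have -> : fst (grid_sum d M n.+1 g) = / INR n.+1 ^ d * \big[Rplus/0]_(k <- box d M n.+1) w (grid d n.+1 k).
  by rewrite /grid_sum /Cmul /= fst_sum; rewrite Rmult_0_l Rminus_0_r.
have hcube k : k \in cube d 0 L -> c <= w (grid d n.+1 k).
  move=> /mem_cube hk; apply: low => i; have [k1 k2] := hk i; rewrite /grid.
  have k1' : 0 <= IZR (k i) by exact: IZR_le.
  have k2' : IZR (k i) <= del * INR n.+1.
    have : IZR (k i) < INR L by rewrite INR_IZR_INZ; apply: IZR_lt.
    by lra.
  split; first by apply: Rmult_le_pos => //; exact/Rlt_le/Rinv_0_lt_compat.
  by apply: (Rmult_le_reg_r (INR n.+1)) => //; rewrite /Rdiv Rmult_assoc Rinv_l ?Rmult_1_r //; lra.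
have sumle : INR L ^ d * c <= \big[Rplus/0]_(k <- box d M n.+1) w (grid d n.+1 k).
  (* Cutting [w] off to the small cube can only lower the sum, and allows the range to be exchanged
     for [cube 0 L]. *)
  pose F k := if k \in cube d 0 L then RtoC (w (grid d n.+1 k)) else C0.
  apply: (Rle_trans _ (\big[Rplus/0]_(k <- box d M n.+1) fst (F k))); last first.
    by apply: sumR_le => k; rewrite /F; case: ifP => _ /=; [lra | exact: hw].
  rewrite -fst_sum (lattice_sum_supp d _ (cube d 0 L)); try exact: uniq_cube.
    rewrite fst_sum -INR_expn -(size_cube d 0) -Rsum_const !big_seq.
    by elim/big_rec2: _ => [|k a b hk]; [lra | rewrite /F hk /=; have := hcube k hk; lra].
  move=> k; rewrite /F; case: ifP => // hk nzk; split=> //.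
  apply: mem_box => i; apply: Rle_trans (proj1 (radius_bounds M n.+1 hM)).
  exact: (bsupp_grid d M g n.+1 k isT sg nzk i).
have -> : (del / 2) ^ d = / INR n.+1 ^ d * (del / 2 * INR n.+1) ^ d.
  by rewrite Rpow_mult_distr; field; apply: pow_nonzero; lra.
rewrite (Rmult_comm c) Rmult_assoc; apply: Rmult_le_compat_l; first lra.
apply: Rle_trans sumle; apply: Rmult_le_compat_r; first lra.
by apply: pow_incr; split; [nra | rewrite hL; nra].
Qed.

End Integral.

(** * Smooth functions *)

Section Smooth.
Variable d : nat.
Implicit Types f g : Fn d.

Definition smooth f := exists D, deriv_family f D.

Definition line (x : Pt d) (i : 'I_d) (s : R) : Pt d := vadd x (vscal s (unit_vec i)).

Lemma line0 x i : line x i 0 = x.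
Proof. by apply: functional_extensionality => j; rewrite /line /vadd /vscal; ring. Qed.

Lemma has_partialE i f g :
  has_partial i f g <-> forall x, cderiv (fun s => f (line x i s)) 0 (g x).
Proof. by []. Qed.

(** Smoothness asks for all iterated derivatives at once; choosing them recursively along the list
    of coordinates reduces it to an invariant [P] that is checked for one derivative. *)
Lemma smooth_coind (P : Fn d -> Prop) :
  (forall f, P f -> Ccont f /\ forall i, exists g, P g /\ has_partial i f g) ->
  forall f, P f -> smooth f.
Proof.
move=> H f Pf.
pose step (i : 'I_d) (h : {h | P h}) : {h | P h} :=
  let g := constructive_indefinite_description _ (proj2 (H _ (proj2_sig h)) i) in
  exist P (proj1_sig g) (proj1 (proj2_sig g)).
exists (fun l => proj1_sig (foldr step (exist P f Pf) l)); split=> // l.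
set h := foldr step _ l; split; first exact: (proj1 (H _ (proj2_sig h))).
move=> i.
exact: (proj2 (proj2_sig (constructive_indefinite_description _ (proj2 (H _ (proj2_sig h)) i)))).
Qed.

Lemma smooth_Ccont f : smooth f -> Ccont f.
Proof. by move=> [D [<- H]]; case: (H [::]). Qed.

Lemma smooth_partial f i : smooth f -> exists g, smooth g /\ has_partial i f g.
Proof.
move=> [D [E H]]; exists (D [:: i]); split; last by rewrite -E; exact: (proj2 (H [::])).
by exists (fun l => D (l ++ [:: i])); split.
Qed.

Lemma smooth_lin f g c : smooth f -> smooth g -> smooth (fun x => Cadd (f x) (Cmul c (g x))).
Proof.
move=> Hf Hg; apply: (smooth_coind (fun h => exists f g, smooth f /\ smooth g /\
   h = fun x => Cadd (f x) (Cmul c (g x)))); last by exists f, g.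
move=> _ {Hf Hg f g} [f [g [Hf [Hg ->]]]]; split.
  by apply: Ccont_lin; exact: smooth_Ccont.
move=> i; have [f' [Sf' Pf']] := smooth_partial f i Hf; have [g' [Sg' Pg']] := smooth_partial g i Hg.
exists (fun x => Cadd (f' x) (Cmul c (g' x))); split; first by exists f', g'.
by apply/has_partialE => x; apply: cderiv_add; [exact: Pf' | apply: cderiv_scal; exact: Pg'].
Qed.

Lemma smooth_shift f y : smooth f -> smooth (fun x => f (vadd x y)).
Proof.
move=> Hf; apply: (smooth_coind (fun h => exists f, smooth f /\ h = fun x => f (vadd x y))); last by exists f.
move=> _ {Hf f} [f [Hf ->]]; split; first exact/Ccont_shift/smooth_Ccont.
move=> i; have [f' [Sf' Pf']] := smooth_partial f i Hf.
exists (fun x => f' (vadd x y)); split; first by exists f'.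
apply/has_partialE => x; apply: cderiv_eq (Pf' (vadd x y)) _ _ => // s; congr f.
by apply: functional_extensionality => j; rewrite /line /vadd; ring.
Qed.

Lemma cderiv_conj (f : R -> Cplx) t l : cderiv f t l -> cderiv (fun s => Cconj (f s)) t (Cconj l).
Proof. by move=> [H1 H2]; split=> //; exact: derivable_pt_lim_opp. Qed.

Lemma smooth_conj f : smooth f -> smooth (fun x => Cconj (f x)).
Proof.
move=> Hf; apply: (smooth_coind (fun h => exists f, smooth f /\ h = fun x => Cconj (f x))); last by exists f.
move=> _ {Hf f} [f [Hf ->]]; split.
  have /Ccont_scont H := smooth_Ccont _ Hf; apply/Ccont_scont => u x /H [H1 H2].
  by split=> //; exact: CV_opp.
move=> i; have [f' [Sf' Pf']] := smooth_partial f i Hf.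
exists (fun x => Cconj (f' x)); split; first by exists f'.
by apply/has_partialE => x; apply: cderiv_conj; exact: Pf'.
Qed.

Lemma Ccont_sum (I : Type) (r : seq I) (F : I -> Fn d) : (forall i, List.In i r -> Ccont (F i)) ->
  Ccont (fun x => \big[Cadd/C0]_(i <- r) F i x).
Proof.
elim: r => [|i r IH] H.
  have := EP_Ccont d _ (EP_const d C0); congr Ccont.
  by apply: functional_extensionality => x; rewrite big_nil.
have := Ccont_lin d _ _ Cone (H i (or_introl erefl)) (IH (fun j hj => H j (or_intror hj))); congr Ccont.
by apply: functional_extensionality => x; rewrite big_cons; ring.
Qed.

Lemma smooth_mul f g : smooth f -> smooth g -> smooth (fun x => Cmul (f x) (g x)).
Proof.
(* A derivative of a product is a sum of two products, so the invariant has to be finite sums of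
   products. *)
pose P (h : Fn d) := exists l : seq (Fn d * Fn d),
  List.Forall (fun p => smooth p.1 /\ smooth p.2) l /\
  h = fun x => \big[Cadd/C0]_(p <- l) Cmul (p.1 x) (p.2 x).
move=> Hf Hg; apply: (smooth_coind P); last first.
  exists [:: (f, g)]; split; first by constructor.
  by apply: functional_extensionality => x; rewrite big_cons big_nil /=; ring.
move=> _ {Hf Hg f g} [l [Hl ->]]; split.
  apply: Ccont_sum => p /(proj1 (List.Forall_forall _ _) Hl) [? ?].
  by apply: Ccont_mul; exact: smooth_Ccont.
move=> i; elim: Hl => [|p l' [Sf Sg] Hl [h [[m [Hm ->]] Ph]]].
  exists (fun=> C0); split.
    by exists [::]; split=> //; apply: functional_extensionality => x; rewrite big_nil.
  by apply/has_partialE => x; apply: cderiv_eq (cderiv_const C0 0) _ _ => // s; rewrite big_nil.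
have [f' [Sf' Pf']] := smooth_partial _ i Sf; have [g' [Sg' Pg']] := smooth_partial _ i Sg.
exists (fun x => \big[Cadd/C0]_(q <- (f', p.2) :: (p.1, g') :: m) Cmul (q.1 x) (q.2 x)); split.
  by exists ((f', p.2) :: (p.1, g') :: m); split=> //; do !constructor.
apply/has_partialE => x.
apply: cderiv_eq (cderiv_add _ _ _ _ _ (cderiv_mul _ _ _ _ _ (Pf' x) (Pg' x)) (Ph x)) _ _.
  by move=> s; rewrite big_cons.
by rewrite !big_cons /= -/(line x i 0) line0; ring.
Qed.

Lemma EP_smooth f : exp_poly d f -> smooth f.
Proof.
apply: smooth_coind => {}f Hf; split; first exact: EP_Ccont.
move=> i; elim: Hf => [c|j|mu j|u v Eu [u' [Eu' Pu]] Ev [v' [Ev' Pv]]|u v Eu [u' [Eu' Pu]] Ev [v' [Ev' Pv]]].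
- exists (fun=> C0); split; first exact: EP_const.
  by apply/has_partialE => x; exact: cderiv_const.
- exists (fun=> RtoC (unit_vec i j)); split; first exact: EP_const.
  apply/has_partialE => x; apply: cderiv_RtoC.
  have := derivable_pt_lim_plus _ _ _ _ _ (derivable_pt_lim_const (x j) 0)
     (derivable_pt_lim_scal_right _ _ _ (unit_vec i j) (derivable_pt_lim_id 0)).
  by rewrite Rplus_0_l Rmult_1_l.
- exists (fun x => Cmul (RtoC (unit_vec i j)) (Cmul mu (Cexp (Cmul mu (RtoC (x j)))))); split.
    by do 2! (apply: EP_mul; first exact: EP_const); exact: EP_exp.
  apply/has_partialE => x.
  have := cderiv_affine (fun s => Cexp (Cmul mu (RtoC s))) (unit_vec i j) (x j) 0 _ (cderiv_exp mu _).
  rewrite Rmult_0_r Rplus_0_l => /cderiv_eq; apply=> // s.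
  by congr (Cexp (Cmul mu (RtoC _))); rewrite /line /vadd /vscal; ring.
- exists (fun x => Cadd (u' x) (v' x)); split; first exact: EP_add.
  by apply/has_partialE => x; apply: cderiv_add; [exact: Pu | exact: Pv].
- exists (fun x => Cadd (Cmul (u' x) (v x)) (Cmul (u x) (v' x))); split.
    by apply: EP_add; exact: EP_mul.
  apply/has_partialE => x; apply: cderiv_eq (cderiv_mul _ _ _ _ _ (Pu x) (Pv x)) _ _ => //.
  by rewrite -/(line x i 0) line0.
Qed.

(** * Test functions *)

Lemma test_fnE f : test_fn f <-> smooth f /\ compactly_supported d f.
Proof.
split=> -[Sf [r Hr]]; split=> //; first by exists r; exact: supp_in_bsupp.
by exists (INR d * r); exact: bsupp_supp_in.
Qed.

Lemma test_cc f : test_fn f -> cc d f.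
Proof. by move=> /test_fnE [/smooth_Ccont cf sf]. Qed.

Lemma test_lin f g c : test_fn f -> test_fn g -> test_fn (fun x => Cadd (f x) (Cmul c (g x))).
Proof.
move=> Tf Tg; have [Sf _] := proj1 (test_fnE f) Tf; have [Sg _] := proj1 (test_fnE g) Tg.
apply/test_fnE; split; first exact: smooth_lin.
by case: (cc_lin d f g c (test_cc _ Tf) (test_cc _ Tg)).
Qed.

Lemma test_shift f y : test_fn f -> test_fn (fun x => f (vadd x y)).
Proof.
move=> Tf; have [Sf _] := proj1 (test_fnE f) Tf; apply/test_fnE; split; first exact: smooth_shift.
by case: (cc_shift d f y (test_cc _ Tf)).
Qed.

Lemma test_conj f : test_fn f -> test_fn (fun x => Cconj (f x)).
Proof.
move=> /test_fnE [Sf [M sM]]; apply/test_fnE; split; first exact: smooth_conj.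
by exists M => x i /sM ->; rewrite /Cconj /= Ropp_0.
Qed.

Lemma test_mul f g : smooth f -> test_fn g -> test_fn (fun x => Cmul (f x) (g x)).
Proof.
move=> Sf /test_fnE [Sg [M sM]]; apply/test_fnE; split; first exact: smooth_mul.
by exists M; exact: bsupp_mulr.
Qed.

Lemma test0 : test_fn (fun _ : Pt d => C0).
Proof. by apply/test_fnE; split; [exact/EP_smooth/EP_const | exists 0]. Qed.

Lemma test_sum (I : Type) (r : seq I) (F : I -> Fn d) (c : I -> Cplx) : (forall i, test_fn (F i)) ->
  test_fn (fun x => \big[Cadd/C0]_(i <- r) Cmul (c i) (F i x)).
Proof.
move=> H; elim: r => [|i r IH].
  have := test0; congr test_fn; apply: functional_extensionality => x; by rewrite big_nil.
have := test_lin _ _ (c i) IH (H i); congr test_fn.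
by apply: functional_extensionality => x; rewrite big_cons CaddC.
Qed.

(** Being outside the cube is an open condition, so [f] vanishes on a whole segment through such a
    point and its difference quotients are 0. *)
Lemma partial_bsupp M f g i : bsupp d M f -> has_partial i f g -> bsupp d M g.
Proof.
move=> sf Pg x j hx.
have aux (h : R -> R) l e : 0 < e -> (forall s, Rabs s < e -> h s = 0) -> derivable_pt_lim h 0 l -> l = 0.
  move=> he hz Hl; apply: NNPP => nl.
  have hl : 0 < Rabs l by exact: Rabs_pos_lt.
  have [[del hd] /= Hd] := Hl _ hl.
  pose s := Rmin del e / 2.
  have hs : 0 < s < del /\ s < e.
    have := Rmin_l del e; have := Rmin_r del e; have := Rmin_pos _ _ hd he; rewrite /s; lra.
  have as_ : Rabs s = s by apply: Rabs_pos_eq; lra.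
  have := Hd s ltac:(lra) ltac:(rewrite as_; lra).
  rewrite Rplus_0_l !hz ?as_ ?Rabs_R0 //; try lra.
  by rewrite /Rdiv Rminus_0_r Rmult_0_l Rminus_0_l Rabs_Ropp; lra.
pose e := Rabs (x j) - M.
have he : 0 < e by rewrite /e; lra.
have hz s : Rabs s < e -> f (line x i s) = C0.
  move=> hs; apply: (sf _ j); rewrite /line /vadd /vscal.
  have := Rabs_triang (x j + s * unit_vec i j) (- (s * unit_vec i j)).
  rewrite Rabs_Ropp (_ : _ + - _ = x j); last by ring.
  have : Rabs (s * unit_vec i j) <= Rabs s.
    rewrite Rabs_mult /unit_vec; case: (_ == _); rewrite ?Rabs_R1 ?Rabs_R0; have := Rabs_pos s; lra.
  by move: hs; rewrite /e; lra.
have [H1 H2] := Pg x; rewrite (surjective_pairing (g x)); congr pair.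
  by apply: aux he _ H1 => s /hz; rewrite -/(line x i s) => ->.
by apply: aux he _ H2 => s /hz; rewrite -/(line x i s) => ->.
Qed.

Lemma deriv_family_bsupp M f D : bsupp d M f -> deriv_family f D -> forall l, bsupp d M (D l).
Proof.
move=> sf [E H]; elim=> [|i l IH]; first by rewrite E.
exact: partial_bsupp IH (proj2 (H l) i).
Qed.

Lemma deriv_family_lin f g c D E : deriv_family f D -> deriv_family g E ->
  deriv_family (fun x => Cadd (f x) (Cmul c (g x))) (fun l x => Cadd (D l x) (Cmul c (E l x))).
Proof.
move=> [D0 HD] [E0 HE]; split; first by rewrite D0 E0.
move=> l; split; first by apply: Ccont_lin; [exact: (proj1 (HD l)) | exact: (proj1 (HE l))].
move=> i; apply/has_partialE => x; apply: cderiv_add; first exact: (proj2 (HD l) i x).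
by apply: cderiv_scal; exact: (proj2 (HE l) i x).
Qed.

Lemma deriv_family_shift f y D : deriv_family f D ->
  deriv_family (fun x => f (vadd x y)) (fun l x => D l (vadd x y)).
Proof.
move=> [D0 HD]; split; first by rewrite D0.
move=> l; split; first by apply: Ccont_shift; exact: (proj1 (HD l)).
move=> i; apply/has_partialE => x; apply: cderiv_eq (proj2 (HD l) i (vadd x y)) _ _ => // s.
by congr (D l); apply: functional_extensionality => j; rewrite /line /vadd; ring.
Qed.

Lemma deriv_family_sum (I : Type) (r : seq I) (F : I -> Fn d) (c : I -> Cplx) (D : I -> seq 'I_d -> Fn d) :
  (forall i, deriv_family (F i) (D i)) ->
  deriv_family (fun x => \big[Cadd/C0]_(i <- r) Cmul (c i) (F i x))
    (fun l x => \big[Cadd/C0]_(i <- r) Cmul (c i) (D i l x)).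
Proof.
move=> H; elim: r => [|i r IH].
  split; first by apply: functional_extensionality => x; rewrite !big_nil.
  move=> l; have E : (fun x : Pt d => \big[Cadd/C0]_(i <- [::]) Cmul (c i) (D i l x)) = fun=> C0.
    by apply: functional_extensionality => x; rewrite big_nil.
  rewrite E; split; first exact/EP_Ccont/EP_const.
  by move=> i; apply/has_partialE => x; apply: cderiv_eq (cderiv_const C0 0) _ _ => // ; rewrite big_nil.
have := deriv_family_lin _ _ (c i) _ _ IH (H i); congr deriv_family.
  by apply: functional_extensionality => x; rewrite big_cons CaddC.
apply: functional_extensionality => l; apply: functional_extensionality => x.
by rewrite big_cons CaddC.
Qed.

(* By the mean value theorem the difference quotients of a compactly supported C^1 function
   converge uniformly. *)
Lemma uniform_quotient M g g' i : Ccont g' -> bsupp d M g' -> has_partial i g g' ->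
  forall eps, 0 < eps -> exists del, 0 < del /\ forall s x, Rabs s <= del ->
    Cnorm (Csub (Csub (g (line x i s)) (g x)) (Cmul (RtoC s) (g' x))) <= eps * Rabs s.
Proof.
move=> cg sg Pg eps he.
have [del [hd uc]] := compact_ucont _ _ _ cg sg (eps / 2) ltac:(lra).
exists del; split=> // s x hs.
have mvt (pr : Cplx -> R) : (forall z w, pr (Csub z w) = pr z - pr w) -> (forall z, Rabs (pr z) <= Cnorm z) ->
   (forall y, derivable_pt_lim (fun t => pr (g (line y i t))) 0 (pr (g' y))) ->
   Rabs (pr (g (line x i s)) - pr (g x) - s * pr (g' x)) <= eps / 2 * Rabs s.
  move=> prB prN Hp.
  have Hd t : derivable_pt_lim (fun t => pr (g (line x i t))) t (pr (g' (line x i t))).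
    have E : (fun u => pr (g (line x i u))) = Ranalysis1.comp (fun u => pr (g (line (line x i t) i u))) (fun u => u - t).
      apply: functional_extensionality => u; rewrite /Ranalysis1.comp; congr (pr (g _)).
      by apply: functional_extensionality => j; rewrite /line /vadd /vscal; ring.
    rewrite E; have h1 : derivable_pt_lim (fun u => u - t) t 1.
      by have := derivable_pt_lim_minus _ _ t _ _ (derivable_pt_lim_id t) (derivable_pt_lim_const t t); rewrite Rminus_0_r.
    have := derivable_pt_lim_comp _ (fun u => pr (g (line (line x i t) i u))) t 1 (pr (g' (line x i t))) h1.
    by rewrite Rmult_1_r; apply; rewrite Rminus_diag; exact: Hp.
  have [c [Hc hc]] := MVT_gen (fun t => pr (g (line x i t))) 0 s (fun t => pr (g' (line x i t)))
     (fun t _ => proj2 (is_derive_Reals _ _ _) (Hd t))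
     (fun t _ => derivable_continuous_pt _ _ (exist _ _ (Hd t))).
  move: hc; rewrite line0 Rminus_0_r => ->.
  rewrite (_ : _ * s - s * _ = (pr (g' (line x i c)) - pr (g' x)) * s); last by ring.
  rewrite Rabs_mult; apply: Rmult_le_compat_r; first exact: Rabs_pos.
  rewrite -prB; apply: Rle_trans (prN _) _; apply: uc => j.
  rewrite /line /vadd /vscal (_ : _ - x j = c * unit_vec i j); last by ring.
  have : Rabs c <= Rabs s.
    move: Hc; rewrite /Rmin /Rmax; case: Rle_dec => h [h1 h2].
      by rewrite !Rabs_pos_eq; lra.
    by rewrite !Rabs_left1; lra.
  rewrite Rabs_mult /unit_vec; case: (_ == _); rewrite ?Rabs_R1 ?Rabs_R0; have := Rabs_pos c; lra.
have h1 := mvt fst (fun z w => erefl) Cnorm_fst (fun y => proj1 (Pg y)).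
have h2 := mvt snd (fun z w => erefl) Cnorm_snd (fun y => proj2 (Pg y)).
apply: Rle_trans (Cnorm_le_sum _) _.
move: h1 h2; rewrite /Csub /Cadd /Copp /Cmul /RtoC /=.
rewrite (_ : fst (g (line x i s)) + - fst (g x) + - (s * fst (g' x) - 0 * snd (g' x)) =
   fst (g (line x i s)) - fst (g x) - s * fst (g' x)); last by ring.
rewrite (_ : snd (g (line x i s)) + - snd (g x) + - (s * snd (g' x) + 0 * fst (g' x)) =
   snd (g (line x i s)) - snd (g x) - s * snd (g' x)); last by ring.
lra.
Qed.

End Smooth.

(** * Convolution *)

Section Convolution.
Variable d : nat.
Implicit Types f g phi psi : Fn d.

Definition vsub (x y : Pt d) : Pt d := vadd x (vscal (-1) y).

Definition conv phi psi : Fn d := fun x => integral d (fun y => Cmul (psi (vsub x y)) (phi y)).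

Lemma Ccont_sub psi x : Ccont psi -> Ccont (fun y => psi (vsub x y)).
Proof.
move=> /(Ccont_affine d psi (-1) x); congr Ccont.
by apply: functional_extensionality => y; rewrite /vsub vaddC.
Qed.

Lemma conv_cc phi psi x : cc d phi -> Ccont psi -> cc d (fun y => Cmul (psi (vsub x y)) (phi y)).
Proof. by move=> cphi cpsi; apply: cc_mul => //; exact: Ccont_sub. Qed.

Lemma conv_bsupp M1 M2 phi psi : bsupp d M1 phi -> bsupp d M2 psi -> bsupp d (M1 + M2) (conv phi psi).
Proof.
move=> s1 s2 x i hx; rewrite /conv.
have -> : (fun y => Cmul (psi (vsub x y)) (phi y)) = fun=> C0; last exact: integral0.
apply: functional_extensionality => y.
case: (Rlt_le_dec M1 (Rabs (y i))) => h; first by rewrite (s1 y i h); ring.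
rewrite (s2 (vsub x y) i); first by ring.
rewrite /vsub /vadd /vscal.
have := Rabs_triang (x i + -1 * y i) (y i); rewrite (_ : _ + y i = x i); last by ring.
lra.
Qed.

(** The substitution [y -> x - y], composed of a shift and a reflection. *)
Lemma conv_comm phi psi : cc d phi -> cc d psi -> conv phi psi = conv psi phi.
Proof.
move=> cphi cpsi; apply: functional_extensionality => x; rewrite /conv.
have cg := conv_cc phi psi x cphi (proj1 cpsi).
rewrite -(integral_shift d _ x cg) -(integral_opp d _ (cc_shift d _ x cg)).
congr (integral d); apply: functional_extensionality => y.
rewrite (_ : vadd (vscal (-1) y) x = vsub x y); last by rewrite /vsub vaddC.
rewrite (_ : vsub x (vsub x y) = y); first by ring.
by apply: functional_extensionality => i; rewrite /vsub /vadd /vscal; ring.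
Qed.

(** [K] depends on [phi] only. With [g] a difference of translates of [psi], or the error of its
    difference quotient, the bound gives continuity and differentiability of the convolution. *)
Lemma conv_estimate phi : cc d phi -> exists K, 0 < K /\ forall g B, 0 <= B -> Ccont g ->
  (forall y, Cnorm (g y) <= B) -> Cnorm (integral d (fun y => Cmul (g y) (phi y))) <= B * K.
Proof.
move=> [cphi [M0 /bsupp_nonneg [M [hM sM]]]].
have [B0 hB0] := compact_bounded _ _ _ cphi sM.
have B0p : 0 <= B0 by apply: Rle_trans (hB0 (vzero d)); exact: Cnorm_ge0.
have hv : 0 < (2 * M + 5) ^ d by apply: pow_lt; lra.
exists ((B0 + 1) * (2 * M + 5) ^ d); split; first by apply: Rmult_lt_0_compat; lra.
move=> g B hB cg hg; rewrite -Rmult_assoc; apply: integral_bound => //.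
- by apply: Rmult_le_pos; lra.
- exact: bsupp_mulr.
- exact: Ccont_mul.
- move=> y; rewrite CnormM; apply: Rmult_le_compat; try exact: Cnorm_ge0; first exact: hg.
  by have := hB0 y; lra.
Qed.

Lemma integral_mul_lin phi f g c : cc d phi -> Ccont f -> Ccont g ->
  Cadd (integral d (fun y => Cmul (f y) (phi y))) (Cmul c (integral d (fun y => Cmul (g y) (phi y)))) =
  integral d (fun y => Cmul (Cadd (f y) (Cmul c (g y))) (phi y)).
Proof.
move=> cphi cf cg; rewrite -integral_lin; try exact: cc_mul.
by congr (integral d); apply: functional_extensionality => y; ring.
Qed.

Lemma conv_Ccont phi psi : cc d phi -> cc d psi -> Ccont (conv phi psi).
Proof.
move=> cphi [cpsi [M sM]]; have [K [hK est]] := conv_estimate _ cphi.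
apply/Ccont_coord => x eps he.
have [del [hd uc]] := compact_ucont _ _ _ cpsi sM (eps / (2 * K)) ltac:(apply: Rdiv_lt_0_compat; lra).
exists del; split=> // x' hx'.
have -> : Csub (conv phi psi x') (conv phi psi x) =
   Cadd (conv phi psi x') (Cmul (Copp Cone) (conv phi psi x)) by ring.
rewrite /conv integral_mul_lin //; try exact: Ccont_sub.
apply: Rle_lt_trans (est _ (eps / (2 * K)) _ _ _) _.
- by apply/Rlt_le/Rdiv_lt_0_compat; lra.
- by apply: Ccont_lin; exact: Ccont_sub.
- move=> y; rewrite (_ : Cadd _ _ = Csub (psi (vsub x' y)) (psi (vsub x y))); last by ring.
  apply: uc => i; apply: Rlt_le; apply: Rle_lt_trans (hx' i); apply: Req_le; congr Rabs.
  by rewrite /vsub /vadd; ring.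
- by rewrite (_ : eps / (2 * K) * K = eps / 2); [lra | field; lra].
Qed.

Lemma cderiv_of_estimate (f : R -> Cplx) l :
  (forall eps, 0 < eps -> exists del, 0 < del /\ forall s, Rabs s <= del ->
    Cnorm (Csub (Csub (f s) (f 0)) (Cmul (RtoC s) l)) <= eps * Rabs s) -> cderiv f 0 l.
Proof.
move=> H.
have aux (pr : Cplx -> R) : (forall z w, pr (Csub z w) = pr z - pr w) -> (forall z, Rabs (pr z) <= Cnorm z) ->
    (forall s z, pr (Cmul (RtoC s) z) = s * pr z) -> derivable_pt_lim (fun s => pr (f s)) 0 (pr l).
  move=> prB prN prZ eps he.
  have [del [hd Hd]] := H (eps / 2) ltac:(lra).
  exists (mkposreal del hd) => s ns /= hs; rewrite Rplus_0_l.
  have as_ : 0 < Rabs s by exact: Rabs_pos_lt.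
  have := Rle_trans _ _ _ (prN _) (Hd s (Rlt_le _ _ hs)); rewrite !prB prZ => h.
  have -> : (pr (f s) - pr (f 0)) / s - pr l = (pr (f s) - pr (f 0) - s * pr l) * / s by field.
  rewrite Rabs_mult Rabs_inv; apply: (Rmult_lt_reg_r (Rabs s)) => //.
  rewrite Rmult_assoc Rinv_l; last lra.
  by have := Rmult_lt_0_compat _ _ he as_; lra.
split; [apply: (aux fst) | apply: (aux snd)] => //; try exact: Cnorm_fst; try exact: Cnorm_snd;
  by move=> s z; rewrite /Cmul /RtoC /=; ring.
Qed.

Lemma conv_partial phi psi psi' i : cc d phi -> cc d psi -> cc d psi' -> has_partial i psi psi' ->
  has_partial i (conv phi psi) (conv phi psi').
Proof.
move=> cphi [cpsi _] [cpsi' [M sM]] Pp; have [K [hK est]] := conv_estimate _ cphi.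
apply/has_partialE => x; apply: cderiv_of_estimate => eps he.
have [del [hd Hq]] := uniform_quotient d M psi psi' i cpsi' sM Pp (eps / K) ltac:(exact: Rdiv_lt_0_compat).
exists del; split=> // s hs; rewrite line0.
have -> : Csub (Csub (conv phi psi (line d x i s)) (conv phi psi x)) (Cmul (RtoC s) (conv phi psi' x)) =
  Cadd (Cadd (conv phi psi (line d x i s)) (Cmul (Copp Cone) (conv phi psi x)))
    (Cmul (Copp (RtoC s)) (conv phi psi' x)) by ring.
have h1 : Ccont (fun y => Cadd (psi (vsub (line d x i s) y)) (Cmul (Copp Cone) (psi (vsub x y)))).
  by apply: Ccont_lin; exact: Ccont_sub.
rewrite /conv !integral_mul_lin //; try exact: Ccont_sub.
have -> : eps * Rabs s = (eps / K * Rabs s) * K by field; lra.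
apply: est.
- by apply: Rmult_le_pos; [exact/Rlt_le/Rdiv_lt_0_compat | exact: Rabs_pos].
- by apply: Ccont_lin => //; exact: Ccont_sub.
- move=> y; have := Hq s (vsub x y) hs; congr (Cnorm _ <= _).
  have -> : line d (vsub x y) i s = vsub (line d x i s) y.
    by apply: functional_extensionality => j; rewrite /line /vsub /vadd; ring.
  by ring.
Qed.

Lemma conv_deriv_family phi psi D : cc d phi -> compactly_supported d psi -> deriv_family psi D ->
  deriv_family (conv phi psi) (fun l => conv phi (D l)).
Proof.
move=> cphi [M sM] HD; have sD := deriv_family_bsupp d M psi D sM HD.
have ccD l : cc d (D l) by split; [exact: (proj1 (proj2 HD l)) | exists M].
split; first by rewrite (proj1 HD).
move=> l; split; first exact: conv_Ccont.
by move=> i; apply: conv_partial => //; exact: (proj2 (proj2 HD l) i).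
Qed.

Lemma conv_test phi psi : cc d phi -> test_fn psi -> test_fn (conv phi psi).
Proof.
move=> cphi /test_fnE [[D HD] sp]; apply/test_fnE; split.
  by exists (fun l => conv phi (D l)); exact: conv_deriv_family.
have [_ [M1 s1]] := cphi; have [M2 s2] := sp.
by exists (M1 + M2); exact: conv_bsupp.
Qed.

End Convolution.

(** * Distributions *)

Section Distribution.
Variables (d : nat) (T : Fn d -> Cplx).
Hypothesis HT : distribution T.
Implicit Types phi psi : Fn d.

Lemma dist_lin phi psi c : test_fn phi -> test_fn psi ->
  T (fun x => Cadd (phi x) (Cmul c (psi x))) = Cadd (T phi) (Cmul c (T psi)).
Proof.
move=> tp ts; have [HA [HZ _]] := HT.
have tz : test_fn (fun x => Cmul c (psi x)).
  by have := test_lin d _ _ c (test0 d) ts; congr test_fn; apply: functional_extensionality => x; ring.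
by rewrite HA // HZ.
Qed.

Lemma dist0 : T (fun=> C0) = C0.
Proof.
have := dist_lin _ _ (Copp Cone) (test0 d) (test0 d).
have -> : (fun _ : Pt d => Cadd C0 (Cmul (Copp Cone) C0)) = fun=> C0.
  by apply: functional_extensionality => x; ring.
by move=> ->; ring.
Qed.

Lemma dist_sum (I : Type) (r : seq I) (F : I -> Fn d) (c : I -> Cplx) : (forall i, test_fn (F i)) ->
  T (fun x => \big[Cadd/C0]_(i <- r) Cmul (c i) (F i x)) =
  \big[Cadd/C0]_(i <- r) Cmul (c i) (T (F i)).
Proof.
move=> H; elim: r => [|i r IH].
  rewrite big_nil -[RHS]dist0; congr T.
  by apply: functional_extensionality => x; rewrite big_nil.
rewrite big_cons -IH CaddC -dist_lin //; last exact: test_sum.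
by congr T; apply: functional_extensionality => x; rewrite big_cons CaddC.
Qed.

Definition translate (y : Pt d) phi : Fn d := fun x => phi (vsub d x y).

Lemma test_translate y phi : test_fn phi -> test_fn (translate y phi).
Proof. exact: test_shift. Qed.

(* The regularization of T by phi; in the usual notation it is T * phi(- .). *)
Definition regular phi : Fn d := fun y => T (translate y phi).

(** Translation is continuous in the space of test functions: each derivative is uniformly
    continuous, and the supports stay in one cube because a convergent sequence of shifts is
    bounded. *)
Lemma regular_Ccont phi : test_fn phi -> Ccont (regular phi).
Proof.
move=> tp; have /test_fnE [[D HD] [M sM]] := tp.
apply/Ccont_scont => u y Hu.
have [_ [_ Hcv]] := HT; apply: Hcv => [n||]; try exact: test_translate.
have /(choice (fun i b => forall n, Rabs (u n i) <= b)) [b Hb] : forall i, exists b, forall n, Rabs (u n i) <= b.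
  by move=> i; have [b [_ hb]] := maj_by_pos _ (exist _ _ (Hu i)); exists b.
pose M' := M + vnorm b + vnorm y.
have sup z : (forall i, Rabs (z i) <= vnorm b + vnorm y) -> bsupp d M' (translate z phi).
  move=> hz x i hx; apply: (sM _ i); rewrite /vsub /vadd /vscal.
  have := Rabs_triang (x i + -1 * z i) (z i); rewrite (_ : _ + z i = x i); last by ring.
  by have := hz i; move: hx; rewrite /M'; lra.
have hb n i : Rabs (u n i) <= vnorm b + vnorm y.
  by have := Hb i n; have := Rle_abs (b i); have := vnorm_coord _ b i; have := vnorm_ge0 _ y; lra.
exists (INR d * M'); split; first apply: bsupp_supp_in.
  by apply: sup => i; have := vnorm_coord _ y i; have := vnorm_ge0 _ b; lra.
split; first by move=> n; apply: bsupp_supp_in; apply: sup; exact: hb.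
exists (fun n l => translate (u n) (D l)), (fun l => translate y (D l)).
split; first exact: deriv_family_shift.
split; first by move=> n; exact: deriv_family_shift.
move=> l eps he.
have uc := compact_ucont _ _ _ (proj1 (proj2 HD l)) (deriv_family_bsupp d M phi D sM HD l).
have [del [hd Hd]] := uc (eps / 2) ltac:(lra).
have [N HN] := eventually_all d (fun i n => Rabs (u n i - y i) < del)
  (fun i => let: ex_intro N HN := Hu i del hd in
            ex_intro _ N (fun n hn => HN n (elimT leP hn))).
exists N => n x /HN hn; apply: (Rle_lt_trans _ (eps / 2)); last lra.
apply: Hd => i; apply: Rlt_le; apply: Rle_lt_trans (hn i); rewrite -Rabs_Ropp.
by apply: Req_le; congr Rabs; rewrite /vsub /vadd /vscal; ring.
Qed.

(* The Riemann sums of the convolution converge to it in the space of test functions. *)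
Lemma dist_conv phi psi : test_fn phi -> test_fn psi ->
  T (conv d phi psi) = integral d (fun y => Cmul (regular psi y) (phi y)).
Proof.
move=> tp ts; have cp := test_cc d _ tp.
have /test_fnE [[D HD] sps] := ts.
have [cphi [M0 /bsupp_nonneg [M [hM sM]]]] := cp.
have [M2 [hM2 sM2]] : exists M2, 0 <= M2 /\ bsupp d M2 psi by case: sps => ? /bsupp_nonneg.
pose w n (k : {ffun 'I_d -> Z}) := Cmul (RtoC (/ INR n.+1 ^ d)) (phi (grid d n.+1 k)).
pose P n : Fn d := fun x => \big[Cadd/C0]_(k <- box d M n.+1) Cmul (w n k) (translate (grid d n.+1 k) psi x).
have PE n g x : \big[Cadd/C0]_(k <- box d M n.+1) Cmul (w n k) (translate (grid d n.+1 k) g x) =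
   grid_sum d M n.+1 (fun y => Cmul (g (vsub d x y)) (phi y)).
  rewrite /grid_sum (big_distrr (times := Cmul)) /=; apply: eq_bigr => k _.
  by rewrite /w /translate /=; ring.
have tP n : test_fn (P n) by apply: test_sum => k; exact: test_translate.
have lim : Cv (fun n => T (P n)) (T (conv d phi psi)).
  have [_ [_ Hcv]] := HT; apply: Hcv => //; first exact: conv_test.
  exists (INR d * (M + M2)); split; first by apply/bsupp_supp_in/conv_bsupp.
  split.
    move=> n; apply: bsupp_supp_in => x i hx; rewrite /P big1 // => k _; rewrite /w /translate.
    case: (Rlt_le_dec M (Rabs (grid d n.+1 k i))) => h; first by rewrite (sM _ i h); ring.
    rewrite (sM2 _ i); first by ring.
    rewrite /vsub /vadd /vscal.
    have := Rabs_triang (x i + -1 * grid d n.+1 k i) (grid d n.+1 k i).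
    rewrite (_ : _ + grid d n.+1 k i = x i); last by ring.
    lra.
  exists (fun n l x => \big[Cadd/C0]_(k <- box d M n.+1) Cmul (w n k) (translate (grid d n.+1 k) (D l) x)),
    (fun l => conv d phi (D l)).
  split; first exact: conv_deriv_family.
  split.
    move=> n; apply: (deriv_family_sum d _ _ (fun k => translate (grid d n.+1 k) psi) (w n)
      (fun k l => translate (grid d n.+1 k) (D l))) => k.
    exact: deriv_family_shift.
  move=> l eps he.
  have cD := proj1 (proj2 HD l); have sD := deriv_family_bsupp d M2 psi D sM2 HD l.
  have [B1 hB1] := compact_bounded _ _ _ cphi sM; have [B2 hB2] := compact_bounded _ _ _ cD sD.
  have B1p : 0 <= B1 by apply: Rle_trans (hB1 (vzero d)); exact: Cnorm_ge0.
  have B2p : 0 <= B2 by apply: Rle_trans (hB2 (vzero d)); exact: Cnorm_ge0.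
  have hv : 0 < (2 * M + 5) ^ d by apply: pow_lt; lra.
  (* [B1] and [B2] bound [phi] and [D l], so the integrand oscillates by at most [e (B1 + B2)] on
     the mesh; the factor 2 makes the final inequality strict. *)
  pose e := eps / (2 * (2 * M + 5) ^ d * (B1 + B2 + 1)).
  have hden : 0 < 2 * (2 * M + 5) ^ d * (B1 + B2 + 1) by apply: Rmult_lt_0_compat; lra.
  have hep : 0 < e by apply: Rdiv_lt_0_compat.
  have [d1 [hd1 uc1]] := compact_ucont _ _ _ cphi sM e hep.
  have [d2 [hd2 uc2]] := compact_ucont _ _ _ cD sD e hep.
  have [n1 hn1] := small_invS _ hd1; have [n2 hn2] := small_invS _ hd2.
  exists (maxn n1 n2) => n x; rewrite geq_max => /andP [/hn1 h1 /hn2 h2].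
  rewrite PE Cnorm_sub_sym.
  apply: (Rle_lt_trans _ (e * (B1 + B2 + 1) * (2 * M + 5) ^ d)); last first.
    by rewrite (_ : _ * _ = eps / 2); [lra | rewrite /e; field; lra].
  apply: integral_error => //.
  - by apply: Rmult_le_pos; lra.
  - exact: bsupp_mulr.
  - by apply: Ccont_mul => //; exact: Ccont_sub.
  move=> y y' hy.
  have -> : Csub (Cmul (D l (vsub d x y)) (phi y)) (Cmul (D l (vsub d x y')) (phi y')) =
    Cadd (Cmul (Csub (D l (vsub d x y)) (D l (vsub d x y'))) (phi y))
         (Cmul (D l (vsub d x y')) (Csub (phi y) (phi y'))) by ring.
  apply: Rle_trans (Cnorm_triangle _ _) _; rewrite !CnormM.
  have k1 : Cnorm (Csub (phi y) (phi y')) <= e.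
    by apply: uc1 => i; apply: Rle_trans (hy i) h1.
  have k2 : Cnorm (Csub (D l (vsub d x y)) (D l (vsub d x y'))) <= e.
    apply: uc2 => i; apply: Rle_trans h2; apply: Rle_trans (hy i); rewrite -Rabs_Ropp.
    by apply: Req_le; congr Rabs; rewrite /vsub /vadd /vscal; ring.
  have := Rmult_le_compat _ _ _ _ (Cnorm_ge0 _) (Cnorm_ge0 _) k2 (hB1 y).
  have := Rmult_le_compat _ _ _ _ (Cnorm_ge0 _) (Cnorm_ge0 _) (hB2 (vsub d x y')) k1.
  by lra.
apply: Cv_unique lim _.
have := integral_grid_sum d M (fun y => Cmul (regular psi y) (phi y)) hM (bsupp_mulr d _ _ _ sM)
   (Ccont_mul d _ _ (regular_Ccont psi ts) cphi).
apply: Cv_ext => n; rewrite /P dist_sum; last by move=> k; exact: test_translate.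
rewrite /grid_sum (big_distrr (times := Cmul)) /=; apply: eq_bigr => k _.
rewrite /w /regular -/(INR n.+1).
have E a b c : Cmul a (Cmul b c) = Cmul (Cmul a c) b by ring.
exact: E.
Qed.

Lemma regular_symmetry phi psi : test_fn phi -> test_fn psi ->
  integral d (fun y => Cmul (regular psi y) (phi y)) = integral d (fun y => Cmul (regular phi y) (psi y)).
Proof.
by move=> tp ts; rewrite -!dist_conv // (conv_comm d phi psi) //; exact: test_cc.
Qed.

Lemma regular0 phi : regular phi (vzero d) = T phi.
Proof.
congr T; apply: functional_extensionality => x; congr phi.
by apply: functional_extensionality => i; rewrite /vsub /vadd /vscal /vzero; ring.
Qed.

(* Test against psi = conj(F) |phi(. + x0)|^2 with F = regular phi and phi x0 <> 0: it is a test
   function because F is smooth, and no bump function has to be constructed. *)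
Lemma regular_weak_zero phi : test_fn phi -> exp_poly d (regular phi) ->
  (forall psi, test_fn psi -> integral d (fun y => Cmul (regular phi y) (psi y)) = C0) -> T phi = C0.
Proof.
move=> tp ep Hz.
case: (classic (forall x, phi x = C0)) => [z|nz].
  by rewrite -dist0; congr T; exact: functional_extensionality.
have [x0 hx0] := not_all_ex_not _ _ nz.
pose F := regular phi.
pose s x := phi (vadd x x0).
pose psi x := Cmul (Cconj (F x)) (Cmul (Cconj (s x)) (s x)).
have ts : test_fn s by exact: test_shift.
have tpsi : test_fn psi.
  apply: test_mul; first exact/smooth_conj/EP_smooth.
  by apply: test_mul => //; case: (proj1 (test_fnE d _) (test_conj d _ ts)).
(* [w] is [|F|^2 |s|^2]. The shift in [s] moves [x0] to the origin, where [F] takes the value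
   [T phi]. *)
pose w x := (fst (F x) ^ 2 + snd (F x) ^ 2) * (fst (s x) ^ 2 + snd (s x) ^ 2).
have E : (fun x => RtoC (w x)) = fun x => Cmul (F x) (psi x).
  apply: functional_extensionality => x; rewrite /psi /w /Cmul /Cconj /RtoC /=; congr pair; ring.
have w0 : w (vzero d) = 0.
  apply: (integral_eq0 d w).
  - by move=> x; apply: Rmult_le_pos; apply: Rplus_le_le_0_compat; exact: pow2_ge_0.
  - by rewrite E; apply: cc_mul; [exact: EP_Ccont | exact: test_cc].
  - by rewrite E; exact: Hz.
have s0 : s (vzero d) = phi x0 by rewrite /s vaddC vadd0.
move: w0; rewrite /w s0 /F regular0 => /Rmult_integral [] h.
  by apply: Cnorm_eq0; rewrite /Cnorm h sqrt_0.
by case: hx0; apply: Cnorm_eq0; rewrite /Cnorm h sqrt_0.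
Qed.

(** * Distributions of finite rank *)

Section FiniteRankDistribution.

Let tests := {phi : Fn d | test_fn phi}.
Let pairing (e : Fn d) (p : tests) : Cplx := integral d (fun x => Cmul (e x) (proj1_sig p x)).

Lemma insp_pairing (s : seq (Fn d)) (e : Fn d) : List.Forall (exp_poly d) s -> Ccont e ->
  insp s e -> insp [seq pairing b | b <- s] (pairing e).
Proof.
move=> Hs; elim: Hs e => [|b s' Eb _ IH] e ce /=.
  move=> He p; rewrite /pairing -[RHS](integral0 d); congr (integral d).
  by apply: functional_extensionality => x; rewrite He; ring.
move=> [c Hc]; exists c.
have -> : (fun p => Csub (pairing e p) (Cmul c (pairing b p))) = pairing (fun x => Csub (e x) (Cmul c (b x))).
  apply: functional_extensionality => -[p tp]; rewrite /pairing /=.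
  have -> : forall a b, Csub a (Cmul c b) = Cadd a (Cmul (Copp c) b) by move=> *; ring.
  rewrite integral_mul_lin //; [|exact: test_cc|exact: EP_Ccont].
  by congr (integral d); apply: functional_extensionality => x; ring.
apply: IH => //; have := Ccont_lin d e b (Copp c) ce (EP_Ccont d _ Eb); congr Ccont.
by apply: functional_extensionality => x; ring.
Qed.

Lemma finite_rank_dist (l : seq (tests * (tests -> Cplx))) :
  (forall y p, regular (proj1_sig p) y =
     \big[Cadd/C0]_(q <- l) Cmul (regular (proj1_sig q.1) y) (q.2 p)) ->
  exists e, exp_poly d e /\ forall phi, test_fn phi -> T phi = integral d (fun x => Cmul (e x) (phi x)).
Proof.
move=> Hl.
pose E (q : tests * (tests -> Cplx)) := regular (proj1_sig q.1).
(* Shifting the argument of [regular p] by [z] amounts to translating [p], so the hypothesis at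
   [translate z p] puts all translates of [regular p] in the span of the [E q]. *)
have EP p : test_fn p -> exp_poly d (regular p).
  move=> tp; apply: (finite_rank_exp_poly d _ [seq E q | q <- l]); first exact: regular_Ccont.
  move=> z.
  have -> : (fun y => regular p (vadd y z)) =
      fun y => \big[Cadd/C0]_(q <- l) Cmul (q.2 (exist _ _ (test_translate z p tp))) (E q y).
    apply: functional_extensionality => y.
    have := Hl y (exist _ _ (test_translate z p tp)) => /= h.
    transitivity (regular (translate z p) y).
      congr T; apply: functional_extensionality => x; congr p.
      by apply: functional_extensionality => i; rewrite /vsub /vadd /vscal; ring.
    by rewrite h; apply: eq_bigr => q _; exact: CmulC.
  pose c (q : tests * (tests -> Cplx)) := q.2 (exist _ _ (test_translate z p tp)).
  elim: (l) => [|q l' IH].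
    by move=> x; rewrite big_nil.
  exists (c q); have := IH; congr insp.
  by apply: functional_extensionality => y; rewrite big_cons /c; ring.
have EE q : exp_poly d (E q) by apply: EP; case: q.1.
pose S := [seq pairing (E q) | q <- l].
(* The elements of the span of [S] are functionals, so the reproducing points are test functions,
   and [q.2] is a functional that gives the coefficient of [q.1]. *)
have [l2 [Vl2 El2]] := reproducing_points _ _ S (insp_subspace _ S) (fun w Hw => Hw).
pose V (w : tests -> Cplx) := exists e, exp_poly d e /\ forall p, w p = pairing e p.
have sV : subspace V.
  split.
    exists (fun=> C0); split; first exact: EP_const.
    move=> p; rewrite /pairing -[LHS](integral0 d); congr (integral d).
    by apply: functional_extensionality => x; ring.
  move=> c u v [e [Ee He]] [e' [Ee' He']].
  exists (fun x => Cadd (e x) (Cmul c (e' x))); split.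
    by apply: EP_add => //; apply: EP_mul => //; exact: EP_const.
  move=> [p tp]; rewrite He He' /pairing /= integral_mul_lin //; try exact: EP_Ccont.
  exact: test_cc.
have VS w : insp S w -> V w.
  apply: insp_in => // i; rewrite size_map => hi.
  pose q0 : tests * (tests -> Cplx) := (exist _ _ (test0 d), fun=> C0).
  by rewrite (nth_map q0) //; exists (E (nth q0 l i)).
suff [e [Ee He]] : V (fun p => T (proj1_sig p)).
  by exists e; split=> // phi tp; rewrite (He (exist _ phi tp)).
have -> : (fun p : tests => T (proj1_sig p)) = rsum l2 (fun p => T (proj1_sig p)).
  apply: functional_extensionality => -[phi tp] /=.
  (* Every functional in the span of [S] takes the same value on the subtracted sum as on [phi],
     hence vanishes at [phi']. *)
  pose phi' x := Cadd (phi x) (Cmul (Copp Cone)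
     (\big[Cadd/C0]_(q <- l2) Cmul (q.2 (exist _ phi tp)) (proj1_sig q.1 x))).
  have tsum : test_fn (fun x => \big[Cadd/C0]_(q <- l2) Cmul (q.2 (exist _ phi tp)) (proj1_sig q.1 x)).
    by apply: test_sum => q; case: q.1.
  have tphi' : test_fn phi' by exact: test_lin.
  have T0 : T phi' = C0.
    apply: regular_weak_zero => //; first exact: EP.
    move=> psi ts; rewrite -regular_symmetry //.
    have -> : (fun y => Cmul (regular psi y) (phi' y)) =
      fun y => \big[Cadd/C0]_(q <- l) Cmul (q.2 (exist _ psi ts)) (Cmul (E q y) (phi' y)).
      apply: functional_extensionality => y.
      have := Hl y (exist _ psi ts) => /= ->.
      by rewrite (big_distrl (times := Cmul)) /=; apply: eq_bigr => q _; rewrite /E; ring.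
    have [_ ->] := integral_sum d _ l (fun q y => Cmul (E q y) (phi' y)) (fun q => q.2 (exist _ psi ts))
      (fun q => cc_mul d _ _ (EP_Ccont d _ (EE q)) (test_cc d _ tphi')).
    have vanish w : insp S w -> forall e, exp_poly d e -> (forall p, w p = pairing e p) -> 
        integral d (fun y => Cmul (e y) (phi' y)) = C0.
      move=> Sw e Ee He; have := El2 w Sw (exist _ phi tp); rewrite /rsum He => h.
      have h2 : integral d (fun y => Cmul (e y) (phi' y)) = Cadd (pairing e (exist _ phi tp)) (Cmul (Copp Cone)
         (\big[Cadd/C0]_(q <- l2) Cmul (q.2 (exist _ phi tp)) (pairing e q.1))).
        have [c2 <-] := integral_sum d _ l2 (fun q y => Cmul (e y) (proj1_sig q.1 y))
           (fun q => q.2 (exist _ phi tp))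
           (fun q => cc_mul d _ _ (EP_Ccont d _ Ee) (test_cc d _ (proj2_sig q.1))).
        rewrite /pairing /= -integral_lin //; last by apply: cc_mul; [exact: EP_Ccont | exact: test_cc].
        congr (integral d); apply: functional_extensionality => y; rewrite /phi'.
        under [X in _ = Cadd _ (Cmul _ X)]eq_bigr => q _ do rewrite CmulA (CmulC (q.2 _)) -CmulA.
        by rewrite -(big_distrr (times := Cmul)) /=; ring.
      rewrite h2 h.
      under eq_bigr => q _ do rewrite He CmulC.
      by ring.
    have zq q : List.In q l -> integral d (fun y => Cmul (E q y) (phi' y)) = C0.
      move=> hq; apply: (vanish (pairing (E q))) => //.
      move: hq; rewrite /S; elim: (l) => [//|a r IHr] [->|/IHr]; last exact: insp_cons.
      by exists Cone; have := proj1 (insp_subspace _ [seq pairing (E q) | q <- r]);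
        congr insp; apply: functional_extensionality => p; ring.
    move: zq; elim: (l) => [|q l' IH] zq; first by rewrite big_nil.
    rewrite big_cons IH; last by move=> q' hq'; apply: zq; right.
    by rewrite zq; [ring | left].
  (* Expanded by linearity, [T phi' = 0] says that [l2] reproduces [T] itself, which puts [T] in the
     span of [S]. *)
  move: T0; rewrite /phi' dist_lin // dist_sum; last by move=> q; case: q.1.
  move=> h; rewrite /rsum; apply: Csub_eq0; rewrite -[RHS]h.
  have -> : forall a b, Csub a b = Cadd a (Cmul (Copp Cone) b) by move=> *; ring.
  by congr (Cadd _ (Cmul _ _)); apply: eq_bigr => q _; exact: CmulC.
by apply: rsum_in => // i p0 hi; apply: VS; exact: Vl2.
Qed.

End FiniteRankDistribution.
End Distribution.

(** * The case of distributions *)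

Theorem distribution_case (d t : nat) (h : 'I_t -> Pt d) (m : 'I_t -> nat) (T : Fn d -> Cplx) :
  dense_subgroup h -> distribution T ->
  (forall k : 'I_t, dist_exp_poly (DeltaD (h k) (m k) T)) -> dist_exp_poly T.
Proof.
move=> dh HT He.
pose tests := {phi : Fn d | test_fn phi}.
pose pairing (e : Fn d) (p : tests) : Cplx := integral d (fun x => Cmul (e x) (proj1_sig p x)).
pose A (y : Pt d) (p : tests) := regular d T (proj1_sig p) y.
have [e Hee] := choice _ He.
have [W HW] : exists W, forall k y, insp W (pairing (fun x => e k (vadd x y))).
  apply: (insp_collect _ _ _ (fun k y => pairing (fun x => e k (vadd x y)))) => k.
  have /is_exp_poly_EP Ee := proj1 (Hee k).
  have [s [Es Hs]] := EP_finite_rank d _ Ee.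
  exists [seq pairing b | b <- s] => y; apply: insp_pairing => //.
  exact/Ccont_shift/EP_Ccont.
have [|p|l Hl] := dense_reproducing _ d t h m A W _ dh _.
- move=> k y; have := HW k y; congr insp; apply: functional_extensionality => -[phi tp].
  have Ee := is_exp_poly_EP d _ (proj1 (Hee k)).
  have cct := test_cc d _ (test_translate d y _ tp).
  have ty : test_fn (translate d y phi) by exact: test_translate.
  (* The difference of [T] at the translated test function is, on one side, the integral of [e k]
     against [phi (. - y)], that is, of [e k (. + y)] against [phi]; on the other side, linearity of
     [T] expands it into the recurrence for [A]. *)
  transitivity (DeltaD (h k) (m k) T (translate d y phi)).
    apply: Cv_unique (proj2 (Hee k) _ ty).
    have := integral_riemann d _ (cc_mul d _ _ (EP_Ccont d _ Ee) cct).
    rewrite -(integral_shift d _ y); last by apply: cc_mul => //; exact: EP_Ccont.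
    congr Cv; congr (integral d); apply: functional_extensionality => x; congr Cmul; congr phi.
    by apply: functional_extensionality => i; rewrite /vsub /vadd /vscal; ring.
  rewrite /DeltaD /FDelta /Ftau /A /regular.
  have := dist_sum d T HT _ (index_enum 'I_(m k).+1)
    (fun j => translate d (vadd y (vscal (INR j) (h k))) phi) (fun j => dcoef (m k) j)
    (fun j => test_translate d _ _ tp).
  move=> <-; congr T; apply: functional_extensionality => x; apply: eq_bigr => j _.
  congr Cmul; congr phi; apply: functional_extensionality => i.
  by rewrite /vsub /vadd /vscal; ring.
- by case: p => phi tp; exact: regular_Ccont.
have [e0 [Ee0 He0]] := finite_rank_dist d T HT l (fun y p => Hl y p).
exists e0; split; first exact: EP_is_exp_poly.
move=> phi tp; rewrite He0 //; apply: integral_riemann.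
by apply: cc_mul; [exact: EP_Ccont | exact: test_cc].
Qed.

Theorem theorem4 :
  (* case X_d = C(R^d) *)
  (forall (d t : nat) (h : 'I_t -> Pt d) (m : 'I_t -> nat) (f : Fn d),
     dense_subgroup h -> Ccont f ->
     (forall k : 'I_t, is_exp_poly (FDelta (h k) (m k) f)) ->
     is_exp_poly f) /\
  (* case X_d = D(R^d)' *)
  (forall (d t : nat) (h : 'I_t -> Pt d) (m : 'I_t -> nat) (T : Fn d -> Cplx),
     dense_subgroup h -> distribution T ->
     (forall k : 'I_t, dist_exp_poly (DeltaD (h k) (m k) T)) ->
     dist_exp_poly T).
Proof.
split=> [d t h m f dh cf He|]; last exact: distribution_case.
by apply: EP_is_exp_poly; exact: continuous_case dh cf He.
Qed.
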